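(* Let $\alpha\in\mathbb C\setminus\mathbb R$, let $(L,K)$ be an admissible pair of isotropic lines in $\mathbb C^7$, and let $h\in\mathcal L_-^\tau(\mathbb G_2,\mathbb C^7)$ be holomorphic at $\alpha$ (and thus at $\bar\alpha$). Define $$K'=h(\alpha)^{-1}K,\qquad p_{\alpha,K}*h=p_{\alpha,K}\,h\,p_{\alpha,K'}^{-1},\qquad L'=\big((p_{\alpha,K}*h)(\alpha)\big)^{-1}L .$$ Then the pair $(L',K')$ is admissible. Therefore $p_{\alpha,L',K'}\in\mathcal L_-^\tau(\mathbb G_2,\mathbb C^7)$ has simple poles at $\alpha$ and $\bar\alpha$. Furthermore $$p_{\alpha,L,K}\,h\,p_{\alpha,L',K'}^{-1}$$ is in $\mathcal L_-^\tau(\mathbb G_2,\mathbb C^7)$ and is holomorphic at $\alpha$ and $\bar\alpha$.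
   Context: Let $\mathbb O$ be the octonions, $\mathbb R^7=\mathrm{Im}(\mathbb O)$, $\mathbb C^7=\mathrm{Im}(\mathbb O)\otimes\mathbb C$. Let $\langle\cdot,\cdot\rangle$ be the complex bilinear extension of the standard inner product, with $\perp$ and ''isotropic'' taken with respect to it. $\mathbb G_2\subset\mathrm{SO}(7,\mathbb C)$ is the automorphism group of $\mathbb O\otimes\mathbb C$ acting on $\mathbb C^7$. For $x,y\in\mathbb C^7$, $x\cdot y\in\mathbb C^7$ is the imaginary part of their octonionic product. A complex coassociative plane is an isotropic $2$-dimensional complex subspace $\mathcal C\subset\mathbb C^7$ with $\mathcal C\cdot\mathcal C=0$. For $\alpha\in\mathbb C\setminus\mathbb R$ and an isotropic line $L$, $p_{\alpha,L}(\lambda)=\frac{\lambda-\bar\alpha}{\lambda-\alpha}\pi_{\bar L}+\pi_{(L\oplus\bar L)^\perp}+\frac{\lambda-\alpha}{\lambda-\bar\alpha}\pi_L$, with projections relative to $\mathbb C^7=L\oplus(L\oplus\bar L)^\perp\oplus\bar L$. Call a pair $(L,K)$ of isotropic lines admissible if $K\subset\bar L^\perp$ and $L\oplus\pi_{(L\oplus\bar L)^\perp}K$ is a complex coassociative plane; for admissible pairs put $p_{\alpha,L,K}=p_{\alpha,L}p_{\alpha,K}$. Loops in $\mathbb G_2$ are holomorphic maps $g:U\to\mathbb G_2$, $U\subset\mathbb{CP}^1$ open and dense; loops agreeing on an open dense set are identified, and multiplication is pointwise. A loop in a group is holomorphic at a point if it extends holomorphically, as a group-valued map, near that point. $\mathcal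 L_-^\tau(\mathbb G_2,\mathbb C^7)$ is the group of loops that are rational ($g:\mathbb{CP}^1\to\mathrm{End}(\mathbb C^7)$ meromorphic), holomorphic at $\infty$ with $g(\infty)=\mathrm{Id}$, and satisfy $\overline{g(\bar\lambda)}=g(\lambda)$. The loop $p_{\alpha,K}*h$ is holomorphic at $\alpha$ as a loop in $\mathrm{SO}(7,\mathbb C)$, so $L'$ is well defined. *)

(* Defs.v *)
From HB Require Import structures.
From mathcomp Require Import all_boot all_order all_algebra.
From mathcomp Require Import complex ring.
From mathcomp Require Import all_classical all_reals all_analysis.
Import Order.TTheory GRing.Theory Num.Theory.
Import numFieldNormedType.Exports.

Set Implicit Arguments.
Unset Strict Implicit.
Unset Printing Implicit Defensive.

Local Open Scope classical_set_scope.
Local Open Scope ring_scope.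

(* Folding R[i] into a constant of type numClosedFieldType makes the generic
   normed and topological structures of numeric fields available on it. *)
Definition Cplx (R : realType) : numClosedFieldType := R[i].

Section Octonions.
Context {C : comNzRingType}.
Implicit Types x y : 'cV[C]_7.

(* Bilinear, not sesquilinear. *)
Definition dotC x y : C := (x^T *m y) 0 0.

(* Imaginary part of the product of two imaginary octonions, from the Fano
   table e_i e_(i+1) = e_(i+3) (indices in Z/7), extended by cyclic permutation
   of (i, i+1, i+3) and by antisymmetry. *)
Definition crossO x y : 'cV[C]_7 :=
  \col_(k < 7) \sum_(ab <- [:: (1, 3); (2, 6); (4, 5)] : seq ('I_7 * 'I_7))
    (x (k + ab.1) 0 * y (k + ab.2) 0 - x (k + ab.2) 0 * y (k + ab.1) 0).

(* (a, x) stands for a + x with a real and x imaginary.  Over a real field this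
   is the algebra of octonions, over its complexification O (x) C. *)
Definition oct : Type := (C^o * 'cV[C]_7)%type.

Definition mulO (u v : oct) : oct :=
  (u.1 * v.1 - dotC u.2 v.2,
   u.1 *: v.2 + v.1 *: u.2 + crossO u.2 v.2).

Definition imO x : oct := (0, x).

Definition octdot x y : 'cV[C]_7 := (mulO (imO x) (imO y)).2.

Definition normO (u : oct) : C := u.1 ^+ 2 + dotC u.2 u.2.

End Octonions.
Arguments oct C : clear implicits.

(* The form is multiplicative, and positive definite over the reals: by Hurwitz's
   theorem, the real algebra is indeed the octonions. *)
Lemma normOM (C : comNzRingType) (u v : oct C) :
  normO (mulO u v) = normO u * normO v.
Proof.
case: u v => [a x] [b y]; rewrite /normO /mulO /dotC /crossO /=.
rewrite !mxE.
do !under eq_bigr do rewrite !mxE.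
rewrite !big_ord_recl !big_ord0 /=.
rewrite !mxE !big_cons !big_nil /=.
pose X (k : nat) := x (inord k) 0; pose Y (k : nat) := y (inord k) 0.
have xE i : x i 0 = X (val i) by rewrite /X inord_val.
have yE i : y i 0 = Y (val i) by rewrite /Y inord_val.
rewrite !xE !yE /=.
ring.
Qed.

Section Geometry.
Context {R : realType}.
Local Notation C := (Cplx R).
Implicit Types (L K U : {vspace 'cV[C]_7}) (M : 'M[C]_7).

(* A in 'M_7 belongs to G_2 when it is the restriction to the imaginary part of
   an automorphism of the complex algebra O (x) C. *)
Definition G2 : set 'M[C]_7 :=
  [set A | exists f : {linear oct C -> oct C},
     [/\ bijective f,
         forall u v, f (mulO u v) = mulO (f u) (f v)
       & forall x, f (imO x) = imO (A *m x)]].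

Definition SO7 : set 'M[C]_7 := [set A | A^T *m A = 1%:M /\ \det A = 1].

Definition conjv (x : 'cV[C]_7) : 'cV[C]_7 := map_mx (fun z : C => z^*) x.

Definition conjU U : {vspace 'cV[C]_7} := <<[seq conjv u | u <- vbasis U]>>%VS.

Definition perp U : {vspace 'cV[C]_7} :=
  (\bigcap_(u <- vbasis U) lker (linfun (mulmx u^T)))%VS.

Definition mximage M U : {vspace 'cV[C]_7} := (linfun (mulmx M) @: U)%VS.

Lemma conjvK : involutive conjv.
Proof. by move=> x; apply/colP => i; rewrite !mxE conjCK. Qed.

Lemma conjv0 : conjv 0 = 0.
Proof. by apply/colP => i; rewrite !mxE rmorph0. Qed.

Lemma conjvD : {morph conjv : x y / x + y}.
Proof. by move=> x y; apply/colP => i; rewrite !mxE rmorphD. Qed.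

Lemma conjvZ a x : conjv (a *: x) = a^* *: conjv x.
Proof. by apply/colP => i; rewrite !mxE rmorphM. Qed.

Lemma memv_conjU U x : (x \in conjU U) = (conjv x \in U).
Proof.
have conjvS (W : {vspace 'cV[C]_7}) (X : seq 'cV[C]_7) y :
    {in X, forall u, conjv u \in W} -> y \in <<X>>%VS -> conjv y \in W.
  move=> XW; rewrite -[X]/(val (in_tuple X)) => /coord_span ->.
  rewrite (big_morph conjv conjvD conjv0) memv_suml// => i _.
  rewrite conjvZ memvZ// XW// mem_nth//.
have conjUS y : y \in conjU U -> conjv y \in U.
  by apply: conjvS => _ /mapP[u /vbasis_mem uU ->]; rewrite conjvK.
apply/idP/idP => [/conjUS//|xU]; rewrite -[x]conjvK.
apply: (conjvS (conjU U) (vbasis U)); last by rewrite (span_basis (vbasisP U)).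
by move=> u uU; rewrite memv_span// map_f.
Qed.

Lemma memv_perpP U x :
  reflect (forall y, y \in U -> dotC x y = 0) (x \in perp U).
Proof.
have dotE u : (x \in lker (linfun (mulmx u^T))) = (dotC x u == 0).
  have -> : dotC x u = (u^T *m x) 0 0.
    by rewrite /dotC -[u^T *m x]trmxK trmx_mul trmxK [RHS]mxE.
  rewrite memv_ker lfunE /=; apply/eqP/eqP => [->|u0]; first by rewrite mxE.
  by apply/matrixP => i j; rewrite !ord1 u0 mxE.
have bigE (s : seq 'cV[C]_7) :
    (x \in \bigcap_(u <- s) lker (linfun (mulmx u^T)))%VS =
    all (fun u => dotC x u == 0) s.
  by elim: s => [|u s IH]; rewrite ?big_nil ?memvf// big_cons memv_cap dotE IH.
rewrite /perp bigE; apply: (iffP allP) => [xU y|xU y /vbasis_mem/xU/eqP//].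
move=> /coord_vbasis ->; rewrite /dotC mulmx_sumr summxE big1// => i _.
rewrite -scalemxAr mxE.
have /xU/eqP : (vbasis U)`_i \in vbasis U by rewrite mem_nth// size_tuple.
by rewrite /dotC => ->; rewrite mulr0.
Qed.

Definition isotropic U := forall x y, x \in U -> y \in U -> dotC x y = 0.

Definition isotropic_line L := \dim L = 1%N /\ isotropic L.

Definition coassociative U :=
  [/\ \dim U = 2%N, isotropic U
    & forall x y, x \in U -> y \in U -> octdot x y = 0].

(* Projections relative to C^7 = L (+) (L (+) conj L)^perp (+) conj L;
   daddv_pi V W is the projection onto V along W. *)
Definition piL L : 'End('cV[C]_7) :=
  daddv_pi L (perp (L + conjU L) + conjU L)%VS.
Definition piM L : 'End('cV[C]_7) :=
  daddv_pi (perp (L + conjU L)) (L + conjU L)%VS.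
Definition piLbar L : 'End('cV[C]_7) :=
  daddv_pi (conjU L) (L + perp (L + conjU L))%VS.

Definition admissible L K :=
  [/\ isotropic_line L, isotropic_line K, (K <= perp (conjU L))%VS
    & coassociative (L + piM L @: K)%VS].

Definition mx_of (f : 'End('cV[C]_7)) : 'M[C]_7 :=
  \matrix_(i, j) f (delta_mx j 0) i 0.

Lemma mul_mx_of (f : 'End('cV[C]_7)) x : mx_of f *m x = f x.
Proof.
apply/colP => i; rewrite [in RHS](matrix_sum_delta x) linear_sum summxE !mxE.
by apply: eq_bigr => j _; rewrite big_ord1 linearZ /= !mxE mulrC.
Qed.

End Geometry.

Section Loops.
Context {R : realType}.
Local Notation C := (Cplx R).
Local Notation M7 := 'M[Cplx R]_7.

(* The Riemann sphere; None is the point at infinity. *)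
Definition CP1 : Type := one_point_compactification C.

Implicit Types (g : CP1 -> M7) (p q : CP1) (G : set M7).

Definition pt (z : C) : CP1 := Some z.

Definition conjP p : CP1 := omap (fun z : C => z^*) p.

(* Affine chart centred at p: chart p 0 = p. *)
Definition chart p (z : C) : CP1 :=
  match p with
  | Some a => Some (a + z)
  | None => if z == 0 then None else Some z^-1
  end.

(* Inverse of [chart p], with a junk value off its range. *)
Definition local_coord p q : C :=
  match p, q with
  | Some a, Some z => z - a
  | None, Some z => z^-1
  | _, None => 0
  end.

(* Complex differentiability, since [derivable] is taken over C. *)
Definition holo_on (U : set CP1) g :=
  forall p, U p -> derivable (g \o chart p) 0 1.

(* Loops are represented by total functions, whose values off some open dense
   set are irrelevant; every notion below is invariant under changing a loop off
   an open dense set. *)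
Definition is_loop G g := exists U : set CP1,
  [/\ open U, dense U, holo_on U g & forall q, U q -> G (g q)].

Definition extends_at G g p (e : CP1 -> M7) := exists W V : set CP1,
  [/\ open W, W p, open V & dense V] /\
  [/\ holo_on W e, forall q, W q -> G (e q)
    & forall q, W q -> V q -> e q = g q].

Definition holo_at G g p := exists e, extends_at G g p e.

(* Value at p of the holomorphic extension, 0 if there is none. *)
Definition loop_value G g p : M7 :=
  xget 0 [set M | exists2 e, extends_at G g p e & e p = M].

Definition meromorphic g := forall p, exists n : nat,
  holo_at setT (fun q => local_coord p q ^+ n *: g q) p.

Definition simple_pole g p := exists e,
  extends_at setT (fun q => local_coord p q *: g q) p e /\ e p <> 0.

Definition real_loop g := exists V : set CP1,
  [/\ open V, dense V
    & forall q, V q -> map_mx (fun z : C => z^*) (g (conjP q)) = g q].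

(* The group L_-^tau(G_2, C^7). *)
Definition Lminus g :=
  [/\ is_loop G2 g, meromorphic g,
      holo_at G2 g None /\ loop_value G2 g None = 1%:M & real_loop g].

Definition mulL g1 g2 : CP1 -> M7 := fun q => g1 q *m g2 q.
Definition invL g : CP1 -> M7 := fun q => invmx (g q).

(* (q - b) / (q - a) *)
Definition moebius (a b : C) q : C :=
  match q with Some z => (z - b) / (z - a) | None => 1 end.

(* p_(alpha,L) and p_(alpha,L,K). *)
Definition loop_line (alpha : C) (L : {vspace 'cV[C]_7}) : CP1 -> M7 := fun q =>
  moebius alpha alpha^* q *: mx_of (piLbar L) + mx_of (piM L)
  + moebius alpha^* alpha q *: mx_of (piL L).

Definition loop_pair (alpha : C) (L K : {vspace 'cV[C]_7}) : CP1 -> M7 :=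
  mulL (loop_line alpha L) (loop_line alpha K).

End Loops.
Arguments CP1 R : clear implicits.

(* Main.v *)
From HB Require Import structures.
From mathcomp Require Import all_boot all_order all_algebra.
From mathcomp Require Import fingroup perm.
From mathcomp Require Import complex ring lra.
From mathcomp Require Import all_classical all_reals all_analysis.
Require Import Defs.
Import Order.TTheory GRing.Theory Num.Theory.
Import numFieldNormedType.Exports.

Set Implicit Arguments.
Unset Strict Implicit.
Unset Printing Implicit Defensive.

Local Open Scope classical_set_scope.
Local Open Scope ring_scope.

(** Why the theorem holds.  Let l and k span L and K, and put
    t = (z - conj alpha) / (z - alpha).  Then p_(alpha,L) is the matrix
    pmx t l = t E^T + M + t^-1 E, where E projects onto l and M onto the middle
    summand, and its inverse is its transpose.  The proof has an algebraic part,
    about a pair of vectors, and a local analytic part at the pole alpha; the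
    sphere only has to transport the outcome to loops.

    Algebra.  A matrix is in G_2 exactly when it is orthogonal and preserves the
    cross product (G2P), and then it has determinant one (autO_det).  The pair
    (L, K) is admissible exactly when l and k are null, k is orthogonal to
    conj l, and m = k - (<k, l> / |l|^2) conj l is a nonzero vector with
    l x m = 0 (adm, admissibleP).  In this case the products pmx t l * pmx t k
    lie in G_2 (adm_autO): both factors act on the isotropic planes
    <conj l, m> and <l, conj m>, the product acts there by a matrix of SL_2,
    and that copy of SL_2 is generated by transvections which are exponentials
    of nilpotent derivations of the cross product (transv_autO).  Admissibility
    is symmetric in l and k (adm_sym): this rests on the identity
    |l|^2 m x conj m + |m|^2 l x conj l = 0, whose left side is a purely
    imaginary null vector (cross_conj_pair).

    Dressing at the pole.  Write e for h near alpha and e = H + (z - alpha) W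
    with H = e(alpha), and let k' = H^-1 k.  In pmx t k * e * (pmx t k')^-1 the
    double pole has coefficient <k, e k'>, which is
    - (z - alpha)^2 <W k', W k'> / 2 since e is orthogonal and k, k' are null,
    and the simple poles vanish at z = alpha because H k' = k.  So the product
    extends to a holomorphic S (dressE, dressing_local) as soon as W is
    holomorphic.  The holomorphy of this divided difference
    (dslope_derivable) is the one fact of complex analysis that is needed; it
    is obtained from Goursat's theorem on squares (goursat) and Cauchy's integral
    formula.  The same lemma applied to S and l gives a holomorphic g extending
    pmx t l * S * (pmx t l')^-1 with l' = S(alpha)^-1 l.

    Admissibility of (l', k').  Passing to the limit in S^T conj k shows that l'
    is orthogonal to conj k', so (z - alpha) pmx t l' * pmx t k' has a value at
    alpha; up to a scalar it is g(alpha)^-1 A e(alpha) with A the residue of the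
    original pair, hence nonzero.  Being the limit of matrices tau P with tau
    tending to 0 and P in G_2, its transpose maps any two vectors to vectors with
    zero cross product, and this forces admissibility (adm_of_residue).  Then g
    takes values in G_2 off alpha, and at alpha too by continuity
    (pair_dressing_local).

    Globalization.  A holomorphic extension at a point of the sphere is
    determined by the loop, as an open dense set meets every neighbourhood of the
    point (extends_at_value); this identifies the values at alpha and at
    infinity.  Away from the two poles the simple factors are holomorphic, and
    conjugation exchanges the poles (extends_at_conj), so that everything at
    conj alpha follows from what happens at alpha. *)

(** * The complex numbers with their real norm *)

Section CplxBasics.
Context {R : realType}.
Local Notation C := (Cplx R).

(** The constructor is wrapped so that its result has the type carrying the
    normed structure of a numeric field. *)
Definition cpx (x y : R) : C := Complex x y.
(** Real valued, whereas the norm of the numeric field takes its values in that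
    field; estimates are done in R. *)
Definition nm (z : C) : R := ComplexField.Normc.normc z.

Arguments nm : simpl never.

Lemma normE (z : C) : `|z| = cpx (nm z) 0.
Proof. by []. Qed.

Lemma cpxE (z : C) : z = cpx (complex.Re z) (complex.Im z).
Proof. by case: z. Qed.

Lemma lt_cpx (x : R) (e : C) : 0 < e -> (cpx x 0 < e) = (x < complex.Re e).
Proof.
case: e => a b; rewrite /cpx !ltcE /= => /andP[/eqP -> _]. by rewrite eqxx.
Qed.

Lemma nm_ge0 z : 0 <= nm z.
Proof. by case: z => a b; rewrite /nm /= sqrtr_ge0. Qed.
Lemma nmM x y : nm (x * y) = nm x * nm y.
Proof. exact: ComplexField.Normc.normcM. Qed.
Lemma nmD x y : nm (x + y) <= nm x + nm y.
Proof. exact: le_normcD. Qed.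
Lemma nmN x : nm (- x) = nm x.
Proof. exact: normcN. Qed.
Lemma nm0 : nm 0 = 0. Proof. exact: ComplexField.Normc.normc0. Qed.
Lemma nm_eq0 x : (nm x == 0) = (x == 0).
Proof. by apply/eqP/eqP => [/ComplexField.Normc.eq0_normc//|->]; rewrite nm0. Qed.
Lemma nmV x : nm x^-1 = (nm x)^-1.
Proof. exact: ComplexField.Normc.normcV. Qed.
Lemma nm_Re (z : C) : `|complex.Re z| <= nm z.
Proof. have := normc_ge_Re z. by rewrite -lecR. Qed.
Lemma nm_Im (z : C) : `|complex.Im z| <= nm z.
Proof.
case: z => a b; rewrite /nm /= -sqrtr_sqr ler_wsqrtr// lerDr sqr_ge0//.
Qed.
Lemma nm_le (z : C) : nm z <= `|complex.Re z| + `|complex.Im z|.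
Proof.
rewrite [z in nm z]cpxE. have -> : cpx (complex.Re z) (complex.Im z) = cpx (complex.Re z) 0 + cpx 0 (complex.Im z).
  by rewrite /cpx; simpc.
apply: (le_trans (nmD _ _)). by rewrite /nm /= expr0n /= addr0 add0r !sqrtr_sqr.
Qed.

Lemma Re0_lt (e : C) : 0 < e -> 0 < complex.Re e.
Proof. by rewrite ltcE /= => /andP[]. Qed.

Lemma norm_lt (z e : C) : 0 < e -> (`|z| < e) = (nm z < complex.Re e).
Proof. by move=> e0; rewrite normE lt_cpx. Qed.

Lemma cpx_gt0 (r : R) : 0 < r -> 0 < cpx r 0.
Proof. by move=> r0; rewrite /cpx ltcE /= eqxx. Qed.

Lemma nbhs_nmP (z : C) (P : set C) :
  nbhs z P <-> exists2 r : R, 0 < r & forall w, nm (w - z) < r -> P w.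
Proof.
split.
  move=> /nbhs_ballP[e /= e0 eP]; exists (complex.Re e); first exact: Re0_lt.
  by move=> w we; apply: eP; rewrite /ball /= distrC norm_lt.
move=> [r r0 rP]; apply/nbhs_ballP; exists (cpx r 0) => /=; first exact: cpx_gt0.
by move=> w /=; rewrite /ball /= distrC norm_lt ?cpx_gt0//= => /rP.
Qed.

Lemma continuous_nmP (f : C -> C) (z : C) : {for z, continuous f} <->
  forall e : R, 0 < e -> exists2 d : R, 0 < d &
    forall w, nm (w - z) < d -> nm (f w - f z) < e.
Proof.
split => [fz e e0|fz].
  have /nbhs_nmP[d d0 dP] : nbhs z (f @^-1` [set y | nm (y - f z) < e]).
    by apply: fz; apply/nbhs_nmP; exists e.
  by exists d.
move=> A /nbhs_nmP[e e0 eA]; have [d d0 dP] := fz e e0.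
by apply/nbhs_nmP; exists d => // w /dP/eA.
Qed.

Lemma continuous_Re : continuous (@complex.Re R : C -> R).
Proof.
move=> z A /nbhs_ballP[e /= e0 eA]; apply/nbhs_nmP; exists e => // w wz.
apply: eA; rewrite /ball /= distrC; apply: le_lt_trans wz.
by rewrite -[X in `|X|](raddfB (@complex.Re R)) nm_Re.
Qed.

Lemma continuous_Im : continuous (@complex.Im R : C -> R).
Proof.
move=> z A /nbhs_ballP[e /= e0 eA]; apply/nbhs_nmP; exists e => // w wz.
apply: eA; rewrite /ball /= distrC; apply: le_lt_trans wz.
by rewrite -[X in `|X|](raddfB (@complex.Im R)) nm_Im.
Qed.

Lemma continuous_cpxl (y : R) : continuous (cpx ^~ y).
Proof.
move=> x A /nbhs_nmP[e e0 eA]; apply/nbhs_ballP; exists e => //= t.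
rewrite /ball /= distrC => xt; apply: eA; apply: le_lt_trans xt.
by apply: (le_trans (nm_le _)); rewrite /= subrr normr0 addr0.
Qed.

Lemma continuous_cpxr (x : R) : continuous (cpx x).
Proof.
move=> y A /nbhs_nmP[e e0 eA]; apply/nbhs_ballP; exists e => //= t.
rewrite /ball /= distrC => xt; apply: eA; apply: le_lt_trans xt.
by apply: (le_trans (nm_le _)); rewrite /= subrr normr0 add0r.
Qed.

(** Differentiability as a first order expansion, which avoids quotients in the
    estimates. *)
Definition deriv_nm (f : C -> C) (z d : C) := forall e : R, 0 < e ->
  exists2 r : R, 0 < r & forall w, nm (w - z) < r ->
    nm (f w - f z - d * (w - z)) <= e * nm (w - z).

Lemma is_derive_nmP (f : C -> C) (z d : C) : is_derive z 1 f d <-> deriv_nm f z d.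
Proof.
have E (u a d' : C) : a != 0 -> u - d' * a = a * - (d' - a^-1 * u).
  by move=> a0; rewrite opprB mulrBr mulVKf// [d' * _]mulrC.
have key w (wz : w - z != 0) : nm (f w - f z - d * (w - z)) =
    nm (w - z) * nm (d - (w - z)^-1 *: (f ((w - z)%:A + z) - f z)).
  rewrite -(nmN (d - _)) -nmM scaler1 subrK; congr nm.
  exact: (E (f w - f z) (w - z) d wz).
split=> [fd e e0|fd].
- have /cvgrPdist_le/= dP : (h^-1 *: (f (h *: 1 + z) - f z)) @[h --> 0^'] --> d.
    have [ex <-] := fd; exact: ex.
  have := dP _ (cpx_gt0 e0); rewrite near_withinE => /nbhs_nmP[r r0 rP].
  exists r => // w wz; have [->|wNz] := eqVneq w z.
    by rewrite !subrr mulr0 subr0 nm0 mulr0.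
  have wz0 : w - z != 0 by rewrite subr_eq0.
  have := rP (w - z); rewrite subr0 => /(_ wz wz0).
  by rewrite normE lecR key// mulrC => dwz; rewrite ler_wpM2r// nm_ge0.
- suff dP : (h^-1 *: (f (h *: 1 + z) - f z)) @[h --> 0^'] --> d.
    by apply: DeriveDef; [apply/cvg_ex; exists d|exact/cvg_lim].
  apply/cvgrPdist_le => e e0; have [r r0 rP] := fd _ (Re0_lt e0).
  rewrite near_withinE; apply/nbhs_nmP; exists r => // h; rewrite subr0 => hr h0.
  have := rP (h + z); rewrite addrK => /(_ hr).
  have := @key (h + z); rewrite addrK => ->// H.
  have h0' : 0 < nm h by rewrite lt_neqAle nm_ge0 eq_sym nm_eq0 h0.
  rewrite normE lecE /=; rewrite mulrC ler_pM2r// in H.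
  by rewrite H andbT; case: (e) e0 => a b; rewrite ltcE /= => /andP[].
Qed.

Lemma derivable_nmP (f : C -> C) (z : C) :
  derivable f z 1 <-> exists d, deriv_nm f z d.
Proof.
split=> [fd|[d]]; first by exists ('D_1 f z); exact/is_derive_nmP/derivableP.
by move=> /is_derive_nmP[].
Qed.

End CplxBasics.
Arguments nm {R} z : simpl never.

(** * Integrals of complex functions along segments *)

Section Integral.
Context {R : realType}.
Local Notation C := (Cplx R).
Local Notation mu := (@lebesgue_measure R).
Local Notation re := (@complex.Re R).
Local Notation im := (@complex.Im R).

Definition seg_cont (p : R -> C) (a b : R) :=
  forall t, a <= t <= b -> {for t, continuous p}.

Definition segint (p : R -> C) (a b : R) : C :=
  cpx (\int[mu]_(t in `[a, b]) re (p t)) (\int[mu]_(t in `[a, b]) im (p t)).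

Lemma itg_re p a b : seg_cont p a b ->
  mu.-integrable `[a, b] (EFin \o (fun t => re (p t))).
Proof.
move=> pab; apply: continuous_compact_integrable; first exact: segment_compact.
apply: continuous_in_subspaceT => t; rewrite inE /= in_itv /= => /pab tp.
by apply: (@continuous_comp _ _ _ p re) => //; exact: continuous_Re.
Qed.

Lemma itg_im p a b : seg_cont p a b ->
  mu.-integrable `[a, b] (EFin \o (fun t => im (p t))).
Proof.
move=> pab; apply: continuous_compact_integrable; first exact: segment_compact.
apply: continuous_in_subspaceT => t; rewrite inE /= in_itv /= => /pab tp.
by apply: (@continuous_comp _ _ _ p im) => //; exact: continuous_Im.
Qed.

Lemma seg_contS p a b c d : a <= c -> d <= b -> seg_cont p a b -> seg_cont p c d.
Proof.
move=> ac db pab t /andP[ct td]; apply: pab.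
by rewrite (le_trans ac ct) (le_trans td db).
Qed.

Lemma eq_segint p q a b : (forall t, a <= t <= b -> p t = q t) ->
  segint p a b = segint q a b.
Proof.
move=> pq; rewrite /segint; congr cpx; apply: eq_Rintegral => t.
  by rewrite inE /= in_itv /= => /pq ->.
by rewrite inE /= in_itv /= => /pq ->.
Qed.

Lemma cpxD a b c d : cpx a b + cpx c d = cpx (a + c) (b + d) :> C.
Proof. by []. Qed.

Lemma segintD p q a b : seg_cont p a b -> seg_cont q a b ->
  segint (fun t => p t + q t) a b = segint p a b + segint q a b.
Proof.
move=> pab qab; rewrite /segint cpxD -!RintegralD//; try exact: itg_re; try exact: itg_im.
by congr cpx; apply: eq_Rintegral => t _; rewrite raddfD.
Qed.

Lemma segintZ p c a b : seg_cont p a b ->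
  segint (fun t => c * p t) a b = c * segint p a b.
Proof.
move=> pab; have ip := itg_re pab; have iq := itg_im pab.
rewrite /segint; case: c => u v; rewrite /cpx; simpc.
rewrite -!RintegralZl//.
have iz r f : mu.-integrable `[a, b] (EFin \o f) -> mu.-integrable `[a, b] (EFin \o (fun t => r * f t)).
  by move=> fi; exact: (@integrableZl _ _ _ mu `[a,b] _ r (EFin \o f)).
rewrite -RintegralB//; try exact: iz.
rewrite -RintegralD//; try exact: iz.
by congr cpx; apply: eq_Rintegral => t _; case: (p t).
Qed.

Lemma seg_cont_cst c a b : seg_cont (fun=> c) a b.
Proof. by move=> t _; exact: cvg_cst. Qed.

Lemma segint_cst c a b : a <= b -> segint (fun=> c) a b = c * cpx (b - a) 0.
Proof.
move=> ab; rewrite /segint !Rintegral_cst//= lebesgue_measure_itv/= lte_fin.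
case: c => u v; rewrite /cpx /=; simpc.
have [ab'|ba] := ltP a b; first by rewrite -EFinD.
have -> : b = a by apply/eqP; rewrite eq_le ab ba.
by rewrite subrr /=.
Qed.

Lemma segint_split p a c b : a <= c -> c <= b -> seg_cont p a b ->
  segint p a b = segint p a c + segint p c b.
Proof.
move=> ac cb pab.
have pcb : seg_cont p c b by exact: seg_contS pab.
rewrite /segint cpxD.
have H (f : R -> R) : mu.-integrable `[a, b] (EFin \o f) ->
   mu.-integrable `[c, b] (EFin \o f) ->
   \int[mu]_(t in `[a, b]) f t = \int[mu]_(t in `[a, c]) f t + \int[mu]_(t in `[c, b]) f t.
  move=> fi fi'; rewrite -[X in _ = _ + X]Rintegral_itv_obnd_cbnd; last first.
    apply: integrableS fi' => //.
    by apply: subset_itvr; rewrite bnd_simp.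
  by rewrite -(Rintegral_itvB (x := c) fi) ?bnd_simp// addrC subrK.
by rewrite !H//; try exact: itg_re; try exact: itg_im.
Qed.

Lemma Rint_bound (f : R -> R) a b M : a <= b -> mu.-integrable `[a, b] (EFin \o f) ->
  (forall t, a <= t <= b -> `|f t| <= M) ->
  `|\int[mu]_(t in `[a, b]) f t| <= M * (b - a).
Proof.
move=> ab fi fM.
apply: (le_trans (le_normr_Rintegral _ fi)) => //.
have -> : M * (b - a) = \int[mu]_(t in `[a, b]) M.
  rewrite Rintegral_cst//= lebesgue_measure_itv/= lte_fin.
  have [ab'|ba] := ltP a b; first by rewrite -EFinD.
  have -> : b = a by apply/eqP; rewrite eq_le ab ba.
  by rewrite subrr /=.
apply: le_Rintegral => //.
- exact: (integrable_norm fi).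
- apply: continuous_compact_integrable; first exact: segment_compact.
  exact: cst_continuous.
Qed.

Lemma segint_bound p a b M : a <= b -> seg_cont p a b ->
  (forall t, a <= t <= b -> nm (p t) <= M) ->
  nm (segint p a b) <= 2 * M * (b - a).
Proof.
move=> ab pab pM; apply: (le_trans (nm_le _)); rewrite /segint /=.
rewrite -mulrA mulr_natl mulr2n lerD// Rint_bound//; try exact: itg_re; try exact: itg_im.
  by move=> t /pM; apply: le_trans; exact: nm_Re.
by move=> t /pM; apply: le_trans; exact: nm_Im.
Qed.

End Integral.
Arguments segint {R} p a b : simpl never.

(** * Contour integrals along squares *)

Section Contour.
Context {R : realType}.
Local Notation C := (Cplx R).
Local Notation re := (@complex.Re R).
Local Notation im := (@complex.Im R).
Local Notation ii := (cpx 0 1 : C).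
Implicit Types (f g : C -> C) (x y s : R).

Definition square x y s : set C :=
  [set z | x <= re z <= x + s /\ y <= im z <= y + s].

Definition square_bd x y s : set C :=
  [set z | square x y s z /\
    [\/ re z = x, re z = x + s, im z = y | im z = y + s]].

(** The integral of f(z) dz along the boundary, counterclockwise: the four sides
    are bottom, top, right and left. *)
Definition oint f x y s : C :=
  segint (fun t => f (cpx t y)) x (x + s)
  - segint (fun t => f (cpx t (y + s))) x (x + s)
  + ii * (segint (fun t => f (cpx (x + s) t)) y (y + s)
          - segint (fun t => f (cpx x t)) y (y + s)).

Definition cont_on (A : set C) f := forall z, A z -> {for z, continuous f}.

Lemma contM f g z : {for z, continuous f} -> {for z, continuous g} ->
  {for z, continuous (fun z => f z * g z)}.
Proof. exact: (@cvgM C C (nbhs z)). Qed.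
Lemma contD f g z : {for z, continuous f} -> {for z, continuous g} ->
  {for z, continuous (fun z => f z + g z)}.
Proof. exact: (@cvgD C C C (nbhs z)). Qed.
Lemma contB f g z : {for z, continuous f} -> {for z, continuous g} ->
  {for z, continuous (fun z => f z - g z)}.
Proof. exact: (@cvgB C C C (nbhs z)). Qed.
Lemma cont_cst (c z : C) : {for z, continuous (fun _ : C => c)}.
Proof. exact: (@cst_continuous C C). Qed.
Lemma cont_id (z : C) : {for z, continuous (fun x : C => x)}.
Proof. by []. Qed.
Lemma contV f z : f z != 0 -> {for z, continuous f} ->
  {for z, continuous (fun z => (f z)^-1)}.
Proof. by move=> fz0 fz; exact: (@cvgV C C (nbhs z) _ f (f z) fz0 fz). Qed.

Lemma sides_cont f x y s : 0 <= s -> cont_on (square_bd x y s) f ->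
  [/\ seg_cont (fun t => f (cpx t y)) x (x + s),
      seg_cont (fun t => f (cpx t (y + s))) x (x + s),
      seg_cont (fun t => f (cpx (x + s) t)) y (y + s)
    & seg_cont (fun t => f (cpx x t)) y (y + s)].
Proof.
move=> s0 fc; split=> t txs.
- apply: (@continuous_comp _ _ _ (cpx ^~ y) f); first exact: continuous_cpxl.
  by apply: fc; split; [split=> //=; rewrite ?lexx ?lerDl ?s0|constructor 3].
- apply: (@continuous_comp _ _ _ (cpx ^~ (y + s)) f); first exact: continuous_cpxl.
  by apply: fc; split; [split=> //=; rewrite ?lexx ?lerDl ?s0|constructor 4].
- apply: (@continuous_comp _ _ _ (cpx (x + s)) f); first exact: continuous_cpxr.
  by apply: fc; split; [split=> //=; rewrite ?lexx ?lerDl ?s0|constructor 2].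
- apply: (@continuous_comp _ _ _ (cpx x) f); first exact: continuous_cpxr.
  by apply: fc; split; [split=> //=; rewrite ?lexx ?lerDl ?s0|constructor 1].
Qed.

Lemma ointD f g x y s : 0 <= s -> cont_on (square_bd x y s) f -> cont_on (square_bd x y s) g ->
  oint (fun z => f z + g z) x y s = oint f x y s + oint g x y s.
Proof.
move=> s0 /(sides_cont s0)[f1 f2 f3 f4] /(sides_cont s0)[g1 g2 g3 g4].
by rewrite /oint !segintD//; ring.
Qed.

Lemma ointZ c f x y s : 0 <= s -> cont_on (square_bd x y s) f ->
  oint (fun z => c * f z) x y s = c * oint f x y s.
Proof.
move=> s0 /(sides_cont s0)[f1 f2 f3 f4].
by rewrite /oint !segintZ//; ring.
Qed.

Lemma eq_oint f g x y s : 0 <= s -> (forall z, square_bd x y s z -> f z = g z) ->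
  oint f x y s = oint g x y s.
Proof.
move=> s0 fg; rewrite /oint; congr (_ - _ + _ * (_ - _)); apply: eq_segint => t txs;
  apply: fg; split; rewrite /square/= ?lexx ?lerDl ?s0//.
- by constructor 3.
- by constructor 4.
- by constructor 2.
- by constructor 1.
Qed.

Lemma ointB f g x y s : 0 <= s -> cont_on (square_bd x y s) f -> cont_on (square_bd x y s) g ->
  oint (fun z => f z - g z) x y s = oint f x y s - oint g x y s.
Proof.
move=> s0 fc gc; have gNc : cont_on (square_bd x y s) (fun z => -1 * g z).
  by move=> z /gc gz; exact: (contM (@cont_cst (-1) z) gz).
rewrite -[- oint g x y s]mulN1r -ointZ// -ointD//; apply: eq_oint => // z _.
by rewrite mulN1r.
Qed.

Lemma oint_bound f x y s M : 0 <= s -> cont_on (square_bd x y s) f ->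
  (forall z, square_bd x y s z -> nm (f z) <= M) -> nm (oint f x y s) <= 8 * M * s.
Proof.
move=> s0 /(sides_cont s0)[f1 f2 f3 f4] fM.
have Ds u : u <= u + s by rewrite lerDl.
have sE u : u + s - u = s by rewrite addrC addKr.
have B p u : seg_cont p u (u + s) -> (forall t, u <= t <= u + s -> nm (p t) <= M) ->
   nm (segint p u (u + s)) <= 2 * M * s.
  by move=> pc pM; have := segint_bound (Ds u) pc pM; rewrite sE.
have b1 : nm (segint (fun t => f (cpx t y)) x (x + s)) <= 2 * M * s.
  by apply: B => // t t_; apply: fM; split; rewrite /square/= ?lexx ?Ds ?t_//; constructor 3.
have b2 : nm (segint (fun t => f (cpx t (y + s))) x (x + s)) <= 2 * M * s.
  by apply: B => // t t_; apply: fM; split; rewrite /square/= ?lexx ?Ds ?t_//; constructor 4.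
have b3 : nm (segint (fun t => f (cpx (x + s) t)) y (y + s)) <= 2 * M * s.
  by apply: B => // t t_; apply: fM; split; rewrite /square/= ?lexx ?Ds ?t_//; constructor 2.
have b4 : nm (segint (fun t => f (cpx x t)) y (y + s)) <= 2 * M * s.
  by apply: B => // t t_; apply: fM; split; rewrite /square/= ?lexx ?Ds ?t_//; constructor 1.
have nii : nm ii = 1 by rewrite /nm /= expr0n expr1n /= add0r sqrtr1.
rewrite /oint; apply: (le_trans (nmD _ _)); rewrite nmM nii mul1r.
have := nmD (segint (fun t => f (cpx t y)) x (x + s)) (- segint (fun t => f (cpx t (y + s))) x (x + s)).
have := nmD (segint (fun t => f (cpx (x + s) t)) y (y + s)) (- segint (fun t => f (cpx x t)) y (y + s)).
by rewrite !nmN; lra.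
Qed.

Lemma square_bd_square x y s z : square_bd x y s z -> square x y s z.
Proof. by case. Qed.

Lemma squareS x y s x' y' s' : x <= x' -> y <= y' -> x' + s' <= x + s -> y' + s' <= y + s ->
  square x' y' s' `<=` square x y s.
Proof. move=> h1 h2 h3 h4 z [/andP[a b] /andP[c d]]; split; apply/andP; split; lra. Qed.

(** The sides interior to the square are integrated twice, in opposite
    directions. *)
Lemma oint_quarters f x y s : 0 <= s -> cont_on (square x y s) f ->
  oint f x y s = oint f x y (s / 2) + oint f (x + s / 2) y (s / 2)
    + oint f x (y + s / 2) (s / 2) + oint f (x + s / 2) (y + s / 2) (s / 2).
Proof.
move=> s0 fc.
have sE u : u + s / 2 + s / 2 = u + s by lra.
have h0 : 0 <= s / 2 by lra.
have H w : y <= w <= y + s -> segint (fun t => f (cpx t w)) x (x + s) =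
   segint (fun t => f (cpx t w)) x (x + s / 2) +
   segint (fun t => f (cpx t w)) (x + s / 2) (x + s).
  move=> wy; apply: segint_split; [lra|lra|] => t tx.
  apply: (@continuous_comp _ _ _ (cpx ^~ w) f); first exact: continuous_cpxl.
  by apply: fc; split.
have V w : x <= w <= x + s -> segint (fun t => f (cpx w t)) y (y + s) =
   segint (fun t => f (cpx w t)) y (y + s / 2) +
   segint (fun t => f (cpx w t)) (y + s / 2) (y + s).
  move=> wx; apply: segint_split; [lra|lra|] => t ty.
  apply: (@continuous_comp _ _ _ (cpx w) f); first exact: continuous_cpxr.
  by apply: fc; split.
rewrite /oint !sE !H ?V; [|apply/andP; split; lra..].
ring.
Qed.

Lemma oint_affine (b c : C) x y s : 0 <= s -> oint (fun z => b + c * z) x y s = 0.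
Proof.
move=> s0.
have idc : cont_on (square_bd x y s) (fun z => z) by move=> z _; exact: cont_id.
have cstc u : cont_on (square_bd x y s) (fun=> u) by move=> z _; exact: cont_cst.
have Ds u : u <= u + s by rewrite lerDl.
have sE u : u + s - u = s by rewrite addrC addKr.
have o1 : oint (fun=> 1) x y s = 0 by rewrite /oint !segint_cst// !sE; ring.
have oz : oint (fun z => z) x y s = 0.
  have h1 : seg_cont (fun t => cpx t (y + s) : C) x (x + s).
    by move=> t _; exact: continuous_cpxl.
  have h2 : seg_cont (fun t => cpx x t : C) y (y + s).
    by move=> t _; exact: continuous_cpxr.
  rewrite /oint.
  have -> : segint (fun t => cpx t y : C) x (x + s) =
      segint (fun t => cpx t (y + s) + (- cpx 0 s : C)) x (x + s).
    by apply: eq_segint => t _; rewrite /cpx; simpc; rewrite addrK.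
  have -> : segint (fun t => cpx (x + s) t : C) y (y + s) =
      segint (fun t => cpx x t + (cpx s 0 : C)) y (y + s).
    by apply: eq_segint => t _; rewrite /cpx; simpc.
  rewrite (segintD h1 (@seg_cont_cst _ _ _ _)) (segintD h2 (@seg_cont_cst _ _ _ _)).
  rewrite !segint_cst// !sE.
  rewrite [_ + _ - segint _ x _]addrAC subrr add0r.
  rewrite [_ + _ - segint _ y _]addrAC subrr add0r.
  by rewrite /cpx; simpc; rewrite addNr.
have -> : oint (fun z => b + c * z) x y s = oint (fun z => b * 1 + c * z) x y s.
  by apply: eq_oint => // z _; rewrite mulr1.
have c1 : cont_on (square_bd x y s) (fun=> b * 1).
  by move=> z _; exact: (contM (@cont_cst b z) (@cont_cst 1 z)).
have c2 : cont_on (square_bd x y s) (fun z => c * z).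
  by move=> z _; exact: (contM (@cont_cst c z) (@cont_id z)).
rewrite (ointD s0 c1 c2) (ointZ _ s0 (cstc 1)) (ointZ _ s0 idc).
by rewrite o1 oz !mulr0 addr0.
Qed.

End Contour.
Arguments oint {R} f x y s : simpl never.
Arguments square_bd {R} x y s : simpl never.

(** * Goursat's theorem *)

Section Goursat.
Context {R : realType}.
Local Notation C := (Cplx R).
Local Notation re := (@complex.Re R).
Local Notation im := (@complex.Im R).
Implicit Types (f g : C -> C) (x y s : R).

(** A weight against which the contour integrals of squares are measured: the
    area, plus twice the length of the part of the horizontal line of ordinate
    yw inside the square, a line along a side counting half. The two half-open
    conditions make it additive under subdivision into quarters. The second term
    only has order s, which is what continuity alone yields on squares
    containing an exceptional point of ordinate yw. *)
Definition mass (e yw y s : R) : R :=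
  e * (s ^+ 2 + s * ((y <= yw < y + s)%R%:R + (y < yw <= y + s)%R%:R)).

Lemma mass_quarters e yw y s : 0 <= s ->
  mass e yw y (s / 2) + mass e yw y (s / 2) + mass e yw (y + s / 2) (s / 2) +
  mass e yw (y + s / 2) (s / 2) = mass e yw y s.
Proof.
move=> s0; rewrite /mass.
have -> : y + s / 2 + s / 2 = y + s by lra.
have h0 : 0 <= s / 2 by lra.
have -> : (y <= yw < y + s)%R%:R = (y <= yw < y + s / 2)%R%:R + (y + s / 2 <= yw < y + s)%R%:R :> R.
  have [a|a] := leP y yw; have [b|b] := ltP yw (y + s / 2); have [c|c] := ltP yw (y + s); rewrite /= ?addr0 ?add0r//; lra.
have -> : (y < yw <= y + s)%R%:R = (y < yw <= y + s / 2)%R%:R + (y + s / 2 < yw <= y + s)%R%:R :> R.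
  have [a|a] := ltP y yw; have [b|b] := leP yw (y + s / 2); have [c|c] := leP yw (y + s); rewrite /= ?addr0 ?add0r//; lra.
by field.
Qed.

Lemma mass_ge e yw y s : 0 <= e -> 0 <= s -> e * s ^+ 2 <= mass e yw y s.
Proof.
move=> e0 s0; rewrite /mass ler_wpM2l// lerDl mulr_ge0// addr_ge0// ler0n//.
Qed.

Lemma mass_ge_w e yw y s : 0 <= e -> 0 < s -> y <= yw <= y + s -> e * s <= mass e yw y s.
Proof.
move=> e0 s0 /andP[y1 y2]; rewrite /mass ler_wpM2l//.
have s2 : 0 <= s ^+ 2 by rewrite sqr_ge0.
rewrite y1 y2 /= andbT.
suff : 1 <= (yw < y + s)%R%:R + (y < yw)%R%:R :> R by nra.
have [b|b] := ltP yw (y + s); have [c|c] := ltP y yw; rewrite /=; lra.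
Qed.

Section Bisect.
Variables (g : C -> C) (e yw : R).
Let bad s (p : R * R) := mass e yw p.2 s < nm (oint g p.1 p.2 s).

(** If no quarter exceeded its weight, neither would the whole square, as both
    integral and weight are additive. *)
Lemma bad_step s p : 0 <= s -> cont_on (square p.1 p.2 s) g -> bad s p ->
  exists q, [/\ q.1 = p.1 \/ q.1 = p.1 + s / 2, q.2 = p.2 \/ q.2 = p.2 + s / 2
    & bad (s / 2) q].
Proof.
case: p => x y /= s0 gc; rewrite /bad /= (@oint_quarters _ g x y s s0 gc) -(mass_quarters _ _ _ s0) => H.
have [b1|b1] := ltP (mass e yw y (s / 2)) (nm (oint g x y (s / 2))).
  by exists (x, y); split=> //=; left.
have [b2|b2] := ltP (mass e yw y (s / 2)) (nm (oint g (x + s / 2) y (s / 2))).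
  by exists (x + s / 2, y); split=> //=; [right|left].
have [b3|b3] := ltP (mass e yw (y + s / 2) (s / 2)) (nm (oint g x (y + s / 2) (s / 2))).
  by exists (x, y + s / 2); split=> //=; [left|right].
have [b4|b4] := ltP (mass e yw (y + s / 2) (s / 2)) (nm (oint g (x + s / 2) (y + s / 2) (s / 2))).
  by exists (x + s / 2, y + s / 2); split=> //=; right.
exfalso; move: H; apply/negP; rewrite -leNgt.
do 3!(apply: (le_trans (nmD _ _)); apply: lerD => //).
Qed.

Definition next_corner s (p : R * R) := xget p [set q | [/\ q.1 = p.1 \/ q.1 = p.1 + s / 2, q.2 = p.2 \/ q.2 = p.2 + s / 2
    & bad (s / 2) q]].

Fixpoint corner s p n := if n is m.+1 then next_corner (s / 2 ^+ m) (corner s p m) else p.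

Lemma cornerP s p n : 0 <= s -> cont_on (square p.1 p.2 s) g -> bad s p ->
  [/\ bad (s / 2 ^+ n) (corner s p n),
     square (corner s p n).1 (corner s p n).2 (s / 2 ^+ n) `<=` square p.1 p.2 s,
     (corner s p n).1 <= (corner s p n.+1).1 /\ (corner s p n.+1).1 + s / 2 ^+ n.+1 <= (corner s p n).1 + s / 2 ^+ n
   & (corner s p n).2 <= (corner s p n.+1).2 /\ (corner s p n.+1).2 + s / 2 ^+ n.+1 <= (corner s p n).2 + s / 2 ^+ n].
Proof.
move=> s0 gc b0.
have sn m : 0 <= s / 2 ^+ m by rewrite divr_ge0// exprn_ge0.
have half m : s / 2 ^+ m / 2 = s / 2 ^+ m.+1 by rewrite exprSr invfM mulrA.
have N m : bad (s / 2 ^+ m) (corner s p m) -> square (corner s p m).1 (corner s p m).2 (s / 2 ^+ m) `<=` square p.1 p.2 s ->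
   [/\ bad (s / 2 ^+ m.+1) (corner s p m.+1), 
     (corner s p m).1 <= (corner s p m.+1).1 /\ (corner s p m.+1).1 + s / 2 ^+ m.+1 <= (corner s p m).1 + s / 2 ^+ m
   & (corner s p m).2 <= (corner s p m.+1).2 /\ (corner s p m.+1).2 + s / 2 ^+ m.+1 <= (corner s p m).2 + s / 2 ^+ m].
  move=> bm sqm; have gcm : cont_on (square (corner s p m).1 (corner s p m).2 (s / 2 ^+ m)) g by move=> z /sqm/gc.
  have /= [] := @xgetPex _ (corner s p m) _ (bad_step (sn m) gcm bm).
  rewrite -/(next_corner _ _) half => q1 q2 qb; have := sn m.+1; have := half m.
  move: q1 q2 qb => /=; set q := next_corner _ _; set h := s / 2 ^+ m; set h' := s / 2 ^+ m.+1.
  by move=> q1 q2 qb hh h'0; split=> //; [case: q1 => ->|case: q2 => ->]; split; lra.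
have I m : bad (s / 2 ^+ m) (corner s p m) /\ square (corner s p m).1 (corner s p m).2 (s / 2 ^+ m) `<=` square p.1 p.2 s.
  elim: m => [|m [bm sqm]]; first by rewrite expr0 divr1; split.
  have [bm' [h1 h2] [h3 h4]] := N _ bm sqm; split=> //.
  by apply: subset_trans sqm; apply: squareS.
have [bn sn'] := I n; have [? ? ?] := N _ bn sn'; by split.
Qed.

End Bisect.

Lemma nested_point (u v : nat -> R) : (forall n, u n <= u n.+1) ->
  (forall n, v n.+1 <= v n) -> (forall n, u n <= v n) ->
  exists l, forall n, u n <= l <= v n.
Proof.
move=> un vn uv.
have uI m n : (m <= n)%N -> u m <= u n by move=> mn; have /nondecreasing_seqP := un; exact.
have vI m n : (m <= n)%N -> v n <= v m.
  by move=> mn; have /nonincreasing_seqP := vn; exact.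
have uvI m n : u m <= v n.
  by apply: (le_trans (uI m (maxn m n) (leq_maxl _ _))); apply: (le_trans (uv _)); apply: vI; exact: leq_maxr.
exists (sup (range u)) => n; apply/andP; split.
  apply: ub_le_sup; last by exists n.
  by exists (v 0%N) => _ [m _ <-]; exact: uvI.
by apply: ge_sup; [exists (u 0%N), 0%N|move=> _ [m _ <-]; exact: uvI].
Qed.

Lemma half_small (s r : R) : 0 <= s -> 0 < r -> exists n, s / 2 ^+ n < r.
Proof.
move=> s0 r0; have [n sn] : exists n, s / r < n%:R.
  by exists (Num.bound (s / r)); apply: archi_boundP; rewrite divr_ge0// ltW.
exists n; rewrite ltr_pdivrMr ?exprn_gt0//.
rewrite -ltr_pdivrMl// mulrC; apply: (lt_trans sn).
by rewrite -natrX ltr_nat ltn_expl.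
Qed.

Lemma square_nm x y s (z v : C) : square x y s z -> square x y s v -> nm (v - z) <= 2 * s.
Proof.
move=> [/andP[a1 a2] /andP[a3 a4]] [/andP[b1 b2] /andP[b3 b4]]; apply: (le_trans (nm_le _)).
have -> : re (v - z) = re v - re z by rewrite raddfB.
have -> : im (v - z) = im v - im z by rewrite raddfB.
rewrite mulr_natl mulr2n; apply: lerD; rewrite ler_norml; apply/andP; split; lra.
Qed.

(** Bisect a square whose contour integral exceeds e times its weight; the
    nested squares shrink to a point z. If z is not the exceptional point w,
    replacing g by its affine part at z leaves an integral of order e s^2; if z
    = w, replacing g by g(w) leaves one of order e s. Both contradict the lower
    bounds on the weight. The point w is allowed because the divided difference
    at w of a holomorphic function is a priori only continuous there. *)
Lemma goursat g x y s (w : C) : 0 < s -> cont_on (square x y s) g ->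
  (forall z, square x y s z -> z != w -> derivable g z 1) -> oint g x y s = 0.
Proof.
move=> s0 gc gd; apply/eqP; rewrite -nm_eq0 eq_le nm_ge0 andbT.
have lt2 : 0 < 2 :> R by [].
have M0 : 0 < s ^+ 2 + s * 2 by nra.
suff main e : 0 < e -> nm (oint g x y s) <= e * (s ^+ 2 + s * 2).
  rewrite leNgt; apply/negP => J0.
  have := main (nm (oint g x y s) / (s ^+ 2 + s * 2) / 2).
  rewrite !divr_gt0// => /(_ isT).
  rewrite [leRHS](_ : _ = nm (oint g x y s) / 2); last by field; rewrite gt_eqF.
  lra.
move=> e0; apply: (@le_trans _ _ (mass e (im w) y s)); last first.
  rewrite /mass; apply: ler_wpM2l; first exact: ltW.
  rewrite lerD2l; apply: ler_wpM2l; first exact: ltW.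
  by case: (_ && _); case: (_ && _); rewrite /=; lra.
rewrite leNgt; apply/negP => b0.
pose p n := corner g e (im w) s (x, y) n; pose h n := s / 2 ^+ n.
have P n := @cornerP g e (im w) s (x, y) n (ltW s0) gc b0.
have hn n : 0 < h n by rewrite divr_gt0// exprn_gt0.
have [X XP] : exists l, forall n, (p n).1 <= l <= (p n).1 + h n.
  apply: nested_point => n; [by case: (P n) => _ _ []|by case: (P n) => _ _ []|].
  by rewrite lerDl ltW.
have [Y YP] : exists l, forall n, (p n).2 <= l <= (p n).2 + h n.
  apply: nested_point => n; [by case: (P n) => _ _ _ []|by case: (P n) => _ _ _ []|].
  by rewrite lerDl ltW.
pose z : C := cpx X Y.
have zn n : square (p n).1 (p n).2 (h n) z by split.
have zsq : square x y s z by have := zn 0%N; rewrite /h expr0 divr1.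
have cn n b c : cont_on (square_bd (p n).1 (p n).2 (h n)) (fun v => g v - (b + c * v)).
  move=> v /square_bd_square vs; apply: (@contB _ g (fun v => b + c * v)).
    by apply: gc; case: (P n) => _ + _ _; apply.
  by apply: contD; [exact: cont_cst|apply: contM; [exact: cont_cst|exact: cont_id]].
have gcn n : cont_on (square_bd (p n).1 (p n).2 (h n)) g.
  by move=> v /square_bd_square vs; apply: gc; case: (P n) => _ + _ _; apply.
have affc n b c : cont_on (square_bd (p n).1 (p n).2 (h n)) (fun v => b + c * v).
  by move=> v _; exact: (contD (@cont_cst _ b v) (contM (@cont_cst _ c v) (@cont_id _ v))).
have E n b c : oint g (p n).1 (p n).2 (h n) = oint (fun v => g v - (b + c * v)) (p n).1 (p n).2 (h n).
  by rewrite (ointB (ltW (hn n)) (gcn n) (affc n b c)) (oint_affine _ _ _ _ (ltW (hn n))) subr0.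
(* At the exceptional point continuity replaces differentiability, and the
   linear term of the weight is used. *)
have [zw|zw] := eqVneq z w.
  have [d d0 dP] := (continuous_nmP g z).1 (gc z zsq) (e / 8) (divr_gt0 e0 (ltr0Sn _ _)).
  have [n nd] := half_small (ltW s0) (divr_gt0 d0 lt2).
  have : nm (oint g (p n).1 (p n).2 (h n)) <= 8 * (e / 8) * h n.
    rewrite (E _ (g z) 0); apply: oint_bound; [exact: ltW|exact: cn|].
    move=> v /square_bd_square vs; rewrite mul0r addr0; apply: ltW; apply: dP.
    apply: le_lt_trans (square_nm (zn n) vs) _; move: nd; rewrite -/(h n) => nd; lra.
  have [bn _ _ _] := P n; move: bn; rewrite /= -/(p n) -/(h n) => bn.
  have := @mass_ge_w e (im w) (p n).2 (h n) (ltW e0) (hn n); rewrite -zw /= => /(_ (YP n)).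
  move: bn; rewrite -zw /=; lra.
have /derivable_nmP[d dP] := gd z zsq zw.
have [r r0 rP] := dP (e / 16) (divr_gt0 e0 (ltr0Sn _ _)).
have [n nd] := half_small (ltW s0) (divr_gt0 r0 lt2).
have : nm (oint g (p n).1 (p n).2 (h n)) <= 8 * (e / 16 * (2 * h n)) * h n.
  rewrite (E _ (g z - d * z) d); apply: oint_bound; [exact: ltW|exact: cn|].
  move=> v /square_bd_square vs; have vz := square_nm (zn n) vs.
  have -> : g v - (g z - d * z + d * v) = g v - g z - d * (v - z) by ring.
  apply: (le_trans (rP v _)); last by rewrite ler_wpM2l// divr_ge0// ltW.
  apply: le_lt_trans vz _; move: nd; rewrite -/(h n) => nd; lra.
have [bn _ _ _] := P n; move: bn; rewrite /= -/(p n) -/(h n) => bn.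
have := @mass_ge e (im w) (p n).2 (h n) (ltW e0) (ltW (hn n)).
rewrite expr2; move: bn; lra.
Qed.

End Goursat.

(** * Divided differences of holomorphic functions *)

Section Calculus.
Context {R : realType}.
Local Notation C := (Cplx R).
Implicit Types (f g : C -> C) (z : C).

Lemma der_cst (c z : C) : derivable (fun _ : C => c) z 1.
Proof. exact: derivable_cst. Qed.
Lemma der_id (z : C) : derivable (fun x : C => x) z 1.
Proof. exact: derivable_id. Qed.
Lemma derD f g z : derivable f z 1 -> derivable g z 1 ->
  derivable (fun x => f x + g x) z 1.
Proof. exact: derivableD. Qed.
Lemma derB f g z : derivable f z 1 -> derivable g z 1 ->
  derivable (fun x => f x - g x) z 1.
Proof. exact: derivableB. Qed.
Lemma derM f g z : derivable f z 1 -> derivable g z 1 ->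
  derivable (fun x => f x * g x) z 1.
Proof. exact: derivableM. Qed.
Lemma derV f z : f z != 0 -> derivable f z 1 ->
  derivable (fun x => (f x)^-1) z 1.
Proof. exact: derivableV. Qed.
Lemma der_cont f z : derivable f z 1 -> {for z, continuous f}.
Proof. by move=> /derivable1_diffP/differentiable_continuous. Qed.

Lemma cont_punct_eq f g (a : C) r : 0 < r -> {for a, continuous f} ->
  {for a, continuous g} -> (forall w, nm (w - a) < r -> w != a -> f w = g w) ->
  f a = g a.
Proof.
move=> r0 /continuous_nmP fa /continuous_nmP ga fg.
apply/eqP; rewrite -subr_eq0 -nm_eq0 eq_le nm_ge0 andbT.
rewrite leNgt; apply/negP => e0.
have [d1 d10 h1] := fa _ (divr_gt0 e0 (ltr0Sn R 1)).
have [d2 d20 h2] := ga _ (divr_gt0 e0 (ltr0Sn R 1)).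
pose m := Num.min r (Num.min d1 d2).
have m0 : 0 < m by rewrite !lt_min r0 d10 d20.
pose w : C := a + cpx (m / 2) 0.
have wa : nm (w - a) = m / 2.
  by rewrite /w addrC addKr /nm /= expr0n addr0 sqrtr_sqr ger0_norm// divr_ge0// ltW.
have wm : nm (w - a) < m by rewrite wa; lra.
have wNa : w != a by rewrite -subr_eq0 -nm_eq0 wa gt_eqF// divr_gt0.
have [wr w1 w2] : [/\ nm (w - a) < r, nm (w - a) < d1 & nm (w - a) < d2].
  by split; apply: (lt_le_trans wm); rewrite /m !ge_min ?lexx ?orbT.
have := h1 w w1; have := h2 w w2; rewrite (fg w wr wNa) => H2 H1.
have : nm (f a - g a) <= nm (g w - g a) + nm (g w - f a).
  rewrite -[nm (g w - f a)]nmN (_ : f a - g a = (g w - g a) + - (g w - f a)).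
    exact: nmD.
  by ring.
lra.
Qed.

(** Divided difference of f, completed by the derivative on the diagonal. *)
Definition dslope f (a z : C) : C :=
  if z == a then 'D_1 f a else (f z - f a) / (z - a).

Lemma dslopeE f (a z : C) : f z = f a + (z - a) * dslope f a z.
Proof.
rewrite /dslope; case: eqVneq => [->|za]; first by rewrite subrr mul0r addr0.
by rewrite mulrC divfK ?subr_eq0// addrC subrK.
Qed.

Lemma near_nm (P : C -> Prop) (z : C) r : 0 < r -> (forall w, nm (w - z) < r -> P w) ->
  \forall w \near z, P w.
Proof. by move=> r0 rP; apply/nbhs_nmP; exists r. Qed.

Lemma near_neq (z a : C) : z != a -> \forall w \near z, w != a.
Proof.
move=> za; have r0 : 0 < nm (a - z) by rewrite lt_neqAle nm_ge0 eq_sym nm_eq0 subr_eq0 eq_sym za.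
by apply: (near_nm r0) => w wz; apply: contraTN isT => /eqP wa; move: wz; rewrite wa ltxx.
Qed.

Lemma dslope_cont f (a : C) : derivable f a 1 -> {for a, continuous (dslope f a)}.
Proof.
move=> fa; apply/continuous_nmP => e e0.
have /is_derive_nmP D := derivableP fa.
have [r r0 rP] := D _ (divr_gt0 e0 (ltr0Sn R 1)).
exists r => // w wr; rewrite /dslope eqxx; case: eqVneq => [_|wa].
  by rewrite subrr nm0.
have wa0 : w - a != 0 by rewrite subr_eq0.
have wa0' : 0 < nm (w - a) by rewrite lt_neqAle nm_ge0 eq_sym nm_eq0 wa0.
have -> : (f w - f a) / (w - a) - 'D_1 f a = (f w - f a - 'D_1 f a * (w - a)) / (w - a).
  by rewrite [RHS]mulrBl mulfK.
rewrite nmM nmV ltr_pdivrMr//; apply: le_lt_trans (rP w wr) _.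
by rewrite ltr_pM2r// ltr_pdivrMr//; lra.
Qed.

Lemma dslope_der_neq f (a z : C) : z != a -> derivable f z 1 ->
  derivable (dslope f a) z 1.
Proof.
move=> za fz.
have D : derivable (fun z => (f z - f a) / (z - a)) z 1.
  apply: (@derM (fun z => f z - f a) (fun z => (z - a)^-1)).
    exact: (@derB f (fun=> f a) z fz (@der_cst (f a) z)).
  apply: (@derV (fun z => z - a)); first by rewrite subr_eq0.
  exact: (@derB (fun z => z) (fun=> a) z (@der_id z) (@der_cst a z)).
apply: near_eq_derivable D.
near=> w; rewrite /dslope ifF//; apply/negbTE; near: w; exact: near_neq.
Unshelve. all: by end_near. Qed.

End Calculus.

Section CauchyKernel.
Context {R : realType}.
Local Notation C := (Cplx R).
Local Notation re := (@complex.Re R).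
Local Notation im := (@complex.Im R).
Implicit Types (f g F : C -> C) (x y s : R).

Lemma seg_bounded (p : R -> C) a b : a <= b -> seg_cont p a b ->
  exists M, forall t, a <= t <= b -> nm (p t) <= M.
Proof.
move=> ab pab.
have [c _ cP] : exists2 c, c \in `[a, b] &
    forall t, t \in `[a, b] -> `|re (p t)| + `|im (p t)| <= `|re (p c)| + `|im (p c)|.
  apply: (@EVT_max R (fun t => `|re (p t)| + `|im (p t)|)) => //.
  apply: continuous_in_subspaceT => t; rewrite inE /= in_itv /= => /pab tp.
  have tr : (fun t => `|re (p t)|) @ t --> `|re (p t)|.
    apply: cvg_norm.
    by apply: (@continuous_comp _ _ _ p re) => //; exact: continuous_Re.
  have ti : (fun t => `|im (p t)|) @ t --> `|im (p t)|.
    apply: cvg_norm.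
    by apply: (@continuous_comp _ _ _ p im) => //; exact: continuous_Im.
  exact: (cvgD tr ti).
exists (`|re (p c)| + `|im (p c)|) => t tab; apply: (le_trans (nm_le _)).
by apply: cP; rewrite in_itv.
Qed.

Lemma square_bd_bounded F x y s : 0 <= s -> cont_on (square_bd x y s) F ->
  exists M, forall z, square_bd x y s z -> nm (F z) <= M.
Proof.
move=> s0 /(sides_cont s0)[f1 f2 f3 f4].
have Ds u : u <= u + s by rewrite lerDl.
have [M1 H1] := seg_bounded (Ds _) f1; have [M2 H2] := seg_bounded (Ds _) f2.
have [M3 H3] := seg_bounded (Ds _) f3; have [M4 H4] := seg_bounded (Ds _) f4.
exists (Num.max (Num.max M1 M2) (Num.max M3 M4)) => z [[zx zy] H]; rewrite !le_max.
case: H => e; rewrite (cpxE z) e.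
- by rewrite (H4 _ zy) !orbT.
- by rewrite (H3 _ zy) !orbT.
- by rewrite (H1 _ zx).
- by rewrite (H2 _ zx) !orbT.
Qed.

Section Centered.
Variables (a : C) (r : R).
Hypothesis r0 : 0 < r.
Let x := re a - r.
Let y := im a - r.
Let s := 2 * r.
Let s0 : 0 <= s. Proof. by rewrite /s mulr_ge0// ltW. Qed.

Lemma square_bd_far (z : C) : square_bd x y s z -> r <= nm (z - a).
Proof.
have rp := r0; rewrite /x /y /s => -[_ H].
have hr : re (z - a) = re z - re a by rewrite raddfB.
have hi : im (z - a) = im z - im a by rewrite raddfB.
case: H => e.
- by apply: le_trans (nm_Re _); rewrite hr e ler_normr; apply/orP; right; lra.
- by apply: le_trans (nm_Re _); rewrite hr e ler_normr; apply/orP; left; lra.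
- by apply: le_trans (nm_Im _); rewrite hi e ler_normr; apply/orP; right; lra.
- by apply: le_trans (nm_Im _); rewrite hi e ler_normr; apply/orP; left; lra.
Qed.

Lemma square_bd_farw (z w : C) : square_bd x y s z -> nm (w - a) < r / 2 -> r / 2 <= nm (z - w).
Proof.
move=> /square_bd_far za wa; have := nmD (z - w) (w - a).
by rewrite addrA subrK; lra.
Qed.

Lemma square_bd_neq (z w : C) : square_bd x y s z -> nm (w - a) < r / 2 -> z - w != 0.
Proof.
move=> zb wa; have rp := r0; have := square_bd_farw zb wa => h.
by rewrite -nm_eq0 gt_eqF//; lra.
Qed.

Lemma near_center : nm (a - a) < r / 2.
Proof. by rewrite subrr nm0 divr_gt0. Qed.

Lemma quo_cont F (w : C) : cont_on (square_bd x y s) F -> nm (w - a) < r / 2 ->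
  cont_on (square_bd x y s) (fun z => F z / (z - w)).
Proof.
move=> Fc wa z zb; apply: contM; first exact: Fc.
apply: (@contV _ (fun z => z - w)); first exact: (square_bd_neq zb wa).
exact: (contB (@cont_id _ z) (@cont_cst _ w z)).
Qed.

(** The Cauchy integral of F along the square of centre a and half-side r. *)
Definition cauchy_int F (w : C) := oint (fun z => F z / (z - w)) x y s.

(** From 1 / (z - w) = 1 / (z - a) + (w - a) / ((z - a) (z - w)). *)
Lemma cauchy_int_exp F (w : C) : cont_on (square_bd x y s) F -> nm (w - a) < r / 2 ->
  cauchy_int F w = cauchy_int F a + (w - a) * cauchy_int (fun z => F z / (z - a)) w.
Proof.
move=> Fc wa; have Fa := quo_cont Fc near_center; have Faw := quo_cont Fa wa.
rewrite /cauchy_int -(ointZ _ s0 Faw) -(ointD s0 Fa); last first.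
  by move=> z zb; exact: (contM (@cont_cst _ (w - a) z) (Faw z zb)).
apply: eq_oint => // z zb.
have zw := square_bd_neq zb wa; have za := square_bd_neq zb near_center.
by field; rewrite zw za.
Qed.

Lemma cauchy_int_bound F : cont_on (square_bd x y s) F ->
  exists M, forall w, nm (w - a) < r / 2 -> nm (cauchy_int F w) <= M.
Proof.
move=> Fc; have [M MP] := square_bd_bounded s0 Fc.
exists (8 * (M / (r / 2)) * s) => w wa.
apply: (oint_bound s0 (quo_cont Fc wa)).
move=> z zb; have := square_bd_farw zb wa => zw.
have r2 : 0 < r / 2 by rewrite divr_gt0.
rewrite nmM nmV; apply: ler_pM; rewrite ?nm_ge0 ?invr_ge0 ?nm_ge0//; first exact: MP.
by rewrite lef_pV2// posrE (lt_le_trans _ zw).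
Qed.

Lemma cauchy_int_derivable F : cont_on (square_bd x y s) F -> derivable (cauchy_int F) a 1.
Proof.
move=> Fc; have F1 := quo_cont Fc near_center; have F2 := quo_cont F1 near_center.
have [M MP] := cauchy_int_bound F2.
apply/derivable_nmP; exists (cauchy_int (fun z => F z / (z - a)) a) => e e0.
pose d := Num.min (r / 2) (e / (`|M| + 1)).
have M1 : 0 < `|M| + 1 by rewrite ltr_wpDl.
exists d; first by rewrite lt_min !divr_gt0.
move=> w; rewrite lt_min => /andP[wa we].
rewrite (cauchy_int_exp Fc wa) (cauchy_int_exp F1 wa).
rewrite [X in nm X](_ : _ = (w - a) * (w - a) * cauchy_int (fun z => F z / (z - a) / (z - a)) w); last by ring.
rewrite !nmM mulrAC -mulrA mulrC ler_wpM2r ?nm_ge0//.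
have Mw := MP w wa.
rewrite ltr_pdivlMr// in we; apply: le_trans (ltW we).
rewrite mulrC; apply: ler_wpM2l; first exact: nm_ge0.
by apply: (le_trans Mw); apply: (le_trans (ler_norm _)); rewrite lerDl.
Qed.

(** The value is 2 pi i; bounding the integrand from below on each side gives at
    least 1 per side for the imaginary part, and this is enough. *)
Lemma cauchy_int1_neq0 : cauchy_int (fun=> 1) a != 0.
Proof.
have key (p1 p2 p3 p4 : R) : 1 <= p1 -> p2 <= -1 -> 1 <= p3 -> p4 <= -1 ->
    4 <= p1 - p2 + (p3 - p4) by lra.
have rp := r0; have c1 : cont_on (square_bd x y s) (fun=> 1 : C) by move=> z _; exact: cont_cst.
have c2 := quo_cont c1 near_center.
have [f1 f2 f3 f4] := sides_cont s0 c2.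
suff : 4 <= im (cauchy_int (fun=> 1) a).
  by move=> h; apply/eqP => k0; move: h; rewrite k0 /=; lra.
have sub (z : C) : z - a = cpx (re z - re a) (im z - im a) by rewrite [z in LHS]cpxE [a in LHS]cpxE.
have inv_re (z : C) : re (1 / (z - a)) =
    (re z - re a) / ((re z - re a) ^+ 2 + (im z - im a) ^+ 2) by rewrite mul1r sub.
have inv_im (z : C) : im (1 / (z - a)) =
    - ((im z - im a) / ((re z - re a) ^+ 2 + (im z - im a) ^+ 2)) by rewrite mul1r sub.
have B t c : c <= t <= c + s -> 1 / s <= r / ((t - (c + r)) ^+ 2 + r ^+ 2).
  move=> /andP[t1 t2].
  have h : (t - (c + r)) ^+ 2 + r ^+ 2 <= s * r.
    have u1 : 0 <= t - c by lra.
    have u2 : 0 <= c + 2 * r - t by rewrite /s in t2; lra.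
    by have := mulr_ge0 u1 u2; rewrite /s !expr2; lra.
  have h' : 0 < (t - (c + r)) ^+ 2 + r ^+ 2.
    by rewrite ltr_wpDl ?sqr_ge0 ?exprn_gt0.
  rewrite ler_pdivlMr// mulrC mulrA mulr1 ler_pdivrMr; last by rewrite /s mulr_gt0.
  by rewrite mulrC.
have I c (f : R -> R) : (@lebesgue_measure R).-integrable `[c, c + s] (EFin \o f) ->
   (forall t, c <= t <= c + s -> 1 / s <= f t) -> 1 <= \int[@lebesgue_measure R]_(t in `[c, c + s]) f t.
  move=> fi fB; have -> : 1 = \int[@lebesgue_measure R]_(t in `[c, c + s]) (1 / s).
    rewrite Rintegral_cst//= lebesgue_measure_itv/= lte_fin ifT; last by rewrite ltrDl /s mulr_gt0.
    by rewrite -EFinD /= addrAC subrr add0r mul1r mulVf// /s mulf_neq0// gt_eqF.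
  apply: le_Rintegral => //.
  apply: continuous_compact_integrable; first exact: segment_compact.
  exact: cst_continuous.
have I' c (f : R -> R) : (@lebesgue_measure R).-integrable `[c, c + s] (EFin \o f) ->
   (forall t, c <= t <= c + s -> f t <= - (1 / s)) -> \int[@lebesgue_measure R]_(t in `[c, c + s]) f t <= - 1.
  move=> fi fB; have -> : -1 = \int[@lebesgue_measure R]_(t in `[c, c + s]) (- (1 / s)).
    rewrite Rintegral_cst//= lebesgue_measure_itv/= lte_fin ifT; last by rewrite ltrDl /s mulr_gt0.
    by rewrite -EFinD /= addrAC subrr add0r mulNr mul1r mulVf// /s mulf_neq0// gt_eqF.
  apply: le_Rintegral => //.
  apply: continuous_compact_integrable; first exact: segment_compact.
  exact: cst_continuous.
have xr : x + r = re a by rewrite /x; lra.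
have yr : y + r = im a by rewrite /y; lra.
have xs : x + s = re a + r by rewrite /x /s; lra.
have ys : y + s = im a + r by rewrite /y /s; lra.
have i1 := I x _ (itg_im f1); have i2 := I' x _ (itg_im f2).
have i3 := I y _ (itg_re f3); have i4 := I' y _ (itg_re f4).
rewrite /cauchy_int /oint.
set A := segint _ _ _; set B1 := segint _ _ _; set D := segint _ _ _; set E := segint _ _ _.
have -> : im (A - B1 + cpx 0 1 * (D - E)) = im A - im B1 + (re D - re E).
  by case: (A) (B1) (D) (E) => [? ?] [? ?] [? ?] [? ?]; rewrite /cpx; simpc.
have j1 : 1 <= im A.
  apply: i1 => t tx; rewrite [leRHS](inv_im (cpx t y)) /=.
  have -> : y - im a = - r by rewrite /y; lra.
  by rewrite sqrrN mulNr opprK -xr; exact: B.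
have j2 : im B1 <= -1.
  apply: i2 => t tx; rewrite [leLHS](inv_im (cpx t (y + s))) /=.
  have -> : y + s - im a = r by rewrite ys; lra.
  by rewrite lerN2 -xr; exact: B.
have j3 : 1 <= re D.
  apply: i3 => t tx; rewrite [leRHS](inv_re (cpx (x + s) t)) /=.
  have -> : x + s - re a = r by rewrite xs; lra.
  by rewrite [_ ^+ 2 + _]addrC -yr; exact: B.
have j4 : re E <= -1.
  apply: i4 => t tx; rewrite [leLHS](inv_re (cpx x t)) /=.
  have -> : x - re a = - r by rewrite /x; lra.
  by rewrite sqrrN mulNr lerN2 [_ ^+ 2 + _]addrC -yr; exact: B.
exact: key.
Qed.

End Centered.

(** Goursat applied to the divided difference at w gives Cauchy's formula f(w)
    I_1(w) = I_f(w) for Cauchy integrals. Expanding both integrals at a and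
    dividing by w - a expresses the divided difference of f at a through Cauchy
    integrals, which are differentiable at a. *)
Lemma dslope_derivable f (a : C) : (\forall z \near a, derivable f z 1) ->
  derivable (dslope f a) a 1.
Proof.
move=> /nbhs_nmP[rho rho0 fd].
pose r := rho / 4; have r0 : 0 < r by rewrite divr_gt0.
pose x := re a - r; pose y := im a - r; pose s := 2 * r.
have s0 : 0 < s by rewrite /s mulr_gt0.
have sqd z : square x y s z -> derivable f z 1.
  move=> [/andP[z1 z2] /andP[z3 z4]]; apply: fd; apply: (le_lt_trans (nm_le _)).
  have -> : re (z - a) = re z - re a by rewrite raddfB.
  have -> : im (z - a) = im z - im a by rewrite raddfB.
  have h1 : `|re z - re a| <= r by rewrite ler_norml; move: z1 z2; rewrite /x /s => z1 z2; apply/andP; split; lra.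
  have h2 : `|im z - im a| <= r by rewrite ler_norml; move: z3 z4; rewrite /y /s => z3 z4; apply/andP; split; lra.
  by move: h1 h2 rho0; rewrite /r; lra.
have fc : cont_on (square_bd x y s) f by move=> z /square_bd_square/sqd/der_cont.
have onec : cont_on (square_bd x y s) (fun=> 1 : C) by move=> z _; exact: cont_cst.
pose K := cauchy_int a r.
have cauchy w : nm (w - a) < r / 2 -> K f w = f w * K (fun=> 1) w.
  move=> wa; have wd : derivable f w 1.
    by apply: fd; apply: (lt_trans wa); rewrite /r; move: rho0; lra.
  have G : oint (dslope f w) x y s = 0.
    apply: (goursat (w := w) s0) => z zs; last by move=> zw; exact: (dslope_der_neq zw (sqd z zs)).
    have [->|zw] := eqVneq z w; first exact: dslope_cont.
    by apply: der_cont; exact: (dslope_der_neq zw (sqd z zs)).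
  have q1 := quo_cont r0 fc wa; have q2 := quo_cont r0 onec wa.
  have q3 : cont_on (square_bd x y s) (fun z => f w * (1 / (z - w))).
    by move=> z zb; exact: (contM (@cont_cst _ (f w) z) (q2 z zb)).
  apply/eqP; rewrite -subr_eq0 -/s -/x -/y; apply/eqP.
  rewrite -[RHS]G /K /cauchy_int -/x -/y -/s -(ointZ _ (ltW s0) q2) -(ointB (ltW s0) q1 q3).
  apply: eq_oint; first exact: ltW.
  move=> z zb; have := square_bd_neq r0 zb wa; rewrite subr_eq0 => zw.
  by rewrite /dslope (negbTE zw) mulrBl mul1r.
have fa1 := quo_cont r0 fc (near_center a r0); have ga1 := quo_cont r0 onec (near_center a r0).
have N0 : K (fun=> 1) a != 0 := cauchy_int1_neq0 a r0.
have Nd : derivable (K (fun=> 1)) a 1 := cauchy_int_derivable r0 onec.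
have [d d0 dP] := (continuous_nmP _ _).1 (der_cont Nd) (nm (K (fun=> 1) a)) ltac:(by rewrite lt_neqAle nm_ge0 eq_sym nm_eq0 N0).
(* The quotient obtained by expanding both sides of Cauchy's formula at a. *)
pose S w := (K (fun z => f z / (z - a)) w - f a * K (fun z => 1 / (z - a)) w) / K (fun=> 1) w.
have Sd : derivable S a 1.
  apply: (@derM _ (fun w => K (fun z => f z / (z - a)) w - f a * K (fun z => 1 / (z - a)) w) (fun w => (K (fun=> 1) w)^-1)).
    apply: (@derB _ (K (fun z => f z / (z - a))) (fun w => f a * K (fun z => 1 / (z - a)) w)); first exact: (cauchy_int_derivable r0 fa1).
    by apply: (@derM _ (fun=> f a) (K (fun z => 1 / (z - a)))); [exact: der_cst|exact: (cauchy_int_derivable r0 ga1)].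
  exact: (derV N0 Nd).
pose m := Num.min d (r / 2).
have m0 : 0 < m by rewrite lt_min d0 divr_gt0.
have eqS w : nm (w - a) < m -> w != a -> dslope f a w = S w.
  rewrite lt_min => /andP[wd wa] wNa; rewrite /dslope (negbTE wNa) /S.
  have Nw : K (fun=> 1) w != 0.
    apply: contraTneq (dP w wd) => ->; by rewrite sub0r nmN ltxx.
  have e1 := cauchy_int_exp r0 fc wa; have e2 := cauchy_int_exp r0 onec wa.
  rewrite -/K (cauchy w wa) (cauchy a (near_center a r0)) in e1; rewrite -/K in e2.
  have wa0 : w - a != 0 by rewrite subr_eq0.
  apply: (mulIf wa0); rewrite divfK//; apply: (mulIf Nw).
  rewrite mulrAC divfK// [RHS]mulrC mulrBr -[in RHS](addrK (f a * K (fun=> 1) a) (_ * _)) [_ + f a * _]addrC -e1.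
  rewrite mulrCA (_ : (w - a) * _ = K (fun=> 1) w - K (fun=> 1) a); first by ring.
  by rewrite e2; ring.
have fad : derivable f a 1 by apply: fd; rewrite subrr nm0.
have eqa : dslope f a a = S a.
  exact: (cont_punct_eq m0 (dslope_cont fad) (der_cont Sd) eqS).
apply: near_eq_derivable Sd; apply: (near_nm m0) => w wm.
by have [->|wa] := eqVneq w a; [rewrite eqa|rewrite (eqS w wm wa)].
Qed.

End CauchyKernel.

(** * The cross product of imaginary octonions *)

Section CrossIdentities.
Context {K : comNzRingType}.
Implicit Types x y u v : 'cV[K]_7.

(** Entries indexed by natural numbers let concrete indices modulo 7 compute, so
    that identities reduce to ring. *)
Definition entry x (k : nat) : K := x (inord k) 0.
Lemma entryE x i : x i 0 = entry x (val i).
Proof. by rewrite /entry inord_val. Qed.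

Definition cross_entry (X Y : nat -> K) (k : nat) : K :=
  (X ((k + 1) %% 7)%N * Y ((k + 3) %% 7)%N - X ((k + 3) %% 7)%N * Y ((k + 1) %% 7)%N)
  + (X ((k + 2) %% 7)%N * Y ((k + 6) %% 7)%N - X ((k + 6) %% 7)%N * Y ((k + 2) %% 7)%N)
  + (X ((k + 4) %% 7)%N * Y ((k + 5) %% 7)%N - X ((k + 5) %% 7)%N * Y ((k + 4) %% 7)%N).

Lemma entry_crossO x y k : (k < 7)%N -> entry (crossO x y) k = cross_entry (entry x) (entry y) k.
Proof.
move=> k7; rewrite /entry /crossO mxE !big_cons big_nil /= !entryE /cross_entry /= addr0 addrA.
by rewrite !inordK.
Qed.

Lemma dot_entry x y : dotC x y = \sum_(i < 7) entry x i * entry y i.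
Proof. by rewrite /dotC mxE; apply: eq_bigr => i _; rewrite mxE !entryE. Qed.

Lemma entryP x y : (forall k, (k < 7)%N -> entry x k = entry y k) -> x = y.
Proof. by move=> h; apply/colP => i; rewrite !entryE; apply: h; exact: ltn_ord. Qed.

Lemma entryD x y k : entry (x + y) k = entry x k + entry y k. Proof. by rewrite /entry mxE. Qed.
Lemma entryN x k : entry (- x) k = - entry x k. Proof. by rewrite /entry mxE. Qed.
Lemma entryZ a x k : entry (a *: x) k = a * entry x k. Proof. by rewrite /entry mxE. Qed.

Lemma crossDl x y z : crossO (x + y) z = crossO x z + crossO y z.
Proof. by apply: entryP => k k7; rewrite !(entryD, entry_crossO) // /cross_entry !entryD; ring. Qed.
Lemma crossDr x y z : crossO x (y + z) = crossO x y + crossO x z.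
Proof. by apply: entryP => k k7; rewrite !(entryD, entry_crossO) // /cross_entry !entryD; ring. Qed.
Lemma crossZl a x y : crossO (a *: x) y = a *: crossO x y.
Proof. by apply: entryP => k k7; rewrite !(entryZ, entry_crossO) // /cross_entry !entryZ; ring. Qed.
Lemma crossZr a x y : crossO x (a *: y) = a *: crossO x y.
Proof. by apply: entryP => k k7; rewrite !(entryZ, entry_crossO) // /cross_entry !entryZ; ring. Qed.
Lemma crossC x y : crossO y x = - crossO x y.
Proof. by apply: entryP => k k7; rewrite !(entryN, entry_crossO) // /cross_entry; ring. Qed.
Lemma crossxx x : crossO x x = 0.
Proof. by apply: entryP => k k7; rewrite entry_crossO // /cross_entry /entry mxE; ring. Qed.

Lemma dot_crossCA x y z : dotC (crossO x y) z = dotC x (crossO y z).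
Proof.
rewrite !dot_entry !big_ord_recl !big_ord0 /= !entry_crossO // /cross_entry /=.
ring.
Qed.

(** Polarization of |a x b|^2 = |a|^2 |b|^2 - (a . b)^2. *)
Lemma dot_cross4 (a b c d : 'cV[K]_7) :
  dotC (crossO a b) (crossO c d) + dotC (crossO a d) (crossO c b) =
  2 * dotC a c * dotC b d - dotC a b * dotC c d - dotC a d * dotC b c.
Proof.
rewrite !dot_entry !big_ord_recl !big_ord0 /= !entry_crossO // /cross_entry /=.
ring.
Qed.

(** Polarization of the alternative law x (x u) = (x x) u of the octonions. *)
Lemma cross_crossC x y u : crossO x (crossO y u) =
  - crossO y (crossO x u) + dotC x u *: y + dotC y u *: x - (2 * dotC x y) *: u.
Proof.
apply: entryP => k k7.
rewrite !(entryD, entryN, entryZ) !entry_crossO// !dot_entry !big_ord_recl !big_ord0 /=.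
case: k k7 => [|[|[|[|[|[|[|k]]]]]]] // _.
all: rewrite /cross_entry /= !entry_crossO// /cross_entry /=; ring.
Qed.

Lemma dotCC x y : dotC x y = dotC y x.
Proof. by rewrite !dot_entry; apply: eq_bigr => i _; rewrite mulrC. Qed.

Lemma cross0r x : crossO x 0 = 0.
Proof. by have := crossZr 0 x 0; rewrite !scale0r. Qed.

Lemma crossNr x y : crossO x (- y) = - crossO x y.
Proof. by rewrite -[- y]scaleN1r crossZr scaleN1r. Qed.
Lemma crossNl x y : crossO (- x) y = - crossO x y.
Proof. by rewrite -[- x]scaleN1r crossZl scaleN1r. Qed.

Lemma eq_sub_eq (V : zmodType) (p q a b : V) : a = b -> p - q = a - b -> p = q.
Proof. by move=> -> /eqP; rewrite subrr subr_eq0 => /eqP. Qed.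

Lemma null_cross_cross x y u : crossO x y = 0 -> dotC x y = 0 ->
  crossO x (crossO y u) = (2 * dotC x u) *: y - dotC y u *: x.
Proof.
move=> xy0 xy; have H := cross_crossC u x y.
rewrite xy0 [crossO u y]crossC cross0r in H.
rewrite crossNr opprK xy scale0r addr0 [dotC u x]dotCC [dotC u y]dotCC in H.
apply: (eq_sub_eq (esym H)); apply: entryP => k k7.
by rewrite !(entryD, entryN, entryZ) /entry !mxE; ring.
Qed.

Definition skew x y u := dotC x u *: y - dotC y u *: x.

(** In other words skew x y belongs to the Lie algebra of G_2. The factor 2
    makes the identity integral. *)
Lemma skew_deriv x y u v : crossO x y = 0 -> dotC x y = 0 ->
  skew x y (crossO u v) *+ 2 = (crossO (skew x y u) v + crossO u (skew x y v)) *+ 2.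
Proof.
move=> xy0 xy; have H := null_cross_cross (crossO u v) xy0 xy.
rewrite (cross_crossC y u v) in H.
rewrite !(crossDr, crossZr, crossNr) xy0 scaler0 addr0 in H.
rewrite (cross_crossC x u (crossO y v)) (null_cross_cross v xy0 xy) in H.
rewrite !(crossDr, crossZr, crossNr) -dot_crossCA xy0 [crossO x u]crossC in H.
rewrite [dotC u _]dotCC -dot_crossCA in H.
have d0 : dotC 0 v = 0 by rewrite dot_entry big1// => i _; rewrite /entry mxE mul0r.
have yuv : dotC y (crossO v u) = - dotC y (crossO u v).
  by rewrite [crossO v u]crossC /dotC mulmxN mxE.
rewrite d0 !dot_crossCA yuv in H.
rewrite /skew !(crossDr, crossDl, crossZr, crossZl, crossNr, crossNl).
apply: (eq_sub_eq (esym H)); apply: entryP => k k7.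
rewrite !(entryD, entryN, entryZ, mulrS, mulr0n) /entry !mxE; ring.
Qed.

Lemma dotDr x y z : dotC x (y + z) = dotC x y + dotC x z.
Proof. by rewrite /dotC mulmxDr mxE. Qed.
Lemma dotZr a x y : dotC x (a *: y) = a * dotC x y.
Proof. by rewrite /dotC -scalemxAr mxE. Qed.
Lemma dotNr x y : dotC x (- y) = - dotC x y.
Proof. by rewrite /dotC mulmxN mxE. Qed.
Lemma dotDl x y z : dotC (x + y) z = dotC x z + dotC y z.
Proof. by rewrite dotCC dotDr ![dotC z _]dotCC. Qed.
Lemma dotZl s x y : dotC (s *: x) y = s * dotC x y.
Proof. by rewrite dotCC dotZr dotCC. Qed.
Lemma dotNl x y : dotC (- x) y = - dotC x y.
Proof. by rewrite dotCC dotNr dotCC. Qed.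
Lemma dot0l x : dotC 0 x = 0.
Proof. by rewrite -(scale0r (0 : 'cV[K]_7)) dotZl mul0r. Qed.

End CrossIdentities.

(** * G_2 as the orthogonal automorphisms of the cross product *)

Section CrossAutomorphisms.
Context {C : numClosedFieldType}.
Local Notation cmx := (map_mx (fun z : C => z^*)).
Implicit Types (A B : 'M[C]_7) (x y u v : 'cV[C]_7).

Definition cross_morph A := forall x y, crossO (A *m x) (A *m y) = A *m crossO x y.

Lemma dot_tr x y : (x^T *m y) = (dotC x y)%:M.
Proof. by rewrite [LHS]mx11_scalar. Qed.

Lemma orthP A : A^T *m A = 1%:M <-> forall u v, dotC (A *m u) (A *m v) = dotC u v.
Proof.
split=> [AA u v|h]; first by rewrite /dotC trmx_mul mulmxA -[_ *m _ *m A]mulmxA AA mulmx1.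
apply/matrixP => i j; have := h (delta_mx i 0) (delta_mx j 0).
rewrite /dotC trmx_mul mulmxA -[_ *m A^T *m A]mulmxA !trmx_delta -rowE -!colE !mxE => ->.
by rewrite eqxx eq_sym.
Qed.

(** Membership in G_2 without reference to the algebra of octonions. *)
Definition autO A := A^T *m A = 1%:M /\ cross_morph A.

Lemma autO_mul A B : autO A -> autO B -> autO (A *m B).
Proof.
move=> [AA Ax] [BB Bx]; split.
  by rewrite trmx_mul mulmxA -[_ *m _ *m A]mulmxA AA mulmx1.
by move=> x y; rewrite -!mulmxA Ax Bx.
Qed.

Lemma autO_tr A : autO A -> autO A^T.
Proof.
move=> [AA Ax]; have AA' := mulmx1C AA; split; first by rewrite trmxK.
move=> x y; rewrite -[LHS]mul1mx -AA -mulmxA -Ax !mulmxA.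
by rewrite AA' !mul1mx.
Qed.

Definition cj (x : 'cV[C]_7) : 'cV[C]_7 := cmx x.

Lemma cjK : involutive cj.
Proof. by move=> x; apply/colP => i; rewrite !mxE conjCK. Qed.
Lemma cj0 : cj 0 = 0.
Proof. by apply/colP => i; rewrite !mxE rmorph0. Qed.
Lemma cjD : {morph cj : x y / x + y}.
Proof. by move=> x y; apply/colP => i; rewrite !mxE rmorphD. Qed.
Lemma cjZ a x : cj (a *: x) = a^* *: cj x.
Proof. by apply/colP => i; rewrite !mxE rmorphM. Qed.

Lemma cjN x : cj (- x) = - cj x.
Proof. by apply/colP => i; rewrite !mxE rmorphN. Qed.

Lemma crossO_cj x y : crossO (cj x) (cj y) = cj (crossO x y).
Proof.
apply: entryP => k k7; rewrite entry_crossO//.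
have E z i : entry (cj z) i = (entry z i)^* by rewrite /entry mxE.
by rewrite E entry_crossO// /cross_entry !E -!rmorphM -!rmorphB -!rmorphD.
Qed.

Lemma cmxM m n p (A : 'M[C]_(m, n)) (B : 'M[C]_(n, p)) : cmx (A *m B) = cmx A *m cmx B.
Proof. exact: (map_mxM (@Num.conj C)). Qed.
Lemma autO_conj A : autO A -> autO (cmx A).
Proof.
move=> [AA Ax]; split.
  by rewrite map_trmx -cmxM AA (map_mx1 (@Num.conj C)).
move=> x y; rewrite -[x]cjK -[y]cjK /cj -!cmxM.
by rewrite [LHS]crossO_cj Ax [in RHS](crossO_cj (cj x) (cj y)) -cmxM.
Qed.

(** For null orthogonal x and y this is the exponential of s times the
    endomorphism above, whose square is then zero. *)
Definition transv (s : C) x y : 'M[C]_7 := 1%:M + s *: (y *m x^T - x *m y^T).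

Lemma transvE s x y u : transv s x y *m u = u + s *: skew x y u.
Proof.
rewrite /transv mulmxDl mul1mx -scalemxAl mulmxBl -!mulmxA !dot_tr.
by rewrite !mul_mx_scalar.
Qed.

(** The derivation N = skew x y satisfies N^2 = 0 and N u x N v = 0, so that 1 +
    s N is multiplicative. *)
Lemma transv_autO s x y : dotC x x = 0 -> dotC y y = 0 -> dotC x y = 0 ->
  crossO x y = 0 -> autO (transv s x y).
Proof.
move=> xx yy xy cxy.
split.
  pose N : 'M[C]_7 := y *m x^T - x *m y^T.
  have NN : N *m N = 0.
    rewrite /N mulmxBl !mulmxBr -!mulmxA !(mulmxA x^T) !(mulmxA y^T) !dot_tr.
    by rewrite xx yy [dotC y x]dotCC xy !mul_scalar_mx !scale0r !mulmx0 !subr0.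
  have NT : N^T = - N by rewrite /N linearB /= !trmx_mul !trmxK opprB.
  have TT : (1%:M + s *: N)^T = 1%:M - s *: N.
    by apply/matrixP => i j; have := congr1 (fun M : 'M[C]_7 => M i j) NT; rewrite !(mxE, eq_sym j) => ->; rewrite mulrN.
  rewrite /transv -/N TT mulmxDl mul1mx mulNmx.
  by rewrite mulmxDr mulmx1 -scalemxAl -scalemxAr NN !scaler0 addr0 addrK.
have D u v : skew x y (crossO u v) = crossO (skew x y u) v + crossO u (skew x y v).
  have := congr1 (fun w : 'cV[C]_7 => (2%:R : C)^-1 *: w) (skew_deriv u v cxy xy).
  have K (w : 'cV[C]_7) : (2%:R : C)^-1 *: (w *+ 2) = w.
    by rewrite -[w *+ 2]scaler_nat scalerA mulVf ?scale1r// pnatr_eq0.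
  by rewrite !K.
have Z u v : crossO (skew x y u) (skew x y v) = 0.
  have yx0 : crossO y x = 0 by rewrite crossC cxy oppr0.
  rewrite /skew !(crossDl, crossDr, crossNl, crossNr, crossZl, crossZr) !crossxx cxy yx0.
  by rewrite !(scaler0, oppr0, addr0).
move=> u v; rewrite !transvE D; move: (Z u v).
move: (skew x y u) (skew x y v) => a b ab.
rewrite !(crossDl, crossDr, crossZl, crossZr) ab !scaler0 addr0.
by rewrite scalerDr addrAC -!addrA; congr (_ + _); rewrite addrC.
Qed.

End CrossAutomorphisms.

Section G2char.
Context {R : realType}.
Local Notation C := (Cplx R).
Implicit Types (A B : 'M[C]_7) (x y : 'cV[C]_7).

Definition octmap A (u : oct C) : oct C := (u.1, A *m u.2).

Lemma octmap_linear A : linear (octmap A).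
Proof. by move=> a u v; rewrite /octmap /= mulmxDr -scalemxAr. Qed.

HB.instance Definition _ A :=
  GRing.isLinear.Build C (oct C) (oct C) *:%R (octmap A) (octmap_linear A).

(** An automorphism fixes the unit, so it is determined by its restriction A to
    the imaginary part, and comparing real and imaginary parts of the products
    of imaginary elements gives the two conditions on A. *)
Lemma G2P A : G2 A <-> autO A.
Proof.
split=> [[f [[g gK fK] fM fA]]|[AA Ax]].
  pose one : oct C := (1, 0).
  have mul1O (u : oct C) : mulO one u = u.
    rewrite /mulO /= mul1r scale1r scaler0 addr0; case: u => a x /=.
    have -> : crossO 0 x = 0 by have := crossZl 0 x x; rewrite !scale0r.
    by rewrite addr0 /dotC trmx0 mul0mx mxE subr0.
  have mulO1 (u : oct C) : mulO u one = u.
    rewrite /mulO /= mulr1 scale1r scaler0 add0r; case: u => a x /=.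
    by rewrite cross0r addr0 /dotC mulmx0 mxE subr0.
  have f1 : f one = one.
    by have := fM one (g one); rewrite mul1O fK mulO1 => <-.
  have fE (u : oct C) : f u = (u.1, A *m u.2).
    (* The image of 1 is 1, so that f is determined by A. *)
    have uE : u = u.1 *: one + imO u.2.
      apply: injective_projections => /=; first by rewrite addr0 [RHS]mulr1.
      by rewrite scaler0 add0r.
    rewrite {1}uE linearD linearZ /= f1 fA.
    apply: injective_projections => /=; first by rewrite addr0 [LHS]mulr1.
    by rewrite scaler0 add0r.
  (* Real and imaginary parts of the product of two imaginary octonions. *)
  have H x y : (- dotC x y, A *m crossO x y) = (- dotC (A *m x) (A *m y), crossO (A *m x) (A *m y)) :> oct C.
    have := fM (imO x) (imO y); rewrite !fE /mulO /imO /=.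
    by rewrite !mul0r !scale0r !add0r.
  split; last by move=> x y; have /(congr1 snd)/= := H x y.
  by apply/orthP => x y; have /(congr1 fst)/= /oppr_inj := H x y.
exists (octmap A); split.
- by exists (octmap A^T) => u; rewrite /= /octmap /= mulmxA ?AA ?(mulmx1C AA) mul1mx; case: u.
- move=> u v; rewrite /octmap /mulO /=; congr (_, _).
    by rewrite ((orthP A).1 AA).
  by rewrite !mulmxDr Ax -!scalemxAr.
- by move=> x.
Qed.

End G2char.

(** * Products of anticommuting elements *)

Section AnticommSign.
Context {K : nzRingType}.

Definition anticomm n (w : 'I_n -> K) := forall i j, i != j -> w i * w j = - (w j * w i).

Definition sign_prop n (s : {perm 'I_n}) := forall w : 'I_n -> K, anticomm w ->
  \prod_i w (s i) = (-1) ^+ s * \prod_i w i.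

Lemma sign_propM n (s t : {perm 'I_n}) : sign_prop s -> sign_prop t -> sign_prop (s * t)%g.
Proof.
move=> hs ht w aw; have awt : anticomm (w \o t) by move=> i j ij; apply: aw; rewrite (inj_eq perm_inj).
under eq_bigr do rewrite permM.
by rewrite [LHS](hs (w \o t) awt) (ht w aw) odd_permM signr_addb mulrA.
Qed.

Lemma sign_prop1 n : sign_prop (1%g : {perm 'I_n}).
Proof. by move=> w _; rewrite odd_perm1 mul1r; apply: eq_bigr => i _; rewrite perm1. Qed.

Lemma prod_swap n (w : nat -> K) k : (k.+1 < n)%N -> w k * w k.+1 = - (w k.+1 * w k) ->
  let t i := if i == k then k.+1 else if i == k.+1 then k else i in
  \prod_(0 <= i < n) w (t i) = - \prod_(0 <= i < n) w i.
Proof.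
move=> kn wk t.
have L : \prod_(0 <= i < k) w (t i) = \prod_(0 <= i < k) w i.
  apply: eq_big_nat => i /andP[_ ik]; rewrite /t ltn_eqF// ltn_eqF//; exact: ltnW.
have U : \prod_(k.+2 <= i < n) w (t i) = \prod_(k.+2 <= i < n) w i.
  apply: eq_big_nat => i /andP[ki _]; rewrite /t gtn_eqF//; last exact: ltnW.
  by rewrite gtn_eqF.
have E (g : nat -> K) : \prod_(0 <= i < n) g i =
    \prod_(0 <= i < k) g i * (g k * g k.+1) * \prod_(k.+2 <= i < n) g i.
  rewrite (big_cat_nat (n := k)) //=; last by rewrite ltnW// ltnW.
  rewrite -mulrA; congr (_ * _); rewrite big_ltn; last exact: ltnW.
  by rewrite big_ltn// mulrA.
rewrite !E L U /t !eqxx gtn_eqF// wk; set p := w _ * w _.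
by rewrite mulrN mulNr opprK.
Qed.

Lemma sign_prop_adj n (i j : 'I_n) : val j = (val i).+1 -> sign_prop (tperm i j).
Proof.
move=> ji w aw; have ij : i != j by rewrite -val_eqE /= ji ltn_eqF.
rewrite odd_tperm ij expr1 mulN1r.
pose w' k := oapp w 1 (insub k).
have w'E k : w k = w' (val k) by rewrite /w' valK.
have jn : ((val i).+1 < n)%N by rewrite -ji ltn_ord.
have wij : w' (val i) * w' (val i).+1 = - (w' (val i).+1 * w' (val i)).
  by rewrite -ji -!w'E aw.
rewrite [in RHS](eq_bigr (w' \o val)) => [|k _]; last exact: w'E.
have := prod_swap jn wij; rewrite /= !big_mkord => <-.
apply: eq_bigr => k _; rewrite w'E; congr w'.
case: tpermP => [->|->|/eqP ki /eqP kj]; first by rewrite eqxx.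
  by rewrite ji eqxx gtn_eqF.
by rewrite -ji !val_eqE (negbTE ki) (negbTE kj).
Qed.

(** A transposition is a product of adjacent ones by conjugation; only for
    adjacent factors does the product rule give the sign at once. *)
Lemma sign_prop_tperm n (i j : 'I_n) : i != j -> sign_prop (tperm i j).
Proof.
have main d (i' j' : 'I_n) : val j' = (val i' + d).+1 -> sign_prop (tperm i' j').
  elim: d j' => [|d IH] j' jE; first by apply: sign_prop_adj; rewrite jE addn0.
  have kn : ((val i' + d).+1 < n)%N by rewrite (leq_trans _ (ltn_ord j'))// -[X in (_ < X)%N]/(val j').+1 jE addnS.
  pose k := Ordinal kn.
  have kj : sign_prop (tperm k j') by apply: sign_prop_adj; rewrite jE /= addnS.
  have -> : tperm i' j' = (tperm k j' * tperm i' k * tperm k j')%g.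
    rewrite -{1}[tperm k j']tpermV -mulgA -/(conjg (tperm i' k) (tperm k j')) tpermJ tpermL tpermD//.
      by rewrite -val_eqE /= gtn_eqF// ltnS leq_addr.
    by rewrite -val_eqE /= jE gtn_eqF// ltnS leq_addr.
  by apply: (sign_propM _ kj); apply: (sign_propM kj); exact: IH.
have [ij _|ji _|/val_inj ->] := ltngtP i j; last by rewrite eqxx.
  by apply: (main (j - i.+1)%N); rewrite /= -addSn subnKC.
by rewrite tpermC; apply: (main (i - j.+1)%N); rewrite /= -addSn subnKC.
Qed.

Lemma sign_propP n (s : {perm 'I_n}) : sign_prop s.
Proof.
have [ts -> tsP] := prod_tpermP s.
elim: ts tsP => [_|t ts IH /= /andP[t1 t2]]; first by rewrite big_nil; exact: sign_prop1.
by rewrite big_cons; apply: sign_propM; [exact: sign_prop_tperm|exact: IH].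
Qed.

End AnticommSign.

(** * Matrices in G_2 have determinant one *)

Section AnticommDet.
Context {K : comNzRingType} {M : algType K}.

(** The expansion of the determinant, with anticommuting elements in place of
    rows of scalars: terms with a repeated index cancel under alternation, and
    the others are equal up to the sign of the permutation. *)
Lemma alt_prod_det n (w : 'I_n -> M) (A : 'M[K]_n) : anticomm w ->
  \sum_(s : 'S_n) (-1) ^+ s * \prod_i (\sum_j A j (s i) *: w j) =
  \det A *: ((\prod_i w i) *+ n`!).
Proof.
move=> aw.
transitivity (\sum_(f : {ffun 'I_n -> 'I_n}) \det (\matrix_(i, j) A (f i) j) *: \prod_i w (f i)).
  under eq_bigr do rewrite bigA_distr_bigA /= big_distrr /=.
  rewrite exchange_big /=; apply: eq_bigr => f _; rewrite /determinant scaler_suml.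
  apply: eq_bigr => s _; rewrite scaler_prod -scalerA scaler_sign mulr_sign.
  by under [in RHS]eq_bigr do rewrite mxE.
rewrite (bigID (fun f : {ffun 'I_n -> 'I_n} => injectiveb f)) /= addrC big1 ?add0r => [|f Uf].
  rewrite (reindex (@pval _)) /=; last first.
    pose in_Sn := insubd (1%g : 'S_n).
    by exists in_Sn => /= f Uf; first apply: val_inj; apply: insubdK.
  rewrite -card_Sn -sumr_const scaler_sumr.
  apply: eq_big => /= [s | s _]; rewrite ?(valP s) //.
  have -> : \matrix_(i, j) A (pval s i) j = row_perm s A.
    by apply/matrixP => i j; rewrite !mxE pvalE.
  under eq_bigr do rewrite pvalE.
  rewrite (sign_propP s aw) row_permE det_mulmx det_perm mulr_sign -scaler_sign scalerA.
  by rewrite mulrAC -signr_addb addbb mul1r.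
case/injectivePn: Uf => i1 [i2 Di12 Ef12].
by rewrite (determinant_alternate Di12) ?scale0r//= => j; rewrite !mxE Ef12.
Qed.

End AnticommDet.

Section Clifford.
Context {C : numClosedFieldType}.
Implicit Types (A B : 'M[C]_7) (x y u v : 'cV[C]_7).

Definition cross_mx x : 'M[C]_7 := \matrix_(i, j) crossO x (delta_mx j 0) i 0.

Lemma cV_sum_delta n (y : 'cV[C]_n) : y = \sum_j y j 0 *: delta_mx j 0.
Proof. by rewrite {1}[y]matrix_sum_delta; apply: eq_bigr => i _; rewrite big_ord1. Qed.

Lemma cross_mxE x y : cross_mx x *m y = crossO x y.
Proof.
rewrite [in RHS](cV_sum_delta y) (big_morph (crossO x) (crossDr x) (cross0r x)).
apply/colP => i; rewrite mxE summxE; apply: eq_bigr => j _.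
by rewrite crossZr !mxE mulrC.
Qed.

Lemma eq_mulmx m n (A B : 'M[C]_(m, n)) : (forall v : 'cV[C]_n, A *m v = B *m v) -> A = B.
Proof. by move=> h; apply/matrixP => i j; have := h (delta_mx j 0); rewrite -!colE => /colP/(_ i); rewrite !mxE. Qed.

(** Vectors of the 8-dimensional algebra as columns, the real part first. *)
Definition v8 (a : C) y : 'cV[C]_8 := col_mx (a%:M : 'M[C]_1) y.

Lemma v8D a b x y : v8 a x + v8 b y = v8 (a + b) (x + y).
Proof. by rewrite /v8 (@add_col_mx _ 1 7) -raddfD. Qed.
Lemma v8Z c a x : c *: v8 a x = v8 (c * a) (c *: x).
Proof. by rewrite /v8 (@scale_col_mx _ 1 7) scale_scalar_mx. Qed.
Lemma v8P (S T : 'M[C]_8) : (forall a y, S *m v8 a y = T *m v8 a y) -> S = T.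
Proof.
move=> h; apply: eq_mulmx => v; have := h ((usubmx (v : 'cV[C]_(1 + 7))) 0 0) (dsubmx (v : 'cV[C]_(1 + 7))).
by rewrite /v8 -mx11_scalar vsubmxK.
Qed.

(** Left multiplication by an imaginary octonion; these matrices satisfy the
    Clifford relations. *)
Definition left_mul x : 'M[C]_8 := block_mx (0 : 'M[C]_1) (- x^T) x (cross_mx x).

Lemma left_mulE x (a : C) y : left_mul x *m v8 a y = v8 (- dotC x y) (a *: x + crossO x y).
Proof.
rewrite /left_mul /v8 (mul_block_col (0 : 'M[C]_1)) mul0mx add0r mulNmx dot_tr cross_mxE.
by rewrite mul_mx_scalar rmorphN.
Qed.

Lemma left_mul_anti x y : left_mul x *m left_mul y + left_mul y *m left_mul x = (- (2 * dotC x y))%:M.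
Proof.
apply: v8P => a z; rewrite mulmxDl -!mulmxA !left_mulE v8D mul_scalar_mx v8Z.
rewrite !(dotDr, dotZr, crossDr, crossZr) (cross_crossC x y z).
rewrite -!dot_crossCA [dotC y x]dotCC [crossO y x]crossC.
have -> : dotC (- crossO x y) z = - dotC (crossO x y) z by rewrite dotCC dotNr dotCC.
congr v8; first by ring.
apply/colP => i; rewrite !mxE; ring.
Qed.

Definition D8 A : 'M[C]_8 := block_mx (1 : 'M[C]_1) 0 0 A.
Lemma D8E A a y : D8 A *m v8 a y = v8 a (A *m y).
Proof. by rewrite /D8 /v8 (mul_block_col (1 : 'M[C]_1)) mul1mx !mul0mx addr0 add0r. Qed.

Lemma left_mul_G2 A x : A^T *m A = 1%:M -> cross_morph A -> left_mul (A *m x) = D8 A *m left_mul x *m D8 A^T.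
Proof.
move=> AA Ax; apply: v8P => a y; rewrite -!mulmxA !(D8E, left_mulE).
(* Write y as an image to use that A preserves the product. *)
have yE : y = A *m (A^T *m y) by rewrite mulmxA (mulmx1C AA) mul1mx.
rewrite {1 2}yE Ax ((orthP A).1 AA) mulmxDr; congr (v8 _ (_ + _)).
by rewrite -scalemxAr.
Qed.

Definition e7 (i : 'I_7) : 'cV[C]_7 := delta_mx i 0.

Lemma entry_e7 i k : (k < 7)%N -> entry (e7 i) k = (k == i)%:R.
Proof. by move=> k7; rewrite /entry mxE andbT -val_eqE /= inordK. Qed.

Lemma dot_e7 i y : dotC (e7 i) y = y i 0.
Proof. by rewrite /dotC trmx_delta -rowE mxE. Qed.

(** Explicit coordinates, to compute with products of the left multiplications
    by basis vectors. *)
Definition n8 (a y0 y1 y2 y3 y4 y5 y6 : C) :=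
  v8 a (\col_(k < 7) nth 0 [:: y0; y1; y2; y3; y4; y5; y6] k).

Lemma n8_eq a y : v8 a y = n8 a (entry y 0) (entry y 1) (entry y 2) (entry y 3) (entry y 4) (entry y 5) (entry y 6).
Proof.
rewrite /n8; congr v8; apply: entryP => k k7; rewrite [RHS]/entry mxE inordK//.
by case: k k7 => [|[|[|[|[|[|[|k]]]]]]].
Qed.

Lemma entry_nth (s : seq C) k : (k < 7)%N -> entry (\col_(k < 7) nth 0 s k) k = nth 0 s k.
Proof. by move=> k7; rewrite /entry mxE inordK. Qed.

Lemma left_mul_e7 (i : 'I_7) (a y0 y1 y2 y3 y4 y5 y6 : C) :
  left_mul (e7 i) *m n8 a y0 y1 y2 y3 y4 y5 y6 =
  let Y := fun k : nat => nth 0 [:: y0; y1; y2; y3; y4; y5; y6] k in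
  let E := fun k : nat => (k == i :> nat)%:R : C in
  let z k := a * E k + cross_entry E Y k in
  n8 (- nth 0 [:: y0; y1; y2; y3; y4; y5; y6] i) (z 0%N) (z 1%N) (z 2%N) (z 3%N) (z 4%N) (z 5%N) (z 6%N).
Proof.
move=> /=; rewrite {1}/n8 left_mulE n8_eq dot_e7 mxE.
by congr n8; rewrite entryD entryZ entry_e7// entry_crossO// /cross_entry !entry_e7// !entry_nth.
Qed.

Lemma prod7 (K : nzRingType) (F : 'I_7 -> K) : \prod_i F i =
  F (inord 0) * (F (inord 1) * (F (inord 2) * (F (inord 3) * (F (inord 4) * (F (inord 5) * F (inord 6)))))).
Proof.
by rewrite !big_ord_recl big_ord0 mulr1;
  do 6?[congr (_ * _)]; congr (F _); apply: val_inj; rewrite /= inordK.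
Qed.

Lemma mulM8 (S T : 'M[C]_8) (v : 'cV[C]_8) : (S * T) *m v = S *m (T *m v).
Proof. exact: esym (mulmxA S T v). Qed.

(** The image of the volume element of the Clifford algebra of rank 7 in this
    spin module is a sign. *)
Lemma prod_e7 : \prod_i left_mul (e7 i) = - 1.
Proof.
pose W k := left_mul (e7 (inord k)).
have WE : \prod_i left_mul (e7 i) = W 0%N * (W 1%N * (W 2%N * (W 3%N * (W 4%N * (W 5%N * W 6%N))))).
  exact: prod7.
have b0 (a y0 y1 y2 y3 y4 y5 y6 : C) : W 0%N *m n8 a y0 y1 y2 y3 y4 y5 y6 =
    n8 (- y0) (a) (- y3) (- y6) (y1) (- y5) (y4) (y2).
  by rewrite /W left_mul_e7 /= !inordK// /cross_entry /=; congr n8; ring.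
have b1 (a y0 y1 y2 y3 y4 y5 y6 : C) : W 1%N *m n8 a y0 y1 y2 y3 y4 y5 y6 =
    n8 (- y1) (y3) (a) (- y4) (- y0) (y2) (- y6) (y5).
  by rewrite /W left_mul_e7 /= !inordK// /cross_entry /=; congr n8; ring.
have b2 (a y0 y1 y2 y3 y4 y5 y6 : C) : W 2%N *m n8 a y0 y1 y2 y3 y4 y5 y6 =
    n8 (- y2) (y6) (y4) (a) (- y5) (- y1) (y3) (- y0).
  by rewrite /W left_mul_e7 /= !inordK// /cross_entry /=; congr n8; ring.
have b3 (a y0 y1 y2 y3 y4 y5 y6 : C) : W 3%N *m n8 a y0 y1 y2 y3 y4 y5 y6 =
    n8 (- y3) (- y1) (y0) (y5) (a) (- y6) (- y2) (y4).
  by rewrite /W left_mul_e7 /= !inordK// /cross_entry /=; congr n8; ring.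
have b4 (a y0 y1 y2 y3 y4 y5 y6 : C) : W 4%N *m n8 a y0 y1 y2 y3 y4 y5 y6 =
    n8 (- y4) (y5) (- y2) (y1) (y6) (a) (- y0) (- y3).
  by rewrite /W left_mul_e7 /= !inordK// /cross_entry /=; congr n8; ring.
have b5 (a y0 y1 y2 y3 y4 y5 y6 : C) : W 5%N *m n8 a y0 y1 y2 y3 y4 y5 y6 =
    n8 (- y5) (- y4) (y6) (- y3) (y2) (y0) (a) (- y1).
  by rewrite /W left_mul_e7 /= !inordK// /cross_entry /=; congr n8; ring.
have b6 (a y0 y1 y2 y3 y4 y5 y6 : C) : W 6%N *m n8 a y0 y1 y2 y3 y4 y5 y6 =
    n8 (- y6) (- y2) (- y5) (y0) (- y4) (y3) (y1) (a).
  by rewrite /W left_mul_e7 /= !inordK// /cross_entry /=; congr n8; ring.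
clearbody W; rewrite {}WE; apply: v8P => a y.
rewrite !mulM8 n8_eq b6 b5 b4 b3 b2 b1 b0.
have -> : (- 1 : 'M[C]_8) = (- 1)%:M by rewrite raddfN.
rewrite mul_scalar_mx scaleN1r.
rewrite -[RHS]scaleN1r /n8 v8Z mulN1r.
congr v8; rewrite ?opprK//; apply: entryP => k k7; rewrite entryZ !entry_nth// mulN1r.
by case: k k7 => [|[|[|[|[|[|[|k]]]]]]].
Qed.

Lemma D8M A B : D8 A *m D8 B = D8 (A *m B).
Proof. by apply: v8P => a y; rewrite -mulmxA !D8E mulmxA. Qed.
Lemma D81 : D8 1%:M = 1%:M.
Proof. by apply: v8P => a y; rewrite D8E !mul1mx. Qed.

Lemma e7_anti : anticomm (fun i : 'I_7 => left_mul (e7 i)).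
Proof.
move=> i j ij; apply/eqP; rewrite -addr_eq0; apply/eqP; rewrite -!mulmxE left_mul_anti.
by rewrite dot_e7 mxE (negbTE ij) mulr0 oppr0 raddf0.
Qed.

Lemma conj_prod (I : finType) (F : I -> 'M[C]_8) (S T : 'M[C]_8) : S * T = 1 -> T * S = 1 ->
  \prod_i (S * F i * T) = S * (\prod_i F i) * T.
Proof.
move=> ST TS; rewrite (big_morph (fun X : 'M[C]_8 => S * X * T) (id1 := 1) (op1 := *%R))//.
- by move=> x y; rewrite -!mulrA; congr (S * (x * _)); rewrite !mulrA TS mul1r.
- by rewrite mulr1.
Qed.

Lemma left_mulZsum (n : nat) (c : 'I_n -> C) (F : 'I_n -> 'cV[C]_7) :
  left_mul (\sum_j c j *: F j) = \sum_j c j *: left_mul (F j).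
Proof.
have LD x y : left_mul (x + y) = left_mul x + left_mul y.
  apply: v8P => a z; rewrite mulmxDl !left_mulE v8D scalerDr crossDl; congr v8.
    by rewrite dotCC dotDr opprD ![dotC z _]dotCC.
  by rewrite -!addrA; congr (_ + _); rewrite addrCA.
have LZ d x : left_mul (d *: x) = d *: left_mul x.
  apply: v8P => a z; rewrite -scalemxAl !left_mulE v8Z scalerDr crossZl; congr v8.
    by rewrite dotCC dotZr mulrN dotCC.
  by rewrite !scalerA mulrC.
have L0 : left_mul 0 = 0 by rewrite -(scale0r (0 : 'cV[C]_7)) LZ scale0r.
rewrite (big_morph left_mul LD L0); apply: eq_bigr => j _; exact: LZ.
Qed.

(** Left multiplication by A x is the conjugate of that by x under 1 + A. Hence
    the alternating product of the left multiplications by the A e_i, which is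
    det A times that of the e_i, is a conjugate of a scalar and so unchanged. *)
Lemma autO_det A : autO A -> \det A = 1.
Proof.
move=> [AA Ax].
have H := @alt_prod_det _ _ 7 (fun i => left_mul (e7 i)) A e7_anti.
have DD : D8 A * D8 A^T = 1 by rewrite -mulmxE D8M (mulmx1C AA) D81.
have DD' : D8 A^T * D8 A = 1 by rewrite -mulmxE D8M AA D81.
have E (s : 'S_7) : \prod_i (\sum_j A j (s i) *: left_mul (e7 j)) = (-1) ^+ s * - 1.
  transitivity (\prod_i (D8 A * left_mul (e7 (s i)) * D8 A^T)).
    apply: eq_bigr => i _; rewrite -left_mulZsum -!mulmxE -(left_mul_G2 _ AA Ax); congr left_mul.
    rewrite [RHS](cV_sum_delta (A *m _)); apply: eq_bigr => j _.
    by rewrite -colE mxE.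
  rewrite (conj_prod _ DD DD') (sign_propP s e7_anti) prod_e7 mulr_sign.
  by case: (odd_perm s); rewrite ?mulrN1 ?opprK ?mulrN ?mulNr ?mulr1 ?mul1r ?DD// mulrN1 opprK.
have {H} : - ((7`!)%:R : 'M[C]_8) = \det A *: (- (7`!)%:R).
  rewrite prod_e7 mulNrn in H; rewrite -H.
  rewrite (eq_bigr (fun=> -1)); last first.
    by move=> s _; rewrite E mulrA -signr_addb addbb mul1r.
  by rewrite sumr_const card_Sn mulNrn.
move=> /(congr1 (fun M : 'M[C]_8 => M 0 0)).
have -> : (7`!)%:R = ((7`!)%:R : C)%:M :> 'M[C]_8 by rewrite -scaler_nat scalemx1.
rewrite !mxE /= mulrN => /oppr_inj; rewrite mulr1n => /esym/eqP.
rewrite -[eqbRHS]mul1r -subr_eq0 -mulrBl mulf_eq0 pnatr_eq0 subr_eq0.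
by rewrite -[7`! == 0%N]negbK -lt0n fact_gt0 orbF => /eqP.
Qed.
End Clifford.

(** * The simple factor of a null vector *)

Section Projections.
Context {C : numClosedFieldType}.
Local Notation cmx := (map_mx (fun z : C => z^*)).
Implicit Types (A B E F : 'M[C]_7) (k l m u v : 'cV[C]_7) (s t : C).

(** The Hermitian square norm, written with the bilinear form. *)
Definition nrm k : C := dotC k (cj k).

Lemma dotE_sum k l : dotC k l = \sum_i k i 0 * l i 0.
Proof. by rewrite /dotC mxE; apply: eq_bigr => i _; rewrite mxE. Qed.

Lemma nrm_eq0 k : (nrm k == 0) = (k == 0).
Proof.
apply/eqP/eqP => [|->]; last by rewrite /nrm /dotC trmx0 mul0mx mxE.
rewrite /nrm dotE_sum => h; apply/colP => i; rewrite mxE.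
have h0 j : true -> 0 <= k j 0 * cj k j 0 by rewrite mxE -normCK exprn_ge0.
have /(_ i isT)/eqP := psumr_eq0P h0 h.
by rewrite mxE -normCK expf_eq0 normr_eq0 /= => /eqP.
Qed.

Lemma dot_conj k l : dotC (cj k) (cj l) = (dotC k l)^*.
Proof.
rewrite !dotE_sum rmorph_sum; apply: eq_bigr => i _.
by rewrite !mxE rmorphM.
Qed.

Lemma nrm_conj k : nrm (cj k) = nrm k.
Proof. by rewrite /nrm cjK dotCC. Qed.

Lemma nrm_real k : (nrm k)^* = nrm k.
Proof. by rewrite /nrm -dot_conj cjK dotCC. Qed.

Definition null k := k != 0 /\ dotC k k = 0.

Lemma null_conj k : null k -> null (cj k).
Proof.
move=> [k0 kk]; split; last by rewrite dot_conj kk rmorph0.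
by rewrite -nrm_eq0 nrm_conj nrm_eq0.
Qed.

(** Projection onto k along the orthogonal of conj k; its transpose is the
    projection onto conj k. *)
Definition projl k : 'M[C]_7 := (nrm k)^-1 *: (k *m (cj k)^T).

Lemma projlE k u : projl k *m u = (dotC (cj k) u / nrm k) *: k.
Proof. by rewrite /projl -scalemxAl -mulmxA dot_tr mul_mx_scalar scalerA mulrC. Qed.

Lemma projl_tr k : (projl k)^T = projl (cj k).
Proof. by rewrite /projl linearZ /= trmx_mul trmxK nrm_conj cjK. Qed.

Lemma projl_conj k : cmx (projl k) = (projl k)^T.
Proof.
rewrite projl_tr; apply/matrixP => i j; rewrite !mxE !big_ord1 !mxE nrm_conj !rmorphM.
by rewrite fmorphV /= nrm_real.
Qed.

Lemma projl_idem k : k != 0 -> projl k *m projl k = projl k.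
Proof.
move=> k0; rewrite {2}/projl -scalemxAr mulmxA projlE /nrm [dotC (cj k) k]dotCC -/(nrm k).
by rewrite divff ?nrm_eq0// scale1r.
Qed.

Lemma projl_tr0 k : dotC k k = 0 -> projl k *m (projl k)^T = 0.
Proof.
move=> kk; rewrite projl_tr {2}/projl -scalemxAr mulmxA projlE dot_conj kk rmorph0 mul0r.
by rewrite scale0r mul0mx scaler0.
Qed.

(** The simple factor p_(alpha,L) at the value t of (z - conj alpha) / (z -
    alpha), for L spanned by k. In this form it is a one-parameter group in t.
    *)
Definition pmx t k : 'M[C]_7 := 1%:M + (t - 1) *: (projl k)^T + (t^-1 - 1) *: projl k.

Lemma pmx_tr t k : (pmx t k)^T = pmx t^-1 k.
Proof.
rewrite /pmx; move: (projl k) => E; apply/matrixP => i j; rewrite !mxE invrK (eq_sym j); ring.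
Qed.

Lemma pmx1 k : pmx 1 k = 1%:M.
Proof. by rewrite /pmx invr1 subrr !scale0r !addr0. Qed.

Lemma pmx_mul s t k : null k -> s != 0 -> t != 0 -> pmx s k *m pmx t k = pmx (s * t) k.
Proof.
move=> [k0 kk] s0 t0; have E2 := projl_idem k0; have EF := projl_tr0 kk.
have F2 : (projl k)^T *m (projl k)^T = (projl k)^T by rewrite -trmx_mul E2.
have FE : (projl k)^T *m projl k = 0.
  by rewrite projl_tr -[X in _ *m X]trmxK projl_tr projl_tr0// dot_conj kk rmorph0.
have P (X Y Z : 'M[C]_7) a b : X *m Y = Z -> (a *: X) *m (b *: Y) = (a * b) *: Z.
  by move=> <-; rewrite -scalemxAl -scalemxAr scalerA.
rewrite /pmx !mulmxDl !mulmxDr !mul1mx !mulmx1.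
rewrite (P _ _ _ _ _ E2) (P _ _ _ _ _ F2) (P _ _ _ _ _ EF) (P _ _ _ _ _ FE) !scaler0.
move: (projl k) => E; apply/matrixP => i j; rewrite !mxE; field.
by rewrite s0 t0.
Qed.

Lemma pmx_orth t k : null k -> t != 0 -> (pmx t k)^T *m pmx t k = 1%:M.
Proof. by move=> kn t0; rewrite pmx_tr pmx_mul ?invr_eq0// mulVf// pmx1. Qed.

(** The factor is the square of the factor at a square root of t, and orthogonal
    matrices have determinant of square one. *)
Lemma pmx_det t k : null k -> t != 0 -> \det (pmx t k) = 1.
Proof.
move=> kn t0; have s0 : sqrtC t != 0 by rewrite sqrtC_eq0.
have := congr1 (@determinant _ _) (pmx_orth kn s0).
by rewrite det_mulmx det_tr -det_mulmx pmx_mul// -expr2 sqrtCK det1.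
Qed.

(** This gives the reality condition of the loop, because t at conj z is the
    conjugate of the inverse of t at z. *)
Lemma pmx_conj t k : cmx (pmx t k) = pmx (t^*)^-1 k.
Proof.
rewrite /pmx -projl_conj; apply/matrixP => i j; have := projl_conj k.
move: (projl k) => E Ec; have {}Ec a b : (E a b)^* = E b a.
  by have /matrixP/(_ a b) := Ec; rewrite !mxE.
rewrite !mxE !rmorphD /= !rmorphM /= !rmorphB /= !rmorph1 fmorphV invrK !Ec conjC_nat; ring.
Qed.

Lemma pmxE t k u : pmx t k *m u = u + ((t - 1) * (dotC k u / nrm k)) *: cj k
   + ((t^-1 - 1) * (dotC (cj k) u / nrm k)) *: k.
Proof.
rewrite /pmx !mulmxDl mul1mx -[((t - 1) *: _) *m u]scalemxAl -[((t^-1 - 1) *: _) *m u]scalemxAl.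
by rewrite projl_tr !projlE cjK nrm_conj !scalerA.
Qed.

End Projections.

(** * Admissible pairs of null vectors *)

Section SL2.
Context {C : numClosedFieldType}.
Implicit Types (a b c d s t : C).

Definition M2 a b c d : 'M[C]_2 :=
  \matrix_(i, j) (if i == 0 then if j == 0 then a else b else if j == 0 then c else d).

Lemma eq_M2 (A B : 'M[C]_2) : A 0 0 = B 0 0 -> A 0 1 = B 0 1 -> A 1 0 = B 1 0 ->
  A 1 1 = B 1 1 -> A = B.
Proof.
move=> h1 h2 h3 h4; apply/matrixP => i j.
have o2 (k : 'I_2) : k = 0 \/ k = 1.
  by case: k => [[|[|k]] //= kp]; [left|right]; exact: val_inj.
by case: (o2 i) => ->; case: (o2 j) => ->.
Qed.

Lemma M2M a b c d a' b' c' d' : M2 a b c d *m M2 a' b' c' d' =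
  M2 (a * a' + b * c') (a * b' + b * d') (c * a' + d * c') (c * b' + d * d').
Proof.
by apply: eq_M2; rewrite !mxE !big_ord_recl big_ord0 addr0 !mxE.
Qed.

(** Acts by A on the columns of e, by B^T on those of f and trivially on their
    orthogonal, when e and f are dual bases of isotropic planes; orthogonality
    amounts to B being the inverse of A. *)
Definition rho n (e f : 'M[C]_(n, 2)) (A B : 'M[C]_2) : 'M[C]_n :=
  1%:M + e *m (A - 1%:M) *m f^T + f *m (B^T - 1%:M) *m e^T.

Lemma rhoM n (e f : 'M[C]_(n, 2)) A B A' B' : e^T *m e = 0 -> f^T *m f = 0 ->
  e^T *m f = 1%:M -> rho e f A B *m rho e f A' B' = rho e f (A *m A') (B' *m B).
Proof.
move=> ee ff ef; have fe : f^T *m e = 1%:M by rewrite -[e]trmxK -trmx_mul ef trmx1.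
have key (X Y X' Y' : 'M[C]_2) :
  (1%:M + e *m X *m f^T + f *m Y *m e^T) *m (1%:M + e *m X' *m f^T + f *m Y' *m e^T) =
  1%:M + e *m (X + X' + X *m X') *m f^T + f *m (Y + Y' + Y *m Y') *m e^T.
  pose U := e *m X *m f^T; pose U' := e *m X' *m f^T.
  pose V := f *m Y *m e^T; pose V' := f *m Y' *m e^T.
  have h1 : U *m U' = e *m (X *m X') *m f^T.
    by rewrite /U /U' !mulmxA -[_ *m f^T *m e]mulmxA fe mulmx1.
  have h2 : V *m V' = f *m (Y *m Y') *m e^T.
    by rewrite /V /V' !mulmxA -[_ *m e^T *m f]mulmxA ef mulmx1.
  have h3 : U *m V' = 0 by rewrite /U /V' !mulmxA -[_ *m f^T *m f]mulmxA ff mulmx0 !mul0mx.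
  have h4 : V *m U' = 0 by rewrite /V /U' !mulmxA -[_ *m e^T *m e]mulmxA ee mulmx0 !mul0mx.
  rewrite [e *m (X + X' + _)]mulmxDr [e *m (X + X')]mulmxDr.
  rewrite [f *m (Y + Y' + _)]mulmxDr [f *m (Y + Y')]mulmxDr.
  rewrite [(e *m X + _ + _) *m f^T]mulmxDl [(e *m X + _) *m f^T]mulmxDl.
  rewrite [(f *m Y + _ + _) *m e^T]mulmxDl [(f *m Y + _) *m e^T]mulmxDl.
  rewrite -/U -/U' -/V -/V' -h1 -h2; move: h3 h4.
  clearbody U U' V V'; move=> h3 h4.
  rewrite !mulmxDl !mulmxDr !mul1mx !mulmx1 h3 h4 !addr0.
  by apply/matrixP => i j; rewrite !mxE; ring.
have E (U V : 'M[C]_2) : (U - 1%:M) + (V - 1%:M) + (U - 1%:M) *m (V - 1%:M) = U *m V - 1%:M.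
  rewrite mulmxBl mulmxBr mul1mx mulmx1; move: (U *m V) => W.
  by apply/matrixP => i j; rewrite !mxE; ring.
by rewrite /rho [LHS]key !E trmx_mul.
Qed.

(** The group SL_2 of a field is generated by unipotent matrices. *)
Lemma SL2_ind (P : C -> C -> C -> C -> Prop) :
  (forall a b c d a' b' c' d', P a b c d -> P a' b' c' d' ->
     P (a * a' + b * c') (a * b' + b * d') (c * a' + d * c') (c * b' + d * d')) ->
  (forall s, P 1 s 0 1) -> (forall s, P 1 0 s 1) ->
  forall a b c d, a * d - b * c = 1 -> P a b c d.
Proof.
move=> PM PU PV.
have main a b c d : c != 0 -> a * d - b * c = 1 -> P a b c d.
  move=> c0 h; have := PM _ _ _ _ _ _ _ _ (PM _ _ _ _ _ _ _ _ (PU ((a - 1) / c)) (PV c)) (PU ((d - 1) / c)).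
  rewrite !(mul0r, mulr0, mulr1, mul1r, addr0, add0r) divfK// addrCA subrr addr0.
  have -> : a * ((d - 1) / c) + (a - 1) / c = b.
    have -> : b = (a * d - 1) / c by rewrite -h; field.
    by field.
  have -> : c * ((d - 1) / c) + 1 = d by field.
  by [].
move=> a b c d h; have [c0|] := eqVneq c 0; last by move=> c0; exact: main.
move: h; rewrite c0 mulr0 subr0 => h.
have a0 : a != 0 by apply/eqP => a0; move: h; rewrite a0 mul0r => /eqP; rewrite eq_sym oner_eq0.
have := PM _ _ _ _ _ _ _ _ (PV (-1)) (main a b a (b + d) a0 _).
rewrite !(mul0r, mulr0, mulr1, mul1r, addr0, add0r, mulN1r) addNr addKr; apply.
by rewrite mulrDr h; ring.
Qed.

End SL2.

Section Admissible.
Context {C : numClosedFieldType}.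
Implicit Types (k l m u v : 'cV[C]_7) (s t : C).

(** For k orthogonal to conj l, the component of k in the middle summand
    attached to l. *)
Definition perp_part l k : 'cV[C]_7 := k - (dotC k l / nrm l) *: cj l.

(** Admissibility of the pair of lines spanned by l and k, in terms of vectors.
    *)
Record adm l k : Prop := Adm {
  adm_l : null l; adm_k : null k; adm_perp : dotC l (cj k) = 0;
  adm_neq0 : perp_part l k != 0; adm_cross : crossO l (perp_part l k) = 0 }.

(** The plane <l, m> is coassociative, with a basis orthogonal for the Hermitian
    form. The coassociative plane of an admissible pair (l, k) has this basis
    for m the middle component of k. *)
Record null_pair l m : Prop := NullPair {
  np_l : null l; np_m : null m; np_lm : dotC l m = 0;
  np_herm : dotC l (cj m) = 0; np_cross : crossO l m = 0 }.

Lemma adm_null_pair l k : adm l k -> null_pair l (perp_part l k).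
Proof.
case=> [ln kn lk m0 lm]; set b := dotC k l / nrm l.
have [[l0 ll] [k0 kk]] := (ln, kn).
have nl0 : nrm l != 0 by rewrite nrm_eq0.
have kl : dotC k (cj l) = 0 by rewrite -[k]cjK dot_conj dotCC lk rmorph0.
have lcl : dotC (cj l) (cj l) = 0 by rewrite dot_conj ll rmorph0.
have lcl' : dotC l (cj l) = nrm l by [].
split=> //.
- split=> //; rewrite /perp_part -/b !(dotDl, dotNl, dotZl, dotDr, dotNr, dotZr).
  by rewrite kk kl [dotC (cj l) k]dotCC kl lcl; ring.
- rewrite /perp_part !(dotDr, dotNr, dotZr) lcl' divfK// dotCC subrr//.
- have -> : cj (perp_part l k) = cj k - (b^*) *: l.
    by rewrite /perp_part cjD -scaleNr cjZ cjK rmorphN scaleNr.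
  by rewrite !(dotDr, dotNr, dotZr) lk ll mulr0 subrr.
Qed.

(** The vector v on the left satisfies conj v = - v, and <v, v> = 0 by the
    polarized norm identity; so its Hermitian norm - <v, v> vanishes. *)
Lemma cross_conj_pair l m : null_pair l m ->
  nrm l *: crossO m (cj m) + nrm m *: crossO l (cj l) = 0.
Proof.
case=> [[l0 ll] [m0 mm] lm lcm cx].
have mcl : dotC m (cj l) = 0 by rewrite -[m]cjK dot_conj dotCC lcm rmorph0.
set v := _ + _.
have cvv : cj v = - v.
  rewrite /v cjD !cjZ !nrm_real -!crossO_cj !cjK.
  by rewrite [crossO (cj m) m]crossC [crossO (cj l) l]crossC !scalerN opprD.
have n1 : dotC l (cj l) = nrm l by [].
have n2 : dotC m (cj m) = nrm m by [].
have n1' : dotC (cj l) l = nrm l by rewrite dotCC.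
have n2' : dotC (cj m) m = nrm m by rewrite dotCC.
have cc1 : dotC (cj l) (cj l) = 0 by rewrite dot_conj ll rmorph0.
have cc2 : dotC (cj m) (cj m) = 0 by rewrite dot_conj mm rmorph0.
have cc3 : dotC (cj l) (cj m) = 0 by rewrite dot_conj lm rmorph0.
have two : (2 : C) != 0 by rewrite pnatr_eq0.
have A1 : dotC (crossO m (cj m)) (crossO m (cj m)) = - nrm m ^+ 2.
  have := dot_cross4 m (cj m) m (cj m); rewrite mm n2 n2' cc2 => h.
  by apply: (mulIf two); rewrite mulrC mulr_natl mulr2n h; ring.
have A2 : dotC (crossO l (cj l)) (crossO l (cj l)) = - nrm l ^+ 2.
  have := dot_cross4 l (cj l) l (cj l); rewrite ll n1 n1' cc1 => h.
  by apply: (mulIf two); rewrite mulrC mulr_natl mulr2n h; ring.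
have B1 : dotC (crossO l (cj m)) (crossO (cj l) m) = 2 * nrm l * nrm m.
  have := dot_cross4 l (cj m) (cj l) m.
  rewrite cx n1 n2' lcm [dotC (cj l) m]dotCC mcl lm [dotC (cj m) _]dotCC cc3.
  by rewrite dot0l addr0 => ->; ring.
have B2 : dotC (crossO l (cj l)) (crossO m (cj m)) = nrm l * nrm m.
  have := dot_cross4 l (cj l) m (cj m).
  rewrite [crossO m (cj l)]crossC dotNr B1 lm cc3 n1 n2 lcm [dotC (cj l) m]dotCC mcl.
  by move/eqP; rewrite subr_eq => /eqP ->; ring.
have vv : dotC v v = 0.
  rewrite /v !(dotDl, dotZl, dotDr, dotZr) A1 A2 [dotC (crossO m _) _]dotCC B2; ring.
by apply/eqP; rewrite -nrm_eq0 /nrm cvv dotNr vv oppr0.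
Qed.

(** With k = m + b conj l, the middle component of l relative to k is
    proportional to |m|^2 l - b |l|^2 conj m, and its product with k reduces to
    a multiple of the vector shown to vanish for null pairs. *)
Lemma adm_sym l k : adm l k -> adm k l.
Proof.
move=> lk; have [ln kn lk0 m0 cx] := lk; have [_ mn lm lcm _] := adm_null_pair lk.
have X := cross_conj_pair (adm_null_pair lk).
set m := perp_part l k in m0 cx mn lm lcm X.
set b := dotC k l / nrm l.
have kE : k = m + b *: cj l by rewrite /m /perp_part subrK.
have [[l0 ll] [k0 kk]] := (ln, kn).
have nl0 : nrm l != 0 by rewrite nrm_eq0.
have kl : dotC k l = b * nrm l by rewrite /b divfK.
clearbody m b.
have nm0 : nrm m != 0 by rewrite nrm_eq0.
have nk0 : nrm k != 0 by rewrite nrm_eq0.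
have ckE : cj k = cj m + b^* *: l by rewrite {1}kE cjD cjZ cjK.
have nk : nrm k = nrm m + b * b^* * nrm l.
  have clcm : dotC (cj l) (cj m) = 0 by rewrite dot_conj lm rmorph0.
  rewrite /nrm ckE {1}kE !(dotDl, dotZl, dotDr, dotZr).
  by rewrite [dotC (cj l) l]dotCC [dotC m l]dotCC lm clcm; ring.
have NE : nrm k *: perp_part k l = nrm m *: l - (b * nrm l) *: cj m.
  rewrite /perp_part dotCC kl scalerBr scalerA mulrCA divff// mulr1 ckE nk.
  by apply/colP => i; rewrite !mxE; ring.
split=> //.
- by rewrite -[k]cjK dot_conj dotCC lk0 rmorph0.
- apply/eqP => N0; have := congr1 (fun u => dotC u (cj l)) NE.
  rewrite N0 scaler0 dotDl dotNl !dotZl dot_conj [dotC m l]dotCC lm rmorph0 mulr0 subr0.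
  by rewrite dot0l; move/esym/eqP; rewrite mulf_eq0 (negbTE nm0) -/(nrm l) (negbTE nl0).
- suff : nrm k *: crossO k (perp_part k l) = 0.
    by move/eqP; rewrite scaler_eq0 (negbTE nk0) => /eqP.
  have clm : crossO (cj l) (cj m) = 0 by rewrite crossO_cj cx cj0.
  rewrite -crossZr NE {1}kE !(crossDl, crossDr, crossZl, crossZr, crossNr) clm.
  rewrite [crossO m l]crossC cx [crossO (cj l) l]crossC.
  transitivity (- b *: (nrm l *: crossO m (cj m) + nrm m *: crossO l (cj l))); last by rewrite X scaler0.
  by apply/colP => i; rewrite !mxE; ring.
Qed.

End Admissible.

(** * The product of the simple factors of an admissible pair *)

Section PairLoop.
Context {C : numClosedFieldType}.
Implicit Types (k l m u v : 'cV[C]_7) (s t : C).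

Section Rho.
Variables (l m : 'cV[C]_7).
Hypothesis lm : null_pair l m.

Let e : 'M[C]_(7, 2) := \matrix_(i, j) (if j == 0 then cj l i 0 else m i 0).
Let f : 'M[C]_(7, 2) := \matrix_(i, j) (if j == 0 then l i 0 / nrm l else cj m i 0 / nrm m).

Let nl0 : nrm l != 0. Proof. by rewrite nrm_eq0; case: lm => -[]. Qed.
Let nm0 : nrm m != 0. Proof. by rewrite nrm_eq0; case: lm => _ []. Qed.

Let bil p q (A : 'M[C]_(7, p)) (B : 'M[C]_(7, q)) i j :
  (A^T *m B) i j = dotC (col i A) (col j B).
Proof. by rewrite mxE dotE_sum; apply: eq_bigr => x _; rewrite !mxE. Qed.

Let e0 : col 0 e = cj l. Proof. by apply/colP => i; rewrite !mxE. Qed.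
Let e1 : col 1 e = m. Proof. by apply/colP => i; rewrite !mxE. Qed.
Let f0 : col 0 f = (nrm l)^-1 *: l. Proof. by apply/colP => i; rewrite !mxE /= mulrC. Qed.
Let f1 : col 1 f = (nrm m)^-1 *: cj m. Proof. by apply/colP => i; rewrite !mxE /= mulrC. Qed.

Let ee : e^T *m e = 0.
Proof.
case: lm => -[_ ll] [_ mm] lm0 lcm _.
have mcl : dotC m (cj l) = 0 by rewrite -[m]cjK dot_conj dotCC lcm rmorph0.
apply: eq_M2; rewrite bil ?e0 ?e1 mxE ?dot_conj ?ll ?mm ?rmorph0//.
by rewrite dotCC.
Qed.

Let ff : f^T *m f = 0.
Proof.
case: lm => -[_ ll] [_ mm] lm0 lcm _.
apply: eq_M2; rewrite bil ?f0 ?f1 mxE dotZl dotZr ?dot_conj ?ll ?mm ?rmorph0 ?lcm ?mulr0//.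
by rewrite dotCC lcm !mulr0.
Qed.

Let ef : e^T *m f = 1%:M.
Proof.
case: lm => -[_ ll] [_ mm] lm0 lcm _.
apply: eq_M2; rewrite bil ?e0 ?e1 ?f0 ?f1 mxE dotZr.
- by rewrite dotCC mulVf.
- by rewrite dot_conj lm0 rmorph0 mulr0.
- by rewrite dotCC lm0 mulr0.
- by rewrite mulVf.
Qed.

Let rhoE (A B : 'M[C]_2) i j : rho e f A B i j = (i == j)%:R +
  (e i 0 * (A 0 0 - 1) * f j 0 + e i 0 * A 0 1 * f j 1
   + e i 1 * A 1 0 * f j 0 + e i 1 * (A 1 1 - 1) * f j 1) +
  (f i 0 * (B 0 0 - 1) * e j 0 + f i 0 * B 1 0 * e j 1
   + f i 1 * B 0 1 * e j 0 + f i 1 * (B 1 1 - 1) * e j 1).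
Proof.
rewrite /rho; move: e f => e' f'; rewrite !mxE !big_ord_recl !big_ord0 !mxE !big_ord_recl !big_ord0 !mxE /=.
have -> : lift ord0 ord0 = 1 :> 'I_2 by exact: val_inj.
have -> : ord0 = 0 :> 'I_2 by [].
by rewrite !mulr1n !mulr0n; ring.
Qed.

(** By generation of SL_2 it is enough to treat unipotent matrices, which give
    the transvections of the planes <conj m, conj l> and <l, m>. *)
Lemma rho_SL2 a b c d : a * d - b * c = 1 ->
  autO (rho e f (M2 a b c d) (M2 d (- b) (- c) a)).
Proof.
case: lm => -[_ ll] [_ mm] lm0 lcm cx.
move: a b c d; apply: SL2_ind.
- move=> a b c d a' b' c' d' h h'; have := autO_mul h h'; rewrite rhoM// !M2M.
  congr (autO (rho e f _ _)); congr M2; ring.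
- move=> s; rewrite oppr0.
  suff -> : rho e f (M2 1 s 0 1) (M2 1 (- s) 0 1) = transv (s / nrm m) (cj m) (cj l).
    apply: transv_autO; rewrite ?dot_conj ?ll ?mm ?rmorph0//; first by rewrite dotCC lm0 rmorph0.
    by rewrite crossO_cj crossC cx oppr0 cj0.
  apply/matrixP => i j; rewrite rhoE /transv !mxE !big_ord1 !mxE /=; ring.
- move=> s; rewrite oppr0.
  suff -> : rho e f (M2 1 0 s 1) (M2 1 0 (- s) 1) = transv (s / nrm l) l m.
    exact: transv_autO.
  apply/matrixP => i j; rewrite rhoE /transv !mxE !big_ord1 !mxE /=; ring.
Qed.

(** On the plane <conj l, m> the factors act with determinants t and t^-1, the
    second one in a basis where it is not diagonal; their product is in the copy
    of SL_2. *)
Lemma pair_autO t b : t != 0 -> b *: cj l + m != 0 ->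
  autO (pmx t l *m pmx t (b *: cj l + m)).
Proof.
move=> t0 k0; set k := _ + _ in k0 *.
have nk0 : nrm k != 0 by rewrite nrm_eq0.
case: lm => -[_ ll] [_ mm] lm0 lcm cx.
have ckE : cj k = b^* *: l + cj m by rewrite /k cjD cjZ cjK.
have nk : nrm k = b * b^* * nrm l + nrm m.
  rewrite /nrm ckE /k !(dotDl, dotDr, dotZl, dotZr) dot_conj lm0 rmorph0 [dotC m l]dotCC lm0.
  by rewrite [dotC (cj l) l]dotCC; ring.
have plE : pmx t l = rho e f (M2 t 0 0 1) (M2 t^-1 0 0 1).
  apply/matrixP => i j; rewrite rhoE /pmx /projl !mxE !big_ord1 !mxE /=; ring.
(* The entries of the projection onto k, on the plane <conj l, m>. *)
pose p := b * b^* * nrm l / nrm k; pose q := b * nrm m / nrm k.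
pose r := b^* * nrm l / nrm k; pose s := nrm m / nrm k.
have pkE : pmx t k = rho e f (M2 (1 + (t^-1 - 1) * p) ((t^-1 - 1) * q) ((t^-1 - 1) * r) (1 + (t^-1 - 1) * s))
     (M2 (1 + (t - 1) * p) ((t - 1) * q) ((t - 1) * r) (1 + (t - 1) * s)).
  apply/matrixP => i j; rewrite rhoE /pmx /projl !mxE !big_ord1 ckE /k !mxE /= /p /q /r /s.
  field. by rewrite t0 nk0 nm0 nl0.
have ps : p + s = 1 by rewrite /p /s -mulrDl -nk divff.
rewrite plE pkE rhoM// !M2M.
set A := M2 _ _ _ _; set B := M2 _ _ _ _.
have -> : B = M2 (1 + (t^-1 - 1) * s) (- (t * ((t^-1 - 1) * q))) (- ((t^-1 - 1) * r)) (t * (1 + (t^-1 - 1) * p)).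
  have sE : s = 1 - p by rewrite -ps addrC addKr.
  by rewrite /B sE; congr M2; field.
have -> : A = M2 (t * (1 + (t^-1 - 1) * p)) (t * ((t^-1 - 1) * q)) ((t^-1 - 1) * r) (1 + (t^-1 - 1) * s).
  by rewrite /A; congr M2; ring.
apply: rho_SL2.
have pq : p * s = q * r by rewrite /p /q /r /s; field.
have -> : t * (1 + (t^-1 - 1) * p) * (1 + (t^-1 - 1) * s) - t * ((t^-1 - 1) * q) * ((t^-1 - 1) * r)
  = t * (1 + (t^-1 - 1) * (p + s)) + t * (t^-1 - 1) ^+ 2 * (p * s - q * r) by ring.
by rewrite ps pq subrr mulr0 addr0; field.
Qed.

End Rho.

Lemma adm_autO l k t : adm l k -> t != 0 -> autO (pmx t l *m pmx t k).
Proof.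
move=> lk t0; have [_ [k0 _] _ _ _] := lk.
have kE : k = (dotC k l / nrm l) *: cj l + perp_part l k by rewrite addrC subrK.
rewrite kE; apply: pair_autO => //; last by rewrite -kE.
exact: adm_null_pair.
Qed.

End PairLoop.

(** * Algebra of the dressing *)

Section Dressing.
Context {C : numClosedFieldType}.
Implicit Types (k l m u v : 'cV[C]_7) (s t : C) (e H W : 'M[C]_7).

(** Projection onto the orthogonal of k and conj k along their span. *)
Definition projm k : 'M[C]_7 := 1%:M - projl k - (projl k)^T.

Lemma pmx_projm t k : pmx t k = t *: (projl k)^T + projm k + t^-1 *: projl k.
Proof.
rewrite /pmx /projm; move: (projl k) => E; apply/matrixP => i j; rewrite !mxE; ring.
Qed.

Lemma pmx_inv t k : pmx t^-1 k = t *: projl k + projm k + t^-1 *: (projl k)^T.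
Proof.
rewrite pmx_projm invrK; move: (projl k) (projm k) => E M.
by apply/matrixP => i j; rewrite !mxE; ring.
Qed.

Lemma projmE k u : projm k *m u = u - (dotC (cj k) u / nrm k) *: k - (dotC k u / nrm k) *: cj k.
Proof.
rewrite /projm !mulmxBl mul1mx projl_tr [projl (cj k) *m u]projlE [projl k *m u]projlE.
by rewrite cjK nrm_conj.
Qed.

Lemma projm_tr k : (projm k)^T = projm k.
Proof.
rewrite /projm; move: (projl k) => E; apply/matrixP => i j; rewrite !mxE (eq_sym j); ring.
Qed.

Lemma projm_self k : null k -> projm k *m k = 0.
Proof.
move=> [k0 kk]; rewrite projmE kk mul0r scale0r subr0 dotCC divff ?scale1r ?subrr//.
by rewrite nrm_eq0.
Qed.

(** The dressed matrix with its apparent pole at d = 0 removed; here c and d are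
    the values of z - conj alpha and z - alpha, and W is the divided difference
    of e. *)
Definition dress (c d : C) k e W k' : 'M[C]_7 :=
  (- (c ^+ 2 / 2) * dotC (W *m k') (W *m k') / (nrm k * nrm k')) *: (cj k *m (cj k')^T)
  + c *: ((projl k)^T *m W *m projm k' + projm k *m W *m projl k')
  + ((projl k)^T *m e *m (projl k')^T + projm k *m e *m projm k' + projl k *m e *m projl k')
  + (d / c) *: (projm k *m e *m (projl k')^T + projl k *m e *m projm k')
  + (d / c) ^+ 2 *: (projl k *m e *m (projl k')^T).

Lemma orth_null H k : H^T *m H = 1%:M -> null k -> null (H^T *m k).
Proof.
move=> HH [k0 kk]; have HH' := mulmx1C HH; split.
  by apply: contra_neq k0 => h; rewrite -[k]mul1mx -HH' -mulmxA h mulmx0.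
by have /orthP -> : (H^T)^T *m H^T = 1%:M by rewrite trmxK.
Qed.

(** Negative powers of d come from <k, e k'>, with d^-2, and from the two
    products with d^-1; orthogonality of e and the nullity of k and k' make the
    first divisible by d^2, and H k' = k makes the others divisible by d. *)
Lemma dressE (c d : C) k H W : c != 0 -> d != 0 -> null k -> H^T *m H = 1%:M ->
  (H + d *: W)^T *m (H + d *: W) = 1%:M ->
  let k' := H^T *m k in
  pmx (c / d) k *m (H + d *: W) *m pmx (c / d)^-1 k' = dress c d k (H + d *: W) W k'.
Proof.
move=> c0 d0 kn HH ee k'; have [k'0 k'k'] : null k' := orth_null HH kn.
have [k0 kk] := kn; have HH' := mulmx1C HH.
have Hk' : H *m k' = k by rewrite /k' mulmxA HH' mul1mx.
have kH : k^T *m H = k'^T by rewrite /k' trmx_mul trmxK.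
clearbody k'.
set e := H + d *: W in ee *; set w := W *m k'.
have ek' : e *m k' = k + d *: w by rewrite /e mulmxDl Hk' -scalemxAl.
(* Expand <e k', e k'> = <k', k'> = 0 with e k' = k + d w. *)
have kw : dotC k (e *m k') = - d ^+ 2 / 2 * dotC w w.
  have := (orthP e).1 ee k' k'; rewrite k'k' ek' !(dotDl, dotDr, dotZl, dotZr) kk [dotC w k]dotCC add0r.
  move=> h; have two : (2 : C) != 0 by rewrite pnatr_eq0.
  apply: (mulIf two); rewrite -[LHS]subr0 -h; by field.
have Mk := projm_self kn; have Mk' : projm k' *m k' = 0 by apply: projm_self.
have P (X Y Z : 'M[C]_7) a b : a *: X *m Y *m (b *: Z) = (a * b) *: (X *m Y *m Z).
  by rewrite -!scalemxAl -scalemxAr scalerA.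
have P1 (X Y Z : 'M[C]_7) a : a *: X *m Y *m Z = a *: (X *m Y *m Z).
  by rewrite -!scalemxAl.
have P2 (X Y Z : 'M[C]_7) a : X *m Y *m (a *: Z) = a *: (X *m Y *m Z).
  by rewrite -scalemxAr.
have ETE : (projl k)^T = (nrm k)^-1 *: (cj k *m k^T) by rewrite projl_tr /projl cjK nrm_conj.
have t2 : (projl k)^T *m e *m projl k' = (- d ^+ 2 / 2 * dotC w w / (nrm k * nrm k')) *: (cj k *m (cj k')^T).
  rewrite ETE [projl k']/projl P !mulmxA -(mulmxA (cj k)) -(mulmxA (cj k)) -(mulmxA k^T).
  rewrite dot_tr kw mul_mx_scalar -scalemxAl scalerA.
  by rewrite invfM mulrC.
have lin (X Y : 'M[C]_7) : X *m H *m Y = 0 -> X *m e *m Y = d *: (X *m W *m Y).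
  by move=> z; rewrite /e mulmxDr mulmxDl z add0r -scalemxAr -scalemxAl.
have t1 : (projl k)^T *m e *m projm k' = d *: ((projl k)^T *m W *m projm k').
  have z : (projl k)^T *m H *m projm k' = 0.
    rewrite ETE P1 -[cj k *m k^T *m H]mulmxA kH -mulmxA.
    by rewrite -[X in k'^T *m X]projm_tr -trmx_mul Mk' trmx0 mulmx0 scaler0.
  exact: lin z.
have t1' : projm k *m e *m projl k' = d *: (projm k *m W *m projl k').
  have z : projm k *m H *m projl k' = 0.
    by rewrite /projl -scalemxAr mulmxA -[projm k *m H *m k']mulmxA Hk' Mk mul0mx scaler0.
  exact: lin z.
rewrite pmx_inv pmx_projm /dress -/w.
have nn0 : nrm k * nrm k' != 0 by rewrite mulf_neq0 ?nrm_eq0.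
move: t2 t1 t1'; clearbody e w; move: (cj k *m _) => kk' t2 t1 t1'.
move: (projl k) (projm k) (projl k') (projm k') t2 t1 t1' => E M E' M' t2 t1 t1'.
rewrite !mulmxDl !mulmxDr !P !P1 !P2 t2 t1 t1'.
move: (E^T *m e *m E'^T) (M *m e *m M') (E *m e *m E') => X1 X2 X3.
move: (M *m e *m E'^T) (E *m e *m M') (E *m e *m E'^T) => X4 X5 X6.
move: (E^T *m W *m M') (M *m W *m E') (dotC w w) (nrm k * nrm k') nn0 => X7 X8 ww nn nn0.
apply/matrixP => i j; rewrite !mxE; field.
by rewrite c0 d0 nn0.
Qed.

Lemma pmx_conj_SO t k k' e : null k -> null k' -> t != 0 -> e^T *m e = 1%:M -> \det e = 1 ->
  let S := pmx t k *m e *m pmx t^-1 k' in S^T *m S = 1%:M /\ \det S = 1.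
Proof.
move=> kn k'n t0 ee de S; have ti0 : t^-1 != 0 by rewrite invr_eq0.
split; last by rewrite !det_mulmx !pmx_det// de !mulr1.
rewrite /S !trmx_mul !mulmxA -[_ *m (pmx t k)^T *m _]mulmxA pmx_orth// mulmx1.
by rewrite -[_ *m e^T *m _]mulmxA ee mulmx1 pmx_orth.
Qed.

(** The polynomial tau p_l p_k in tau = t^-1; its value at 0 is the residue of
    the pair loop up to a scalar. The coefficient of tau^-1 vanishes as l is
    orthogonal to conj k. *)
Definition pair_poly (tau : C) l k : 'M[C]_7 :=
  ((projl l)^T *m projm k + projm l *m (projl k)^T)
  + tau *: ((projl l)^T *m projl k + projm l *m projm k + projl l *m (projl k)^T)
  + tau ^+ 2 *: (projm l *m projl k + projl l *m projm k) + tau ^+ 3 *: (projl l *m projl k).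

Lemma pair_polyE tau l k : dotC l (cj k) = 0 -> tau != 0 ->
  pair_poly tau l k = tau *: (pmx tau^-1 l *m pmx tau^-1 k).
Proof.
move=> lk t0; have z : (projl l)^T *m (projl k)^T = 0.
  rewrite !projl_tr {2}/projl -scalemxAr mulmxA projlE cjK lk mul0r scale0r mul0mx scaler0 //.
rewrite !pmx_projm /pair_poly invrK.
move: (projl l) (projm l) (projl k) (projm k) z => E M E' M' z.
have P (X Y : 'M[C]_7) a b : a *: X *m (b *: Y) = (a * b) *: (X *m Y).
  by rewrite -!scalemxAl -scalemxAr scalerA.
have P1 (X Y : 'M[C]_7) a : a *: X *m Y = a *: (X *m Y) by rewrite -!scalemxAl.
have P2 (X Y : 'M[C]_7) a : X *m (a *: Y) = a *: (X *m Y) by rewrite -!scalemxAr.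
rewrite !mulmxDl !mulmxDr !P !P1 !P2 z.
move: (E^T *m M') (M *m E'^T) (E^T *m E') (M *m M') (E *m E'^T) => X1 X2 X3 X4 X5.
move: (M *m E') (E *m M') (E *m E') => X6 X7 X8.
by apply/matrixP => i j; rewrite !mxE; field.
Qed.

Lemma pair_poly0E l k : pair_poly 0 l k = (projl l)^T *m projm k + projm l *m (projl k)^T.
Proof. by rewrite /pair_poly !expr0n /= !scale0r !addr0. Qed.

(** The residue maps conj k to the conjugate of the middle component of k. *)
Lemma pair_poly0_neq0 l k : adm l k -> pair_poly 0 l k != 0.
Proof.
move=> lk; have [[l0 ll] [k0 kk] lck m0 _] := lk.
have nk0 : nrm k != 0 by rewrite nrm_eq0.
have ckk : dotC (cj k) (cj k) = 0 by rewrite dot_conj kk rmorph0.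
apply: contra_neq m0 => Q0.
have : pair_poly 0 l k *m cj k = cj (perp_part l k).
  rewrite pair_poly0E mulmxDl -!mulmxA projl_tr [(projl k)^T]projl_tr [projl (cj k) *m _]projlE cjK nrm_conj.
  rewrite [projm k *m _]projmE ckk mul0r scale0r subr0 divff// scale1r subrr mulmx0 add0r.
  rewrite projmE lck mul0r scale0r subr0 /perp_part cjD cjN cjZ cjK.
  by rewrite rmorphM fmorphV /= nrm_real -dot_conj [dotC (cj k) _]dotCC.
by rewrite Q0 mul0mx => /esym /(congr1 cj); rewrite cjK cj0.
Qed.

Lemma projl_scale b k : b != 0 -> projl (b *: k) = projl k.
Proof.
move=> b0; have bc0 : b^* != 0 by rewrite conjC_eq0.
have [->|k0] := eqVneq k 0; first by rewrite scaler0.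
have nk0 : nrm k != 0 by rewrite nrm_eq0.
rewrite /projl /nrm cjZ dotZl dotZr -/(nrm k) linearZ /= -scalemxAl -scalemxAr !scalerA.
by congr (_ *: _); field; rewrite nk0 bc0 b0.
Qed.

(** Evaluating the hypothesis at the middle component m of k and at l gives the
    product of k with the middle component of l, up to a nonzero scalar: this is
    admissibility of (k, l). *)
Lemma adm_of_residue l k : null l -> null k -> dotC l (cj k) = 0 -> pair_poly 0 l k != 0 ->
  (forall x y, crossO ((pair_poly 0 l k)^T *m x) ((pair_poly 0 l k)^T *m y) = 0) -> adm l k.
Proof.
move=> ln kn lck Q0 Qx; have [[l0 ll] [k0 kk]] := (ln, kn).
have [nl0 nk0] : nrm l != 0 /\ nrm k != 0 by rewrite !nrm_eq0.
have ckl : dotC k (cj l) = 0 by rewrite -[k]cjK dot_conj dotCC lck rmorph0.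
have m0 : perp_part l k != 0.
  apply: contra_neq Q0 => /eqP; rewrite subr_eq0 => /eqP kE.
  have b0 : dotC k l / nrm l != 0 by apply: contra_neq k0 => b0; rewrite kE b0 scale0r.
  have Ek : projl k = (projl l)^T by rewrite kE projl_scale// projl_tr.
  have Mk : projm k = projm l by rewrite /projm Ek trmxK addrAC.
  have z : projm l *m projl l = 0 by rewrite /projl -scalemxAr mulmxA projm_self// mul0mx scaler0.
  by rewrite pair_poly0E Ek Mk trmxK z addr0 -[X in _ *m X]projm_tr -trmx_mul z trmx0.
apply: adm_sym; set m := perp_part l k in m0.
have NE : perp_part k l = projm k *m l.
  by rewrite projmE [dotC (cj k) l]dotCC lck mul0r scale0r subr0 /perp_part [dotC l k]dotCC.
have QT : (pair_poly 0 l k)^T = projm k *m projl l + projl k *m projm l.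
  by rewrite pair_poly0E linearD /= !trmx_mul !trmxK !projm_tr.
have ml : dotC m l = 0.
  by rewrite /m /perp_part dotDl dotNl dotZl [dotC (cj l) l]dotCC divfK// subrr.
have mcl : dotC m (cj l) = 0.
  by rewrite /m /perp_part dotDl dotNl dotZl dot_conj ll rmorph0 ckl mulr0 subr0.
have mck : dotC m (cj k) = nrm m.
  rewrite /nrm {2}/m /perp_part cjD cjN cjZ cjK dotDr dotNr.
  by rewrite dotZr ml mulr0 subr0.
split=> //.
- rewrite NE; apply: contra_neq m0 => N0; move: N0; rewrite -NE => /eqP.
  rewrite subr_eq0 => /eqP lE; set c := _ / _ in lE.
  have c0 : c != 0 by apply: contra_neq l0 => c0; rewrite lE c0 scale0r.
  have cc0 : c^* != 0 by rewrite conjC_eq0.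
  have nlE : nrm l = c * c^* * nrm k.
    by rewrite /nrm lE cjZ cjK dotZl dotZr [dotC (cj k) k]dotCC mulrA.
  have klE : dotC k l = c * nrm k by rewrite lE dotZr.
  rewrite /m /perp_part klE nlE lE cjZ cjK scalerA.
  have -> : c * nrm k / (c * c^* * nrm k) * c^* = 1 by field; rewrite nk0 c0 cc0.
  by rewrite scale1r subrr.
- have QTE u : (pair_poly 0 l k)^T *m u = projm k *m (projl l *m u) + projl k *m (projm l *m u).
    by rewrite QT mulmxDl -!mulmxA.
  have := Qx m l; rewrite !QTE.
  rewrite [projl l *m m]projlE [dotC (cj l) m]dotCC mcl mul0r scale0r mulmx0 add0r.
  rewrite [projm l *m m]projmE [dotC (cj l) m]dotCC mcl [dotC l m]dotCC ml !mul0r !scale0r !subr0.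
  rewrite [projl k *m m]projlE [dotC (cj k) m]dotCC mck [projm l *m l]projm_self// mulmx0 addr0.
  rewrite [projl l *m l]projlE [dotC (cj l) l]dotCC divff// scale1r -NE crossZl => /eqP.
  by rewrite scaler_eq0 mulf_eq0 invr_eq0 nrm_eq0 (negbTE m0) (negbTE nk0) => /eqP.
Qed.

End Dressing.

(** * Algebra of the dressing of a pair *)

Section DressedPair.
Context {C : numClosedFieldType}.
Implicit Types (k l m u v x y : 'cV[C]_7) (s t tau : C) (e H S : 'M[C]_7).

(** The polynomial tau p_k in tau = t^-1. *)
Definition line_poly tau k : 'M[C]_7 := (projl k)^T + tau *: projm k + tau ^+ 2 *: projl k.

Lemma line_polyE tau k : tau != 0 -> line_poly tau k = tau *: pmx tau^-1 k.
Proof.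
move=> t0; rewrite /line_poly pmx_projm invrK; move: (projl k) (projm k) => E M.
by apply/matrixP => i j; rewrite !mxE; field.
Qed.

Lemma line_poly0 k : line_poly 0 k = (projl k)^T.
Proof. by rewrite /line_poly expr0n /= !scale0r !addr0. Qed.

Lemma pmx_cj t k : null k -> pmx t k *m cj k = t *: cj k.
Proof.
move=> [k0 kk]; have ckk : dotC (cj k) (cj k) = 0 by rewrite dot_conj kk rmorph0.
rewrite pmxE ckk mul0r mulr0 scale0r addr0 divff ?nrm_eq0// mulr1 scalerBl scale1r.
by rewrite addrC subrK.
Qed.

Lemma dressed_tr_cj tau k k' e S : tau != 0 -> null k ->
  S = pmx tau^-1 k *m e *m pmx (tau^-1)^-1 k' ->
  S^T *m cj k = line_poly tau k' *m (e^T *m cj k).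
Proof.
move=> t0 kn ->; rewrite !trmx_mul !pmx_tr -!mulmxA !invrK pmx_cj// -!scalemxAr.
by rewrite line_polyE// -scalemxAl.
Qed.

Lemma line_poly0_orth k e : null k -> e^T *m e = 1%:M -> let k' := e^T *m k in
  line_poly 0 k' *m (e^T *m cj k) = (nrm k / nrm k') *: cj k'.
Proof.
move=> kn ee k'; have ee' : (e^T)^T *m e^T = 1%:M by rewrite trmxK (mulmx1C ee).
by rewrite line_poly0 projl_tr projlE cjK nrm_conj /k' ((orthP _).1 ee').
Qed.

Lemma dressed_perp l k S k' : null k -> k' != 0 -> S^T *m S = 1%:M ->
  S^T *m cj k = (nrm k / nrm k') *: cj k' -> dotC l (cj k) = 0 ->
  dotC (S^T *m l) (cj k') = 0.
Proof.
move=> [k0 _] k'0 SS h lk; have SS' : (S^T)^T *m S^T = 1%:M by rewrite trmxK (mulmx1C SS).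
have /eqP := (orthP _).1 SS' l (cj k); rewrite lk h dotZr mulf_eq0 mulf_eq0 invr_eq0 !nrm_eq0.
by rewrite (negbTE k0) (negbTE k'0) => /eqP.
Qed.

Lemma dressed_pair_id (pl pk pl' pk' e ht : 'M[C]_7) : pl^T *m pl = 1%:M ->
  pk^T *m pk = 1%:M -> e^T *m e = 1%:M ->
  ht = pl *m (pk *m e *m pk'^T) *m pl'^T -> ht^T *m (pl *m pk) *m e = pl' *m pk'.
Proof.
move=> hl hk he ->; rewrite !trmx_mul !trmxK !mulmxA.
rewrite -[_ *m pl^T *m pl]mulmxA hl mulmx1 -[_ *m pk^T *m pk]mulmxA hk mulmx1.
by rewrite -[_ *m e^T *m e]mulmxA he mulmx1.
Qed.

Lemma dressed_pairE t l k l' k' e S ht : S = pmx t k *m e *m pmx t^-1 k' ->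
  ht = pmx t l *m S *m pmx t^-1 l' ->
  ht = pmx t l *m pmx t k *m e *m (pmx t l' *m pmx t k')^T.
Proof. by move=> -> ->; rewrite trmx_mul !pmx_tr !mulmxA. Qed.

Lemma dressed_pair_inv t l k l' k' e S ht : null l -> null k -> t != 0 ->
  e^T *m e = 1%:M -> S = pmx t k *m e *m pmx t^-1 k' ->
  ht = pmx t l *m S *m pmx t^-1 l' ->
  ht^T *m (pmx t l *m pmx t k) *m e = pmx t l' *m pmx t k'.
Proof.
move=> ln kn t0 ee SE htE; apply: dressed_pair_id => //; try exact: pmx_orth.
by rewrite htE SE !pmx_tr.
Qed.

Lemma pair_poly_dressed tau l k l' k' e ht : tau != 0 -> dotC l (cj k) = 0 ->
  dotC l' (cj k') = 0 ->
  ht^T *m (pmx tau^-1 l *m pmx tau^-1 k) *m e = pmx tau^-1 l' *m pmx tau^-1 k' ->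
  ht^T *m pair_poly tau l k *m e = pair_poly tau l' k'.
Proof.
by move=> t0 lk lk' h; rewrite (pair_polyE lk t0) (pair_polyE lk' t0) -h -scalemxAr -scalemxAl.
Qed.

Lemma autO_cross_tr tau e P Q u v : autO e -> autO P -> Q = tau *: P ->
  crossO (e^T *m (Q^T *m u)) (e^T *m (Q^T *m v)) = tau *: (e^T *m (Q^T *m crossO u v)).
Proof.
move=> /autO_tr[_ ex] /autO_tr[_ Px] ->; rewrite ex linearZ /= -!scalemxAl.
by rewrite crossZl crossZr Px -!scalemxAr.
Qed.

(** The matrix tau^-1 times the residue polynomial is in G_2, so its transpose,
    together with e, can be pulled out of the cross product; each factor on the
    left carries a tau and only one is used up on the right. *)
Lemma dressed_cross tau l k ht e Q' x y : adm l k -> tau != 0 -> autO e ->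
  ht^T *m pair_poly tau l k *m e = Q' ->
  crossO (Q'^T *m x) (Q'^T *m y) =
  tau *: (e^T *m ((pair_poly tau l k)^T *m crossO (ht *m x) (ht *m y))).
Proof.
move=> lk t0 ee <-; have tt0 : tau^-1 != 0 by rewrite invr_eq0.
rewrite !trmx_mul trmxK -!mulmxA.
exact: (autO_cross_tr _ _ ee (adm_autO lk tt0) (pair_polyE (adm_perp lk) t0)).
Qed.

(** The dressed matrix is a product of elements of G_2, although its single
    factors are only in SO(7). *)
Lemma autO_dressed t l k l' k' e ht : adm l k -> adm l' k' -> t != 0 -> autO e ->
  ht = pmx t l *m pmx t k *m e *m (pmx t l' *m pmx t k')^T -> autO ht.
Proof.
move=> lk lk' t0 ee ->; apply: autO_mul; last exact: autO_tr (adm_autO lk' t0).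
by apply: autO_mul ee; exact: adm_autO.
Qed.

Lemma orth_neq0 (H e Q : 'M[C]_7) : H^T *m H = 1%:M -> e^T *m e = 1%:M -> Q != 0 ->
  H^T *m Q *m e != 0.
Proof.
move=> HH ee; apply: contra_neq => h.
have : H *m (H^T *m Q *m e) *m e^T = Q.
  by rewrite !mulmxA (mulmx1C HH) mul1mx -mulmxA (mulmx1C ee) mulmx1.
by rewrite h mulmx0 mul0mx.
Qed.

End DressedPair.

(** * Holomorphic matrices near the pole *)

Section MatrixDerivative.
Context {R : realType}.
Local Notation C := (Cplx R).
Implicit Types (z : C).

(** Holomorphy of a matrix at a point, entry by entry; the dimensions are
    arbitrary so that it also covers vectors. *)
Definition mder m n (F : C -> 'M[C]_(m, n)) (z : C) :=
  forall i j, derivable (fun x => F x i j) z 1.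

Lemma der_ext (f g : C -> C) (z : C) : f =1 g -> derivable f z 1 -> derivable g z 1.
Proof. by move=> /funext ->. Qed.

Lemma der_sum (I : Type) (s : seq I) (f : I -> C -> C) (z : C) :
  (forall i, derivable (f i) z 1) -> derivable (fun x => \sum_(i <- s) f i x) z 1.
Proof.
move=> fd; elim: s => [|a s IH].
  by apply: (der_ext (f := fun=> 0)) => [x|]; [rewrite big_nil|exact: der_cst].
apply: (der_ext (f := fun x => f a x + \sum_(i <- s) f i x)) => [x|]; first by rewrite big_cons.
exact: (@derD _ (f a) (fun x => \sum_(i <- s) f i x) z (fd a) IH).
Qed.

Lemma der_prod (I : Type) (s : seq I) (f : I -> C -> C) (z : C) :
  (forall i, derivable (f i) z 1) -> derivable (fun x => \prod_(i <- s) f i x) z 1.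
Proof.
move=> fd; elim: s => [|a s IH].
  by apply: (der_ext (f := fun=> 1)) => [x|]; [rewrite big_nil|exact: der_cst].
apply: (der_ext (f := fun x => f a x * \prod_(i <- s) f i x)) => [x|]; first by rewrite big_cons.
exact: (@derM _ (f a) (fun x => \prod_(i <- s) f i x) z (fd a) IH).
Qed.

Lemma mder_cst m n (A : 'M[C]_(m, n)) z : mder (fun=> A) z.
Proof. by move=> i j; exact: der_cst. Qed.

Lemma mderD m n (F G : C -> 'M[C]_(m, n)) z : mder F z -> mder G z ->
  mder (fun x => F x + G x) z.
Proof.
move=> Fz Gz i j; apply: (der_ext (f := fun x => F x i j + G x i j)) => [x|].
  by rewrite mxE.
exact: (@derD _ (fun x => F x i j) (fun x => G x i j) z (Fz i j) (Gz i j)).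
Qed.

Lemma mderZ m n (c : C -> C) (F : C -> 'M[C]_(m, n)) z : derivable c z 1 -> mder F z ->
  mder (fun x => c x *: F x) z.
Proof.
move=> cz Fz i j; apply: (der_ext (f := fun x => c x * F x i j)) => [x|].
  by rewrite mxE.
exact: (@derM _ c (fun x => F x i j) z cz (Fz i j)).
Qed.

Lemma mder_tr m n (F : C -> 'M[C]_(m, n)) z : mder F z -> mder (fun x => (F x)^T) z.
Proof.
move=> Fz i j; apply: (der_ext (f := fun x => F x j i)) => [x|]; first by rewrite mxE.
exact: Fz.
Qed.

Lemma mderM m n p (F : C -> 'M[C]_(m, n)) (G : C -> 'M[C]_(n, p)) z :
  mder F z -> mder G z -> mder (fun x => F x *m G x) z.
Proof.
move=> Fz Gz i j.
apply: (der_ext (f := fun x => \sum_k F x i k * G x k j)) => [x|]; first by rewrite mxE.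
by apply: der_sum => k; exact: (@derM _ (fun x => F x i k) (fun x => G x k j) z (Fz i k) (Gz k j)).
Qed.

Lemma der_det n (F : C -> 'M[C]_n) z : mder F z -> derivable (fun x => \det (F x)) z 1.
Proof.
move=> Fz; apply: der_sum => s.
apply: (@derM _ (fun=> (-1) ^+ s) (fun x => \prod_i F x i (s i)) z (@der_cst _ ((-1) ^+ s) z)).
by apply: der_prod => i; exact: Fz.
Qed.

Lemma der_dot (u v : C -> 'cV[C]_7) z : mder u z -> mder v z ->
  derivable (fun x => dotC (u x) (v x)) z 1.
Proof. by move=> uz vz; exact: (mderM (mder_tr uz) vz). Qed.

Lemma mder_cross (u v : C -> 'cV[C]_7) z : mder u z -> mder v z ->
  mder (fun x => crossO (u x) (v x)) z.
Proof.
move=> uz vz i j.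
apply: (der_ext (f := fun x => \sum_(ab <- [:: (1, 3); (2, 6); (4, 5)] : seq ('I_7 * 'I_7))
    (u x (i + ab.1) 0 * v x (i + ab.2) 0 - u x (i + ab.2) 0 * v x (i + ab.1) 0))) => [x|].
  by rewrite mxE.
apply: der_sum => ab.
apply: (@derB _ (fun x => u x (i + ab.1) 0 * v x (i + ab.2) 0)
                (fun x => u x (i + ab.2) 0 * v x (i + ab.1) 0) z).
  exact: (@derM _ (fun x => u x (i + ab.1) 0) (fun x => v x (i + ab.2) 0) z (uz _ _) (vz _ _)).
exact: (@derM _ (fun x => u x (i + ab.2) 0) (fun x => v x (i + ab.1) 0) z (uz _ _) (vz _ _)).
Qed.

Lemma mder_near m n (F G : C -> 'M[C]_(m, n)) (z : C) : (\forall x \near z, F x = G x) ->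
  mder F z -> mder G z.
Proof.
move=> FG Fz i j; apply: (near_eq_derivable _ (Fz i j)).
by apply: filterS FG => x ->.
Qed.

Definition near_punct (a : C) (P : C -> Prop) := \forall z \near a, z != a -> P z.

Lemma near_punctS (a : C) (P Q : C -> Prop) : (forall z, P z -> Q z) ->
  near_punct a P -> near_punct a Q.
Proof. by rewrite /near_punct => PQ; apply: filterS => z Pz /Pz/PQ. Qed.

Lemma near_punctI (a : C) (P Q : C -> Prop) : near_punct a P -> near_punct a Q ->
  near_punct a (fun z => P z /\ Q z).
Proof. by rewrite /near_punct => nP nQ; apply: filterS2 nP nQ => z Pz Qz za; split; auto. Qed.

Lemma near_punct_near (a : C) (P : C -> Prop) : (\forall z \near a, P z) -> near_punct a P.
Proof. by rewrite /near_punct; apply: filterS => z. Qed.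

Lemma near_punctP (a : C) (P : C -> Prop) : near_punct a P <->
  exists2 r : R, 0 < r & forall w, nm (w - a) < r -> w != a -> P w.
Proof. exact: nbhs_nmP. Qed.

Lemma der_punct_eq (f g : C -> C) (a : C) : derivable f a 1 -> derivable g a 1 ->
  near_punct a (fun z => f z = g z) -> f a = g a.
Proof.
move=> fa ga /near_punctP[r r0 H].
exact: (cont_punct_eq r0 (der_cont fa) (der_cont ga) H).
Qed.

Lemma mder_punct_eq m n (F G : C -> 'M[C]_(m, n)) (a : C) : mder F a -> mder G a ->
  near_punct a (fun z => F z = G z) -> F a = G a.
Proof.
move=> Fa Ga FG; apply/matrixP => i j.
apply: (der_punct_eq (Fa i j) (Ga i j)).
by apply: near_punctS FG => z ->.
Qed.

Lemma orth_punct (F : C -> 'M[C]_7) (a : C) : mder F a ->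
  near_punct a (fun z => (F z)^T *m F z = 1%:M) -> (F a)^T *m F a = 1%:M.
Proof.
move=> Fa H; exact: (mder_punct_eq (mderM (mder_tr Fa) Fa) (@mder_cst _ _ 1%:M a) H).
Qed.

Lemma det_punct (F : C -> 'M[C]_7) (a : C) : mder F a ->
  near_punct a (fun z => \det (F z) = 1) -> \det (F a) = 1.
Proof. move=> Fa H; exact: (der_punct_eq (der_det Fa) (@der_cst _ 1 a) H). Qed.

(** The equations defining G_2 are closed conditions, and a holomorphic matrix
    is continuous. *)
Lemma autO_punct (F : C -> 'M[C]_7) (a : C) : mder F a ->
  near_punct a (fun z => autO (F z)) -> autO (F a).
Proof.
move=> Fa H; split; first by apply: (orth_punct Fa); apply: near_punctS H => z [].
move=> x y.
have Fx (v : 'cV[C]_7) : mder (fun z => F z *m v) a by exact: (mderM Fa (@mder_cst _ _ v a)).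
apply: (mder_punct_eq (mder_cross (Fx x) (Fx y)) (Fx (crossO x y))).
by apply: near_punctS H => z [_].
Qed.

Definition mslope (F : C -> 'M[C]_7) (a z : C) : 'M[C]_7 :=
  \matrix_(i, j) dslope (fun x => F x i j) a z.

Lemma mslopeE F (a z : C) : F z = F a + (z - a) *: mslope F a z.
Proof. by apply/matrixP => i j; rewrite !mxE; exact: (dslopeE (fun x => F x i j)). Qed.

Lemma mslope_der F (a : C) : (\forall z \near a, mder F z) ->
  \forall z \near a, mder (mslope F a) z.
Proof.
move=> Fd; apply: filterS (Fd) => z Fz i j.
apply: (der_ext (f := dslope (fun x => F x i j) a)) => [x|]; first by rewrite mxE.
have [->|za] := eqVneq z a; last exact: (dslope_der_neq za (Fz i j)).
by apply: dslope_derivable; apply: filterS Fd => w; exact.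
Qed.

Lemma der_quo (c d : C -> C) z : derivable c z 1 -> derivable d z 1 -> c z != 0 ->
  derivable (fun x => d x / c x) z 1.
Proof. by move=> cz dz c0; exact: (@derM _ d (fun x => (c x)^-1) z dz (derV c0 cz)). Qed.

Lemma der_sqr (c : C -> C) z : derivable c z 1 -> derivable (fun x => c x ^+ 2) z 1.
Proof. by move=> cz; exact: (@derM _ c c z cz cz). Qed.

Lemma der_Ml (a : C) (c : C -> C) z : derivable c z 1 -> derivable (fun x => a * c x) z 1.
Proof. by move=> cz; exact: (@derM _ (fun=> a) c z (@der_cst _ a z) cz). Qed.

Lemma mder_MM (A B : 'M[C]_7) (F : C -> 'M[C]_7) z : mder F z ->
  mder (fun x => A *m F x *m B) z.
Proof. by move=> Fz; exact: (mderM (mderM (@mder_cst _ _ A z) Fz) (@mder_cst _ _ B z)). Qed.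

Lemma dress_der (c d : C -> C) (k k' : 'cV[C]_7) (e W : C -> 'M[C]_7) z :
  derivable c z 1 -> derivable d z 1 -> c z != 0 -> mder e z -> mder W z ->
  mder (fun x => dress (c x) (d x) k (e x) (W x) k') z.
Proof.
move=> cz dz c0 ez Wz; have dc := der_quo cz dz c0.
have Wk : mder (fun x => W x *m k') z := mderM Wz (@mder_cst _ _ k' z).
have a1 : derivable (fun x => - (c x ^+ 2 / 2) * dotC (W x *m k') (W x *m k') / (nrm k * nrm k')) z 1.
  apply: (der_ext (f := fun x => (- (2^-1) / (nrm k * nrm k')) *
     (c x ^+ 2 * dotC (W x *m k') (W x *m k')))) => [x|].
    by rewrite mulNr mulNr -mulNr; ring.
  apply: der_Ml; exact: (@derM _ (fun x => c x ^+ 2) (fun x => dotC (W x *m k') (W x *m k')) z (der_sqr cz) (der_dot Wk Wk)).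
exact: (mderD (mderD (mderD (mderD (mderZ a1 (@mder_cst _ _ (cj k *m (cj k')^T) z))
  (mderZ cz (mderD (@mder_MM _ _ _ _ Wz) (@mder_MM _ _ _ _ Wz))))
  (mderD (mderD (@mder_MM _ _ _ _ ez) (@mder_MM _ _ _ _ ez)) (@mder_MM _ _ _ _ ez)))
  (mderZ dc (mderD (@mder_MM _ _ _ _ ez) (@mder_MM _ _ _ _ ez))))
  (mderZ (der_sqr dc) (@mder_MM _ _ _ _ ez))).
Qed.

Definition SO_near (a : C) (e : C -> 'M[C]_7) := \forall z \near a,
  [/\ mder e z, (e z)^T *m e z = 1%:M & \det (e z) = 1].

(** The parameter t of the simple factors; its inverse tau vanishes at a. *)
Definition mob (a z : C) : C := (z - a^*) / (z - a).

Lemma mob_near (a : C) : a^* != a -> near_punct a (fun z => z - a^* != 0 /\ z - a != 0).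
Proof.
move=> ca; rewrite /near_punct; apply: filterS (near_neq (a := a^*) (z := a) _) => [z|]; last by rewrite eq_sym.
by move=> zc za; rewrite !subr_eq0.
Qed.

Lemma SO_near_punct (a : C) (e : C -> 'M[C]_7) : (\forall z \near a, mder e z) ->
  near_punct a (fun z => (e z)^T *m e z = 1%:M /\ \det (e z) = 1) -> SO_near a e.
Proof.
move=> ed ep; have ea := nbhs_singleton ed.
have o : (e a)^T *m e a = 1%:M by apply: (orth_punct ea); apply: near_punctS ep => z [].
have d : \det (e a) = 1 by apply: (det_punct ea); apply: near_punctS ep => z [].
apply: filterS2 ed ep => z ez ezp; split=> //.
  by have [->//|/ezp[]] := eqVneq z a.
by have [->//|/ezp[]] := eqVneq z a.
Qed.

(** Since k' = e(a)^-1 k, the poles cancel; what remains is holomorphic because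
    the divided difference of e at a is. *)
Lemma dressing_local (a : C) (k : 'cV[C]_7) (e : C -> 'M[C]_7) : a^* != a -> null k ->
  SO_near a e -> let k' := (e a)^T *m k in
  exists2 S : C -> 'M[C]_7, SO_near a S &
    near_punct a (fun z => S z = pmx (mob a z) k *m e z *m pmx (mob a z)^-1 k').
Proof.
move=> ca kn SO_near_e k'; have [_ oa _] := nbhs_singleton SO_near_e.
have ed : \forall z \near a, mder e z by apply: filterS SO_near_e => z [].
have Wd := mslope_der ed.
pose S z := dress (z - a^*) (z - a) k (e z) (mslope e a z) k'.
have Sd : \forall z \near a, mder S z.
  have nc : \forall z \near a, z != a^* by apply: near_neq; rewrite eq_sym.
  apply: filterS3 ed Wd nc => z ez Wz zc.
  have cd b : derivable (fun x : C => x - b) z 1.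
    exact: (@derB _ (fun x => x) (fun=> b) z (@der_id _ z) (@der_cst _ b z)).
  by apply: (@dress_der (fun x => x - a^*) (fun x => x - a) k k' e _ z (cd _) (cd _) _ ez Wz); rewrite subr_eq0.
have SE : near_punct a (fun z => S z = pmx (mob a z) k *m e z *m pmx (mob a z)^-1 k').
  have := near_punctI (near_punct_near SO_near_e) (mob_near ca).
  apply: near_punctS => z [[_ oz _] [c0 d0]].
  have eE := mslopeE e a z.
  have := @dressE _ (z - a^*) (z - a) k (e a) (mslope e a z) c0 d0 kn oa.
  by rewrite -eE => /(_ oz) H; rewrite /S /mob H.
exists S => //; apply: SO_near_punct Sd _.
have := near_punctI (near_punctI (near_punct_near SO_near_e) (mob_near ca)) SE.
apply: near_punctS => z [[[_ oz dz] [c0 d0]] ->].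
have t0 : mob a z != 0 by rewrite mulf_neq0// invr_eq0.
exact: (pmx_conj_SO kn (orth_null oa kn) t0 oz dz).
Qed.

End MatrixDerivative.

(** * Dressing of an admissible pair near the pole *)

Section PairDressing.
Context {R : realType}.
Local Notation C := (Cplx R).
Implicit Types (z : C).

Lemma mder_poly3 (t : C -> C) (A B D E : 'M[C]_7) z : derivable t z 1 ->
  mder (fun x => A + t x *: B + t x ^+ 2 *: D + t x ^+ 3 *: E) z.
Proof.
move=> tz; have t2 := der_sqr tz.
have t3 : derivable (fun x => t x ^+ 3) z 1.
  apply: (der_ext (f := fun x => t x * (t x ^+ 2))) => [x|]; first by rewrite exprS.
  exact: (@derM _ t (fun x => t x ^+ 2) z tz t2).
exact: (mderD (mderD (mderD (@mder_cst _ _ _ A z) (mderZ tz (@mder_cst _ _ _ B z)))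
  (mderZ t2 (@mder_cst _ _ _ D z))) (mderZ t3 (@mder_cst _ _ _ E z))).
Qed.

Lemma mder_pair_poly (t : C -> C) (l k : 'cV[C]_7) z : derivable t z 1 ->
  mder (fun x => pair_poly (t x) l k) z.
Proof. by move=> tz; exact: mder_poly3. Qed.

Lemma mder_line_poly (t : C -> C) (k : 'cV[C]_7) z : derivable t z 1 ->
  mder (fun x => line_poly (t x) k) z.
Proof.
move=> tz; exact: (mderD (mderD (@mder_cst _ _ _ _ z) (mderZ tz (@mder_cst _ _ _ _ z)))
  (mderZ (der_sqr tz) (@mder_cst _ _ _ _ z))).
Qed.

Section Local.
Variables (a : C) (l k : 'cV[C]_7) (e : C -> 'M[C]_7).
Hypotheses (ca : a^* != a) (lk : adm l k).
Hypothesis eG : \forall z \near a, mder e z /\ autO (e z).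

Let tau z : C := (z - a) / (z - a^*).

Lemma tau_a : tau a = 0. Proof. by rewrite /tau subrr mul0r. Qed.

Lemma tau_der : derivable tau a 1.
Proof.
have cd b : derivable (fun x : C => x - b) a 1.
  exact: (@derB _ (fun x => x) (fun=> b) a (@der_id _ a) (@der_cst _ b a)).
by apply: (@der_quo _ (fun x => x - a^*) (fun x => x - a) a (cd _) (cd _)); rewrite subr_eq0 eq_sym.
Qed.

Lemma tau_mob z : (tau z)^-1 = mob a z.
Proof. by rewrite /tau /mob invf_div. Qed.

Lemma tau_neq0 : near_punct a (fun z => tau z != 0).
Proof.
apply: near_punctS (mob_near ca) => z [c0 d0].
by rewrite /tau mulf_neq0// invr_eq0.
Qed.

Lemma SO_near_e : SO_near a e.
Proof. by apply: filterS eG => z [ez [oz xz]]; split=> //; exact: autO_det. Qed.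

Let k' := (e a)^T *m k.

(** The two successive dressings are holomorphic at a with orthogonal values.
    Comparing the residues of the two pair loops through them transfers
    nonvanishing, and the vanishing of cross products in the limit, from (l, k)
    to (l', k'). *)
Lemma pair_dressing_local (S : C -> 'M[C]_7) : SO_near a S ->
  near_punct a (fun z => S z = pmx (mob a z) k *m e z *m pmx (mob a z)^-1 k') ->
  let l' := (S a)^T *m l in
  adm l' k' /\ exists2 ht : C -> 'M[C]_7, \forall z \near a, mder ht z /\ autO (ht z) &
   near_punct a (fun z => ht z =
     pmx (mob a z) l *m pmx (mob a z) k *m e z *m (pmx (mob a z) l' *m pmx (mob a z) k')^T).
Proof.
move=> SSO SE l'; have [ln kn lck _ _] := lk.
have [ed [eo ex]] := nbhs_singleton eG; have [Sd So _] := nbhs_singleton SSO.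
have k'n : null k' := orth_null eo kn; have l'n : null l' := orth_null So ln.
(* Orthogonality of l' and conj k' comes from the limit at a of S^T conj k,
   computed with the polynomial form of the factor of k'. *)
have Scj : (S a)^T *m cj k = (nrm k / nrm k') *: cj k'.
  rewrite -(line_poly0_orth kn eo) -/k' -[in RHS]tau_a.
  have m1 : mder (fun z => (S z)^T *m cj k) a := mderM (mder_tr Sd) (@mder_cst _ _ _ (cj k) a).
  have m2 : mder (fun z => line_poly (tau z) k' *m ((e z)^T *m cj k)) a.
    exact: (mderM (@mder_line_poly tau k' a tau_der) (mderM (mder_tr ed) (@mder_cst _ _ _ (cj k) a))).
  apply: (mder_punct_eq m1 m2).
  have := near_punctI tau_neq0 SE; apply: near_punctS => z [t0 Sz].
  by apply: (dressed_tr_cj t0 kn); rewrite tau_mob.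
have l'ck' : dotC l' (cj k') = 0 := dressed_perp kn k'n.1 So Scj lck.
have [ht htSO htE] := dressing_local ca ln SSO.
have [hd ho _] := nbhs_singleton htSO.
have htE' : near_punct a (fun z => (ht z)^T *m (pmx (mob a z) l *m pmx (mob a z) k) *m e z
    = pmx (mob a z) l' *m pmx (mob a z) k').
  have := near_punctI (near_punctI (near_punct_near eG) tau_neq0) (near_punctI SE htE).
  apply: near_punctS => z [[[_ [oz _]] t0] [Sz hz]].
  have tt0 : mob a z != 0 by rewrite -tau_mob invr_eq0.
  exact: (dressed_pair_inv ln kn tt0 oz Sz hz).
(* The relation between the two pair loops, multiplied by tau so that it extends
   to a. *)
have QE : near_punct a (fun z => (ht z)^T *m pair_poly (tau z) l k *m e z = pair_poly (tau z) l' k').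
  have := near_punctI htE' tau_neq0; apply: near_punctS => z [hz t0].
  by rewrite -tau_mob in hz; exact: (pair_poly_dressed t0 lck l'ck' hz).
have Qd : mder (fun z => pair_poly (tau z) l k) a := @mder_pair_poly tau l k a tau_der.
have Qd' : mder (fun z => pair_poly (tau z) l' k') a := @mder_pair_poly tau l' k' a tau_der.
have Qa : (ht a)^T *m pair_poly 0 l k *m e a = pair_poly 0 l' k'.
  rewrite -tau_a; exact: (mder_punct_eq (mderM (mderM (mder_tr hd) Qd) ed) Qd' QE).
have l'k' : adm l' k'.
  apply: adm_of_residue => //; first by rewrite -Qa; apply: orth_neq0 => //; exact: pair_poly0_neq0.
  move=> x y.
  have Qv (v : 'cV[C]_7) : mder (fun z => (pair_poly (tau z) l' k')^T *m v) a.
    exact: (mderM (mder_tr Qd') (@mder_cst _ _ _ v a)).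
  have hv (v : 'cV[C]_7) : mder (fun z => ht z *m v) a := mderM hd (@mder_cst _ _ _ v a).
  have m1 := mder_cross (Qv x) (Qv y).
  have m2 := mderZ tau_der (mderM (mder_tr ed) (mderM (mder_tr Qd) (mder_cross (hv x) (hv y)))).
  rewrite -tau_a (mder_punct_eq m1 m2); first by rewrite tau_a scale0r.
  have := near_punctI (near_punctI (near_punct_near eG) QE) tau_neq0.
  apply: near_punctS => z [[[_ ez] Qz] t0].
  exact: (dressed_cross x y lk t0 ez Qz).
split=> //; exists ht.
  have hm : \forall z \near a, mder ht z by apply: filterS htSO => z [].
  have hp : near_punct a (fun z => autO (ht z)).
    have := near_punctI (near_punctI (near_punct_near eG) tau_neq0) (near_punctI SE htE).
    apply: near_punctS => z [[[_ ez] t0] [Sz hz]].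
    have tt0 : mob a z != 0 by rewrite -tau_mob invr_eq0.
    exact: (autO_dressed lk l'k' tt0 ez (dressed_pairE Sz hz)).
  have ha : autO (ht a) := autO_punct hd hp.
  apply: filterS2 hm hp => z hz hzp; split=> //.
  by have [->|/hzp] := eqVneq z a.
have := near_punctI SE htE; apply: near_punctS => z [Sz hz].
exact: (dressed_pairE Sz hz).
Qed.

End Local.

End PairDressing.

(** * Lines and planes as subspaces *)

Lemma congr3 (T1 T2 T3 T : Type) (f : T1 -> T2 -> T3 -> T) a a' b b' c c' :
  a = a' -> b = b' -> c = c' -> f a b c = f a' b' c'.
Proof. by move=> -> -> ->. Qed.

Section Generic.
Variables (F : fieldType) (vT : vectType F).
Implicit Types (U V W : {vspace vT}) (u v x : vT).

Lemma daddv_piE U V u v : (U :&: V = 0)%VS -> u \in U -> v \in V ->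
  daddv_pi U V (u + v) = u.
Proof.
move=> UV uU vV; have VU : (V :&: U = 0)%VS by rewrite capvC.
have vUV : v \in (U + V)%VS by rewrite -[v]add0r memv_add ?mem0v.
have v0 : daddv_pi U V v = 0.
  have := daddv_pi_add UV vUV; rewrite (daddv_pi_id VU vV) => /(canRL (addrK v)) ->.
  by rewrite subrr.
by rewrite (linearD (daddv_pi U V)) /= v0 addr0; exact: daddv_pi_id.
Qed.

Lemma capv_eq0 U V : (forall x, x \in U -> x \in V -> x = 0) -> (U :&: V = 0)%VS.
Proof.
move=> h; apply/eqP; rewrite -subv0; apply/subvP => x.
by rewrite memv_cap memv0 => /andP[xU xV]; rewrite (h x).
Qed.

Lemma dim_pair u v : u != 0 -> v != 0 -> (<[u]> :&: <[v]> = 0)%VS -> \dim (<[u]> + <[v]>) = 2%N.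
Proof. by move=> u0 v0 h; rewrite dimv_disjoint_sum// !dim_vline u0 v0. Qed.

Lemma dim_pair_neq0 u v : \dim (<[u]> + <[v]>) = 2%N -> v != 0.
Proof.
move=> d; apply/eqP => v0; move: d; rewrite v0.
by rewrite addv0 dim_vline; case: (u != 0).
Qed.

End Generic.

Section Sum.
Variable C : numClosedFieldType.
Lemma projm_sum (k : 'cV[C]_7) : projl k + projm k + (projl k)^T = 1%:M.
Proof. by rewrite /projm -[_ - _ - _]addrA -opprD addrAC addrC subrK. Qed.

Lemma projm_perp (k x : 'cV[C]_7) : null k -> dotC (projm k *m x) k = 0.
Proof.
move=> [k0 kk]; have n0 : nrm k != 0 by rewrite nrm_eq0.
rewrite projmE !dotDl !dotNl !dotZl kk [dotC (cj k) k]dotCC -/(nrm k).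
by rewrite mulr0 subr0 divfK// [dotC x k]dotCC subrr.
Qed.

Lemma projm_perp_cj (k x : 'cV[C]_7) : null k -> dotC (projm k *m x) (cj k) = 0.
Proof.
move=> [k0 kk]; have n0 : nrm k != 0 by rewrite nrm_eq0.
rewrite projmE !dotDl !dotNl !dotZl dot_conj kk rmorph0 -/(nrm k).
by rewrite mulr0 subr0 divfK// [dotC x _]dotCC subrr.
Qed.
End Sum.

Section Lines.
Context {R : realType}.
Local Notation C := (Cplx R).
Implicit Types (L K U V : {vspace 'cV[C]_7}) (k l m x y : 'cV[C]_7).

Lemma conjvE x : conjv x = cj x. Proof. by []. Qed.

Lemma octdotE x y : octdot x y = crossO x y.
Proof. by rewrite /octdot /mulO /= !scale0r !add0r. Qed.

Lemma line_gen L : isotropic_line L -> exists2 k, L = <[k]>%VS & null k.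
Proof.
move=> [dL iL]; have k0 : vpick L != 0 by rewrite vpick0 -dimv_eq0 dL.
have kL : vpick L \in L := memv_pick L.
exists (vpick L); last by split=> //; exact: iL.
apply/esym/eqP; rewrite eqEdim dim_vline k0 dL andbT.
by apply/subvP => _ /vlineP[a ->]; exact: memvZ.
Qed.

Lemma isotropic_lineP k : null k -> isotropic_line <[k]>%VS.
Proof.
move=> [k0 kk]; split; first by rewrite dim_vline k0.
by move=> x y /vlineP[a ->] /vlineP[b ->]; rewrite dotZl dotZr kk !mulr0.
Qed.

Lemma conjU_line k : conjU <[k]>%VS = <[cj k]>%VS.
Proof.
apply/vspaceP => x; rewrite memv_conjU conjvE.
apply/vlineP/vlineP => -[a h]; exists a^*; last by rewrite h cjZ cjK.
by rewrite -[x]cjK h cjZ.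
Qed.

Lemma memv_perp_line k x : (x \in perp <[k]>%VS) = (dotC x k == 0).
Proof.
apply/memv_perpP/eqP => [h|h y /vlineP[a ->]]; first exact/h/memv_line.
by rewrite dotZr h mulr0.
Qed.

Lemma memv_perp_lines k l x : (x \in perp (<[k]> + <[l]>)%VS) = (dotC x k == 0) && (dotC x l == 0).
Proof.
apply/memv_perpP/andP => [h|[/eqP h1 /eqP h2] y].
  split; apply/eqP/h; rewrite -[X in X \in _]addr0 ?[k + 0]addrC.
    by rewrite addrC; apply: memv_add; [exact: memv_line|exact: mem0v].
  by rewrite addrC; apply: memv_add; [exact: mem0v|exact: memv_line].
move=> /memv_addP[_ /vlineP[a ->] [_ /vlineP[b ->] ->]].
by rewrite dotDr !dotZr h1 h2 !mulr0 addr0.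
Qed.

Lemma cap_line0 k (U : {vspace 'cV[C]_7}) c : dotC k c != 0 ->
  (forall x, x \in U -> dotC x c = 0) -> (<[k]> :&: U = 0)%VS.
Proof.
move=> kc h; apply: capv_eq0 => x /vlineP[a ->] /h/eqP.
by rewrite dotZl mulf_eq0 (negPf kc) orbF => /eqP ->; rewrite scale0r.
Qed.

Section OneLine.
Variables (k : 'cV[C]_7).
Hypothesis kn : null k.
Let W := perp (<[k]> + conjU <[k]>)%VS.

Lemma memW x : (x \in W) = (dotC x k == 0) && (dotC x (cj k) == 0).
Proof. by rewrite /W conjU_line memv_perp_lines. Qed.

Lemma nk0 : nrm k != 0. Proof. by rewrite nrm_eq0; case: kn. Qed.

Lemma ckk : dotC (cj k) (cj k) = 0.
Proof. by rewrite dot_conj (proj2 kn) rmorph0. Qed.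

Lemma cap_L : (<[k]> :&: (W + conjU <[k]>) = 0)%VS.
Proof.
apply: (@cap_line0 k _ (cj k)); first exact: nk0.
move=> x /memv_addP[w]; rewrite memW => /andP[_ /eqP w0] [v].
by rewrite conjU_line => /vlineP[b ->] ->; rewrite dotDl dotZl w0 ckk mulr0 addr0.
Qed.

Lemma cap_Lbar : (conjU <[k]> :&: (<[k]> + W) = 0)%VS.
Proof.
rewrite conjU_line; apply: (@cap_line0 (cj k) _ k); first by rewrite dotCC; exact: nk0.
move=> x /memv_addP[_ /vlineP[b ->]] [w]; rewrite memW => /andP[/eqP w0 _] ->.
by rewrite dotDl dotZl w0 (proj2 kn) mulr0 addr0.
Qed.

Lemma cap_W : (W :&: (<[k]> + conjU <[k]>) = 0)%VS.
Proof.
apply: capv_eq0 => x; rewrite memW conjU_line => /andP[/eqP x1 /eqP x2].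
move=> /memv_addP[_ /vlineP[a ->] [_ /vlineP[b ->] xE]]; rewrite xE.
have a0 : a = 0.
  move: x2; rewrite xE dotDl !dotZl ckk mulr0 addr0 => /eqP.
  by rewrite mulf_eq0 (negPf nk0) orbF => /eqP.
have b0 : b = 0.
  move: x1; rewrite xE dotDl !dotZl (proj2 kn) mulr0 add0r dotCC => /eqP.
  by rewrite mulf_eq0 (negPf nk0) orbF => /eqP.
by rewrite a0 b0 !scale0r addr0.
Qed.

Lemma mem_projl x : projl k *m x \in <[k]>%VS.
Proof. by rewrite projlE memvZ ?memv_line. Qed.

Lemma mem_projlbar x : (projl k)^T *m x \in conjU <[k]>.
Proof. by rewrite conjU_line projl_tr projlE memvZ ?memv_line. Qed.

Lemma mem_projm x : projm k *m x \in W.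
Proof.
by rewrite memW projm_perp// projm_perp_cj// !eqxx.
Qed.

Lemma line_split x : x = projl k *m x + projm k *m x + (projl k)^T *m x.
Proof. by rewrite -!mulmxDl projm_sum mul1mx. Qed.

Lemma cvec_linE (f : 'End('cV[C]_7)) (A : 'M[C]_7) : (forall x, f x = A *m x) -> mx_of f = A.
Proof. by move=> h; apply: eq_mulmx => x; rewrite mul_mx_of h. Qed.

Lemma piL_line x : piL <[k]>%VS x = projl k *m x.
Proof.
rewrite {1}[x]line_split -addrA; apply: daddv_piE cap_L (mem_projl x) _.
exact: memv_add (mem_projm x) (mem_projlbar x).
Qed.

Lemma piLbar_line x : piLbar <[k]>%VS x = (projl k)^T *m x.
Proof.
rewrite {1}[x]line_split addrC; apply: daddv_piE cap_Lbar (mem_projlbar x) _.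
exact: memv_add (mem_projl x) (mem_projm x).
Qed.

Lemma piM_line x : piM <[k]>%VS x = projm k *m x.
Proof.
rewrite {1}[x]line_split [X in X + _]addrC -addrA; apply: daddv_piE cap_W (mem_projm x) _.
exact: memv_add (mem_projl x) (mem_projlbar x).
Qed.

Lemma loop_line_gen (alpha : C) q :
  loop_line alpha <[k]>%VS q = moebius alpha alpha^* q *: (projl k)^T + projm k
    + moebius alpha^* alpha q *: projl k.
Proof.
exact: (congr3 (fun A B D => moebius alpha alpha^* q *: A + B + moebius alpha^* alpha q *: D)
  (cvec_linE piLbar_line) (cvec_linE piM_line) (cvec_linE piL_line)).
Qed.

End OneLine.

Lemma mximage_line (M : 'M[C]_7) k : mximage M <[k]>%VS = <[M *m k]>%VS.
Proof. by rewrite /mximage limg_line lfunE. Qed.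

Lemma piM_image l k : null l -> dotC l (cj k) = 0 -> (piM <[l]> @: <[k]>)%VS = <[perp_part l k]>%VS.
Proof.
move=> ln lk; have lk' : dotC (cj l) k = 0 by rewrite -[k]cjK dot_conj lk rmorph0.
by rewrite limg_line piM_line// projmE lk' mul0r scale0r subr0 [dotC l k]dotCC.
Qed.

Lemma perp_line_conj l k : (<[k]> <= perp (conjU <[l]>))%VS = (dotC l (cj k) == 0).
Proof.
rewrite -memvE conjU_line memv_perp_line -[k]cjK dot_conj cjK conjC_eq0 dotCC.
by [].
Qed.

Lemma isotropic_pair l m : dotC l l = 0 -> dotC m m = 0 -> dotC l m = 0 -> isotropic (<[l]> + <[m]>)%VS.
Proof.
move=> ll mm lm x y /memv_addP[_ /vlineP[a ->] [_ /vlineP[b ->] ->]].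
move=> /memv_addP[_ /vlineP[c ->] [_ /vlineP[d ->] ->]].
by rewrite !dotDl !dotDr !dotZl !dotZr ll mm lm dotCC lm !mulr0 !addr0.
Qed.

(** Given the orthogonality condition, the subspace attached to the pair is
    spanned by l and the middle component of k. These two vectors are
    independent as soon as the second one is nonzero, since only l pairs with
    conj l. *)
Lemma admissibleP l k : null l -> null k -> admissible <[l]>%VS <[k]>%VS <-> adm l k.
Proof.
move=> ln kn; split=> [[_ _]|lk].
  rewrite perp_line_conj => /eqP lck; rewrite (piM_image ln lck) => -[d _ cx].
  split=> //; first exact: dim_pair_neq0 d.
  rewrite -octdotE; apply: cx.
    by rewrite -[X in X \in _]addr0 memv_add ?mem0v ?memv_line.
  by rewrite -[X in X \in _]add0r memv_add ?mem0v ?memv_line.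
have [_ _ lck m0 cx] := lk; have [_ [_ mm] lm lcm _] := adm_null_pair lk.
split; try exact: isotropic_lineP; first by rewrite perp_line_conj lck eqxx.
rewrite (piM_image ln lck); have [l0 ll] := ln.
split; last 1 first.
- move=> x y /memv_addP[_ /vlineP[a ->] [_ /vlineP[b ->] ->]].
  move=> /memv_addP[_ /vlineP[c ->] [_ /vlineP[d ->] ->]].
  rewrite octdotE !crossDl !crossDr !crossZl !crossZr !crossxx [crossO (perp_part l k) l]crossC cx oppr0 !scaler0.
  by rewrite !addr0.
- apply: dim_pair => //; apply: (@cap_line0 l _ (cj l)); first exact: nk0.
  move=> x /vlineP[b ->]; rewrite dotZl.
  by rewrite -[perp_part l k]cjK dot_conj dotCC lcm rmorph0 mulr0.
- exact: isotropic_pair.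
Qed.

End Lines.

(** * Topology of the Riemann sphere *)

(** Differentiability is with respect to the norm of matrices, while the
    calculus of the previous sections is entrywise. *)
Lemma derivable_entries (K : numFieldType) m n (F : K -> 'M[K]_(m, n)) (z : K) :
  derivable F z 1 <-> forall i j, derivable (fun x => F x i j) z 1.
Proof.
split=> [/derivable1_diffP Fz i j|Fz].
  apply/derivable1_diffP.
  exact: (@differentiable_comp _ _ _ _ F (fun N : 'M[K]_(m, n) => N i j) z Fz (differentiable_coord (F z) i j)).
have -> : F = \sum_(i < m) (\sum_(j < n) (fun x => F x i j *: delta_mx i j)).
  apply/funext => x; rewrite fct_sumE [LHS]matrix_sum_delta; apply: eq_bigr => i _.
  by rewrite fct_sumE.
apply: derivable_sum => i; apply: derivable_sum => j; apply/derivable1_diffP.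
by apply: differentiableZl; apply/derivable1_diffP.
Qed.

Section Sphere.
Context {R : realType}.
Local Notation C := (Cplx R).
Local Notation M7 := 'M[Cplx R]_7.
Implicit Types (z w a b : C) (p q : CP1 R) (U V W : set (CP1 R)) (g e : CP1 R -> M7) (G : set M7).

Lemma mderP (F : C -> M7) z : derivable F z 1 <-> mder F z.
Proof. exact: derivable_entries. Qed.

Lemma holo_onP U g : holo_on U g <-> forall p, U p -> mder (fun z => g (chart p z)) 0.
Proof. by split=> h p Up; apply/mderP; exact: h. Qed.

Lemma nbhs_some a U : nbhs (Some a : CP1 R) U <-> nbhs a (fun z => U (Some z)).
Proof. by []. Qed.

Lemma nbhs_none U : nbhs (None : CP1 R) U <->
  exists2 K : set C, compact K /\ closed K & (forall z, ~ K z -> U (Some z)) /\ U None.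
Proof.
split=> [[K cK KU]|[K cK [KU UN]]].
  by exists K => //; split=> [z Kz|]; apply: KU; [left; exists z|right].
by exists K => // _ [[z Kz <-]|->//]; exact: KU.
Qed.

Lemma continuous_nm : continuous (@nm R : C -> R).
Proof.
move=> z A /nbhs_ballP[e /= e0 eA]; apply/nbhs_nmP; exists e => // w wz.
apply: eA; rewrite /ball /= distrC; apply: le_lt_trans wz.
have h1 := nmD (w - z) z; have h2 := nmD (z - w) w.
rewrite subrK in h1; rewrite subrK -[z - w]opprB nmN in h2.
by rewrite ler_norml; apply/andP; split; lra.
Qed.

Lemma compact_nm (K : set C) : compact K -> exists r : R, forall z, K z -> nm z <= r.
Proof.
move=> Kc; have ic : compact (@nm R @` K).
  by apply: continuous_compact => //; apply: continuous_subspaceT; exact: continuous_nm.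
have [M [Mr MP]] := @compact_bounded _ R^o _ ic.
exists (M + 1) => z Kz; have M1 : M < M + 1 by rewrite ltrDl.
apply: le_trans (ler_norm _) _; apply: (MP _ M1); exists z => //.
Qed.

Lemma open_setC1 a : open (~` [set (Some a : CP1 R)]).
Proof.
rewrite openE => -[z /= za|_ /=].
  apply/nbhs_some; have : \forall w \near z, w != a by apply: near_neq; apply/eqP => h; apply: za; rewrite h.
  by apply: filterS => w /eqP wa [].
apply/nbhs_none; exists [set a]; last by split=> // z za [].
split; first exact: compact_set1.
by apply: accessible_closed_set1; apply: hausdorff_accessible; exact: norm_hausdorff.
Qed.

Lemma near_punct_ex a (P : C -> Prop) : near_punct a P -> exists2 z, z != a & P z.
Proof.
move=> aP; have [z [za Pz]] : exists z, z != a /\ P z.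
  apply: (@filter_ex _ (dnbhs a)); rewrite /dnbhs /within /=.
  by move: aP; rewrite /near_punct; apply: filterS => z Pz za; split=> //; exact: Pz.
by exists z.
Qed.

(** A neighbourhood of infinity contains points of the affine chart because the
    plane is not compact. *)
Lemma open_ex_some U : open U -> U !=set0 -> exists z, U (Some z).
Proof.
move=> Uo [[z|] Up]; first by exists z.
have /nbhs_none[K [Kc _] [KU _]] : nbhs (None : CP1 R) U by exact: open_nbhs_nbhs.
have [r rP] := compact_nm Kc; exists (cpx (r + 1) 0); apply: KU => /rP h.
have := le_trans (ler_norm _) (le_trans (nm_Re _) h).
by rewrite /= gerDl ler10.
Qed.

Lemma dense_setC1 a : dense (~` [set (Some a : CP1 R)]).
Proof.
move=> U Up Uo; have [z Uz] := open_ex_some Uo Up.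
have : nbhs (Some z : CP1 R) U by exact: open_nbhs_nbhs.
move=> /nbhs_some /(near_punct_near) /near_punct_ex[w wz Uw].
have [za|za] := eqVneq z a.
  by exists (Some w); split=> // wa; case: wa => wa; rewrite wa za eqxx in wz.
by exists (Some z); split=> // za'; case: za' => za'; rewrite za' eqxx in za.
Qed.

(** The sets off which the values of a loop are irrelevant. *)
Definition open_dense V := open V /\ dense V.

Lemma open_denseI V V' : open_dense V -> open_dense V' -> open_dense (V `&` V').
Proof. by move=> [Vo Vd] [Vo' Vd']; split; [exact: openI|exact: denseI]. Qed.

Lemma open_dense_setC1 a : open_dense (~` [set (Some a : CP1 R)]).
Proof. by split; [exact: open_setC1|exact: dense_setC1]. Qed.

Lemma open_dense_some V (O : set C) : open_dense V -> open O -> O !=set0 -> exists2 z, O z & V (Some z).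
Proof.
move=> [_ Vd] Oo [z Oz].
have [|_ [[w Ow <-] Vw]] := Vd _ _ (@one_point_compactification_open_some _ O Oo).
  by exists (Some z); exists z.
by exists w.
Qed.

(** An open dense set is met arbitrarily close to any point, measured in the
    chart at this point; this is how equalities on open dense sets reach the
    point itself. *)
Lemma open_dense_chart V p (O : set C) : open_dense V -> nbhs 0 O -> exists2 z, O z & V (chart p z).
Proof.
move=> Vod; rewrite nbhsE => -[B [Bo B0] BO]; case: p => [a|] /=.
  have [||w Bw Vw] := @open_dense_some V [set w | B (w - a)] Vod.
  - apply: (@open_comp _ _ (fun w : C => w - a)) => // w _.
    exact: (@der_cont _ _ w (@derB _ (fun x => x) (fun=> a) w (@der_id _ w) (@der_cst _ a w))).
  - by exists a; rewrite /= subrr.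
  by exists (w - a); [exact: BO|rewrite addrC subrK].
have Bn : near_punct 0 B by apply: near_punct_near; exact: open_nbhs_nbhs.
have [z0 z00 Bz0] := near_punct_ex Bn.
have [||w [Bw w0] Vw] := @open_dense_some V [set w | B w^-1 /\ w != 0] Vod.
- rewrite openE => w [Bw w0]; rewrite /interior /=.
  have wi : \forall x \near w, B x^-1.
    have := @der_cont _ _ w (@derV _ (fun x => x) w w0 (@der_id _ w)).
    by apply; exact: open_nbhs_nbhs.
  by apply: filterS2 wi (near_neq w0).
- by exists z0^-1; rewrite /= invrK invr_eq0.
by exists w^-1; [exact: BO|rewrite invr_eq0 (negPf w0) invrK].
Qed.

(** Continuity of the chart at 0. At infinity it holds because compact sets are
    bounded. *)
Lemma chart_near p U : nbhs p U -> \forall z \near (0 : C), U (chart p z).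
Proof.
case: p => [a /nbhs_some/nbhs_nmP[r r0 rP]|/nbhs_none[K [Kc _] [KU UN]]].
  apply: (near_nm r0) => w; rewrite subr0 => wr; apply: rP.
  by rewrite [a + w]addrC addrK.
have [r rP] := compact_nm Kc; pose r1 := Num.max r 0 + 1.
have r10 : 0 < r1 by rewrite /r1 ltr_wpDl// le_max lexx orbT.
have ri0 : 0 < r1^-1 by rewrite invr_gt0.
apply: (near_nm ri0) => w; rewrite subr0 /= => wr.
have [//|w0] := eqVneq w 0; apply: KU => /rP; rewrite nmV => h.
have nw : 0 < nm w by rewrite lt_neqAle nm_ge0 eq_sym nm_eq0 w0.
have : r1 < (nm w)^-1 by rewrite -[r1]invrK ltf_pV2.
have hr : r <= Num.max r 0 by rewrite le_max lexx.
by rewrite /r1; lra.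
Qed.

Lemma der_freq_eq (f f' : C -> C) a : derivable f a 1 -> derivable f' a 1 ->
  (forall O : set C, nbhs a O -> exists2 z, O z & f z = f' z) -> f a = f' a.
Proof.
move=> fa fa' H; apply/eqP; rewrite -subr_eq0; apply/negPn/negP => n0.
have Dc := @der_cont _ _ a (@derB _ f f' a fa fa').
have nz : \forall z \near a, f z - f' z != 0 := Dc _ (near_neq n0).
by have [z /negP zn zE] := H _ nz; apply: zn; rewrite zE subrr.
Qed.

(** Density only provides agreement at points arbitrarily close to a, not on a
    punctured neighbourhood. *)
Lemma mder_freq_eq (F F' : C -> M7) a : mder F a -> mder F' a ->
  (forall O : set C, nbhs a O -> exists2 z, O z & F z = F' z) -> F a = F' a.
Proof.
move=> Fa Fa' H; apply/matrixP => i j.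
apply: (@der_freq_eq (fun z => F z i j) (fun z => F' z i j) a (Fa i j) (Fa' i j)).
by move=> O /H[z Oz zE]; exists z => //; rewrite zE.
Qed.

Lemma der_shift (f : C -> C) a : derivable (fun z => f (a + z)) 0 1 <-> derivable f a 1.
Proof.
rewrite !derivable_nmP; split=> -[d fd]; exists d => e /fd[r r0 rP]; exists r => // w wr.
  have := rP (w - a); rewrite subr0 addr0 [a + _]addrC subrK => H; exact: H wr.
have := rP (a + w); rewrite [a + w - a]addrC addKr => H.
rewrite subr0 in wr; rewrite subr0 addr0; exact: H wr.
Qed.

Lemma mder_shift (F : C -> M7) a : mder (fun z => F (a + z)) 0 <-> mder F a.
Proof.
split=> h i j.
  exact: (proj1 (der_shift (fun z => F z i j) a) (h i j)).
exact: (proj2 (der_shift (fun z => F z i j) a) (h i j)).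
Qed.

End Sphere.

(** * Extensions of loops *)

Section Extensions.
Context {R : realType}.
Local Notation C := (Cplx R).
Local Notation M7 := 'M[Cplx R]_7.
Implicit Types (z w a b : C) (p q : CP1 R) (U V W : set (CP1 R)) (g e : CP1 R -> M7) (G : set M7).

Lemma chart0 p : chart p 0 = p.
Proof. by case: p => [a|] /=; rewrite ?addr0 ?eqxx. Qed.

(** Both extensions agree with the loop on an open dense set, which accumulates
    at p in the chart at p. *)
Lemma extends_at_value G g p e e' : extends_at G g p e -> extends_at G g p e' -> e p = e' p.
Proof.
move=> [W [V [[Wo Wp Vo Vd] [eh _ eE]]]] [W' [V' [[Wo' Wp' Vo' Vd'] [eh' _ eE']]]].
have /holo_onP/(_ p Wp) ep := eh; have /holo_onP/(_ p Wp') ep' := eh'.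
rewrite -[p]chart0; apply: (mder_freq_eq ep ep') => O O0.
have Wn : nbhs p (W `&` W') by apply: open_nbhs_nbhs; split=> //; exact: openI.
have [z [Oz [Wz Wz']] [Vz Vz']] := @open_dense_chart _ _ p (O `&` _) (open_denseI (conj Vo Vd) (conj Vo' Vd'))
  (filterI O0 (chart_near Wn)).
by exists z => //; rewrite eE// eE'.
Qed.

Lemma loop_valueE G g p e : extends_at G g p e -> loop_value G g p = e p.
Proof.
move=> ge; rewrite /loop_value.
have := @xgetPex _ 0 [set M | exists2 e, extends_at G g p e & e p = M].
case; first by exists (e p), e.
by move=> e' ge' <-; exact: extends_at_value ge' ge.
Qed.

Lemma holo_at_value G g p : holo_at G g p -> exists2 e, extends_at G g p e & e p = loop_value G g p.
Proof. by move=> [e ge]; exists e => //; rewrite (loop_valueE ge). Qed.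

Lemma extends_at_congr G g g' p e V : open_dense V -> (forall q, V q -> g q = g' q) ->
  extends_at G g p e -> extends_at G g' p e.
Proof.
move=> Vod gg' [W [V1 [[Wo Wp Vo Vd] [eh eG eE]]]].
have [Yo Yd] := open_denseI (conj Vo Vd) Vod.
exists W, (V1 `&` V); split; split=> //.
by move=> q Wq [V1q Vq]; rewrite eE// gg'.
Qed.

Lemma extends_at_sub G G' g p e : G `<=` G' -> extends_at G g p e -> extends_at G' g p e.
Proof.
move=> GG' [W [V1 [[Wo Wp Vo Vd] [eh eG eE]]]].
exists W, V1; split; split=> // q /eG; exact: GG'.
Qed.

Lemma holo_onM U g g' : holo_on U g -> holo_on U g' -> holo_on U (mulL g g').
Proof.
by move=> /holo_onP gh /holo_onP gh'; apply/holo_onP => p Up; exact: mderM (gh p Up) (gh' p Up).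
Qed.

Lemma holo_onS U U' g : U' `<=` U -> holo_on U g -> holo_on U' g.
Proof. by move=> UU' gh p /UU'; exact: gh. Qed.

Lemma extends_atM G g g' p e e' : (forall A B, G A -> G B -> G (A *m B)) ->
  extends_at G g p e -> extends_at G g' p e' -> extends_at G (mulL g g') p (mulL e e').
Proof.
move=> GM [W [V [[Wo Wp Vo Vd] [eh eG eE]]]] [W' [V' [[Wo' Wp' Vo' Vd'] [eh' eG' eE']]]].
have [Yo Yd] := open_denseI (conj Vo Vd) (conj Vo' Vd').
exists (W `&` W'), (V `&` V'); split; split=> //; first exact: openI.
- by apply: holo_onM; [apply: holo_onS eh|apply: holo_onS eh'] => q [].
- by move=> q [Wq Wq']; apply: GM; [exact: eG|exact: eG'].
- by move=> q [Wq Wq'] [Vq Vq']; rewrite /mulL eE// eE'.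
Qed.

Lemma holo_extends G U g p : open_dense U -> holo_on U g -> (forall q, U q -> G (g q)) -> U p ->
  extends_at G g p g.
Proof. by move=> [Uo Ud] gh gG Up; exists U, U. Qed.

Lemma is_loopM G g g' : (forall A B, G A -> G B -> G (A *m B)) ->
  is_loop G g -> is_loop G g' -> is_loop G (mulL g g').
Proof.
move=> GM [U [Uo Ud gh gG]] [U' [Uo' Ud' gh' gG']].
have [Yo Yd] := open_denseI (conj Uo Ud) (conj Uo' Ud').
exists (U `&` U'); split=> //.
- by apply: holo_onM; [apply: holo_onS gh|apply: holo_onS gh'] => q [].
- by move=> q [Uq Uq']; apply: GM; [exact: gG|exact: gG'].
Qed.

(** Only the values on an open dense set matter, and holomorphy at a point of an
    open set is insensitive to changes off it. *)
Lemma is_loop_congr G V g g' : open_dense V -> (forall q, V q -> g q = g' q) ->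
  is_loop G g -> is_loop G g'.
Proof.
move=> Vod gg' [U [Uo Ud gh gG]]; have [Vo _] := Vod.
have [Yo Yd] := open_denseI (conj Uo Ud) Vod; exists (U `&` V); split=> //; last first.
  by move=> q [Uq Vq]; rewrite -gg'//; exact: gG.
apply/holo_onP => p [Up Vp]; have /holo_onP/(_ p Up) := gh.
have Vn : nbhs p V by exact: open_nbhs_nbhs.
apply: mder_near; have := chart_near Vn.
by apply: filterS => z Vz; exact: gg'.
Qed.

Lemma real_loopM g g' : real_loop g -> real_loop g' -> real_loop (mulL g g').
Proof.
move=> [V [Vo Vd gV]] [V' [Vo' Vd' gV']].
have [Yo Yd] := open_denseI (conj Vo Vd) (conj Vo' Vd').
exists (V `&` V'); split=> // q [Vq Vq'].
by rewrite /mulL map_mxM gV// gV'.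
Qed.

Lemma near_open a (P : C -> Prop) : (\forall z \near a, P z) ->
  exists B : set C, [/\ open B, B a & forall z, B z -> P z].
Proof.
move=> aP; have : nbhs a [set z | P z] := aP.
by rewrite nbhsE => -[B [Bo Ba] BP]; exists B; split=> // z /BP.
Qed.

Lemma extends_at_some G g a (F : C -> M7) V : open_dense V ->
  (\forall z \near a, mder F z /\ G (F z)) ->
  near_punct a (fun z => V (Some z) -> F z = g (Some z)) ->
  extends_at G g (Some a) (fun q => if q is Some z then F z else 0).
Proof.
move=> Vod Fn; rewrite /near_punct => gn.
have [B [Bo Ba BF]] := near_open Fn; have [D [Do Da DF]] := near_open gn.
have [Yo Yd] := open_denseI Vod (open_dense_setC1 a).
exists (Some @` (B `&` D)), (V `&` ~` [set Some a]); split; split=> //.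
- by apply: one_point_compactification_open_some; exact: openI.
- by exists a.
- apply/holo_onP => _ [z [Bz _] <-] /=; have [Fz _] := BF z Bz.
  exact: (proj2 (mder_shift F z) Fz).
- by move=> _ [z [Bz _] <-]; have [_] := BF z Bz.
- move=> _ [z [Bz Dz] <-] [Vz za]; apply: DF => //.
  by apply/eqP => h; apply: za; rewrite h.
Qed.

Lemma extends_at_someP G g a e : extends_at G g (Some a) e ->
  (\forall z \near a, mder (fun z => e (Some z)) z /\ G (e (Some z))) /\
  exists2 V, open_dense V & \forall z \near a, V (Some z) -> e (Some z) = g (Some z).
Proof.
move=> [W [V [[Wo Wp Vo Vd] [eh eG eE]]]].
have Wn : \forall z \near a, W (Some z).
  exact: (@open_nbhs_nbhs _ (Some a : CP1 R) W (conj Wo Wp)).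
split; last first.
  by exists V; [split|apply: filterS Wn => z Wz; exact: eE].
apply: filterS Wn => z Wz; split; last exact: eG.
have /holo_onP/(_ _ Wz) ez := eh.
exact: (proj1 (mder_shift (fun z => e (Some z)) z) ez).
Qed.

End Extensions.

(** * Complex conjugation on the sphere *)

Lemma conj_affine (K : numClosedFieldType) (x y d w : K) :
  x^* - y^* - d^* * w = (x - y - d * w^*)^*.
Proof. by rewrite !rmorphB rmorphM /= conjCK. Qed.

Section Conj.
Context {R : realType}.
Local Notation C := (Cplx R).
Local Notation M7 := 'M[Cplx R]_7.
Local Notation cmx := (map_mx (fun z : C => z^*)).
Implicit Types (z w a b : C) (p q : CP1 R) (U V W : set (CP1 R)) (g e : CP1 R -> M7) (G : set M7).

Lemma nm_conj z : nm z^* = nm z.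
Proof. by case: z => x y; rewrite /nm /= sqrrN. Qed.

Lemma nm_conjB z w : nm (z^* - w^*) = nm (z - w).
Proof. by rewrite -[RHS]nm_conj rmorphB. Qed.

Lemma conjPK p : conjP (conjP p) = p.
Proof. by case: p => [z|] //=; rewrite conjCK. Qed.

Lemma conjP_chart p z : conjP (chart p z) = chart (conjP p) z^*.
Proof.
case: p => [a|] /=; first by rewrite rmorphD.
by rewrite conjC_eq0; case: ifP => // _; rewrite /= fmorphV.
Qed.

Lemma continuous_conj : continuous (fun z : C => z^*).
Proof.
move=> z; apply/continuous_nmP => e e0; exists e => // w wz.
by rewrite nm_conjB.
Qed.

Lemma nbhs_conjP p U : nbhs (conjP p) U -> nbhs p (conjP @^-1` U).
Proof.
case: p => [a /nbhs_some/nbhs_nmP[r r0 rP]|/nbhs_none[K [Kc _] [KU UN]]].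
  apply/nbhs_some/nbhs_nmP; exists r => // w wa; apply: rP.
  by rewrite nm_conjB.
have Kc' : compact ((fun z : C => z^*) @` K).
  by apply: continuous_compact => //; apply: continuous_subspaceT; exact: continuous_conj.
apply/nbhs_none; exists ((fun z : C => z^*) @` K).
  by split=> //; apply: compact_closed => //; exact: norm_hausdorff.
split=> // z Kz /=; apply: KU => Kz'; apply: Kz; exists z^* => //.
by rewrite conjCK.
Qed.

Lemma open_conjP U : open U -> open (conjP @^-1` U).
Proof.
move=> Uo; rewrite openE => p Up; apply: nbhs_conjP; exact: open_nbhs_nbhs.
Qed.

Lemma open_dense_conjP U : open_dense U -> open_dense (conjP @^-1` U).
Proof.
move=> [Uo Ud]; split; first exact: open_conjP.
move=> V [p Vp] Vo; have [|q [Vq Uq]] := Ud (conjP @^-1` V) _ (open_conjP Vo).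
  by exists (conjP p); rewrite /= conjPK.
by exists (conjP q); split=> //=; rewrite conjPK.
Qed.

Lemma der_conj (f : C -> C) : derivable f 0 1 -> derivable (fun z => (f z^*)^*) 0 1.
Proof.
move=> /derivable_nmP[d fd]; apply/derivable_nmP; exists d^* => e /fd[r r0 rP].
exists r => // w; rewrite subr0 => wr.
have := rP w^*; rewrite subr0 nm_conj => /(_ wr) H; rewrite conjC0.
by rewrite conj_affine nm_conj.
Qed.

(** By the reality condition, conjugating an extension at p on both sides gives
    an extension at conj p. *)
Lemma extends_at_conj G g p e : (forall A, G A -> G (cmx A)) -> real_loop g ->
  extends_at G g p e -> extends_at G g (conjP p) (fun q => cmx (e (conjP q))).
Proof.
move=> Gc [V' [Vo' Vd' gV']] [W [V [[Wo Wp Vo Vd] [eh eG eE]]]].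
have [Yo Yd] := open_denseI (open_dense_conjP (conj Vo Vd)) (conj Vo' Vd').
exists (conjP @^-1` W), (conjP @^-1` V `&` V'); split; split=> //.
- exact: open_conjP.
- by rewrite /= conjPK.
- apply/holo_onP => q /= Wq; have /holo_onP/(_ _ Wq) eq := eh => i j.
  apply: der_ext (der_conj (eq i j)) => z.
  by rewrite mxE conjP_chart.
- by move=> q Wq; apply: Gc; exact: eG.
- by move=> q Wq [Vq Vq']; rewrite eE// -[RHS]gV'.
Qed.

End Conj.

(** * The loops of isotropic lines *)

Section Gen.
Variable (C : numClosedFieldType).

Lemma pmx_conjv t (k : 'cV[C]_7) : pmx t (cj k) = pmx t^-1 k.
Proof.
by rewrite pmx_inv pmx_projm /projm !projl_tr cjK [1%:M - projl (cj k) - _]addrAC.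
Qed.

Lemma perp_part_conj (l k : 'cV[C]_7) : perp_part (cj l) (cj k) = cj (perp_part l k).
Proof.
rewrite /perp_part nrm_conj dot_conj cjD cjN cjZ; congr (_ - _ *: _).
by rewrite rmorphM /= fmorphV /= nrm_real.
Qed.

Lemma adm_conj (l k : 'cV[C]_7) : adm l k -> adm (cj l) (cj k).
Proof.
move=> lk; have [ln kn lck m0 cx] := lk; split; try exact: null_conj.
- by rewrite dot_conj lck rmorph0.
- rewrite perp_part_conj; apply: contra_neq m0 => h.
  by rewrite -[perp_part l k]cjK h cj0.
- by rewrite perp_part_conj crossO_cj cx cj0.
Qed.

(** The homographic function in the chart at infinity. *)
Lemma mob_inf (a b z : C) : z != 0 -> (z^-1 - b) / (z^-1 - a) = (1 - b * z) / (1 - a * z).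
Proof.
move=> z0.
have h c : z^-1 - c = (1 - c * z) / z by rewrite mulrBl mulfK// div1r.
by rewrite !h invf_div mulrA divfK.
Qed.

Lemma invmx_orth n (A : 'M[C]_n) : A^T *m A = 1%:M -> invmx A = A^T.
Proof.
move=> AA; have [_ Au] := mulmx1_unit AA.
by rewrite -[LHS]mul1mx -AA mulmxK.
Qed.
End Gen.

Section Loops.
Context {R : realType}.
Local Notation C := (Cplx R).
Local Notation M7 := 'M[Cplx R]_7.
Local Notation cmx := (map_mx (fun z : C => z^*)).
Implicit Types (z w a b : C) (p q : CP1 R) (U V W : set (CP1 R)) (g e : CP1 R -> M7) (G : set M7).

Lemma moebius_der a b p : p <> Some a -> derivable (fun z => moebius a b (chart p z)) 0 1.
Proof.
have dB x y z : derivable (fun w : C => x + w - y) z 1.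
  exact: (@derB _ (fun w => x + w) (fun=> y) z (@derD _ (fun=> x) (fun w => w) z (@der_cst _ x z) (@der_id _ z)) (@der_cst _ y z)).
case: p => [c ca|_].
  apply: (@der_quo _ (fun w => c + w - a) (fun w => c + w - b) 0 (dB c a 0) (dB c b 0)).
  by rewrite addr0 subr_eq0; apply/eqP => h; apply: ca; rewrite h.
have dM x : derivable (fun w : C => 1 - x * w) 0 1.
  exact: (@derB _ (fun=> 1) (fun w => x * w) 0 (@der_cst _ 1 0)
    (@derM _ (fun=> x) (fun w => w) 0 (@der_cst _ x 0) (@der_id _ 0))).
apply: (der_ext (f := fun w => (1 - b * w) / (1 - a * w))) => [w|].
  rewrite /=; have [->|w0] := eqVneq w 0; first by rewrite !mulr0 !subr0 divr1.
  by rewrite /= mob_inf.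
apply: (@der_quo _ (fun w => 1 - a * w) (fun w => 1 - b * w) 0 (dM a) (dM b)).
by rewrite mulr0 subr0 oner_eq0.
Qed.

Lemma moebius_inv a b q : moebius b a q = (moebius a b q)^-1.
Proof. by case: q => [z|] /=; rewrite ?invr1// invf_div. Qed.

Lemma moebius_conj a b q : (moebius a b (conjP q))^* = moebius a^* b^* q.
Proof. by case: q => [z|] /=; rewrite ?conjC1// rmorphM /= fmorphV /= !rmorphB /= !conjCK. Qed.

(** The loop p_(alpha,L) in terms of a vector k spanning L; it makes sense at
    every point of the sphere because moebius is total. *)
Definition line_loop a k q : M7 := pmx (moebius a a^* q) k.

Lemma loop_lineE a k : null k -> loop_line a <[k]>%VS = line_loop a k.
Proof.
move=> kn; apply/funext => q; have := loop_line_gen kn a q.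
rewrite (moebius_inv a a^*) => ->; exact: esym (pmx_projm _ _).
Qed.

Definition pair_loop a l k q : M7 := line_loop a l q *m line_loop a k q.

Lemma loop_pairE a l k : null l -> null k -> loop_pair a <[l]>%VS <[k]>%VS = pair_loop a l k.
Proof. by move=> ln kn; rewrite /loop_pair !loop_lineE. Qed.

Lemma line_loop_cj a k q : line_loop a^* (cj k) q = line_loop a k q.
Proof. by rewrite /line_loop pmx_conjv moebius_inv conjCK invrK. Qed.

(** Passing to conjugate vectors exchanges the two poles. *)
Lemma pair_loop_cj a l k : pair_loop a^* (cj l) (cj k) = pair_loop a l k.
Proof. by apply/funext => q; rewrite /pair_loop !line_loop_cj. Qed.

Lemma line_loop_real a k q : cmx (line_loop a k (conjP q)) = line_loop a k q.
Proof.
by rewrite /line_loop pmx_conj moebius_conj conjCK -moebius_inv.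
Qed.

Lemma pair_loop_real a l k q : cmx (pair_loop a l k (conjP q)) = pair_loop a l k q.
Proof.
exact: (etrans (cmxM _ _) (congr2 (fun A B => A *m B) (line_loop_real a l q) (line_loop_real a k q))).
Qed.

Lemma real_loop_pair_loop a l k : real_loop (pair_loop a l k).
Proof.
exists setT; split; [exact: openT| |].
  by move=> U off_poles _; rewrite setIT.
by move=> q _; exact: pair_loop_real.
Qed.

Definition off_poles a := ~` [set (Some a : CP1 R)] `&` ~` [set (Some a^* : CP1 R)].

Lemma open_dense_off_poles a : open_dense (off_poles a).
Proof. by apply: open_denseI; exact: open_dense_setC1. Qed.

Lemma off_poles_some a z : off_poles a (Some z) <-> z != a /\ z != a^*.
Proof.
split=> [[h1 h2]|[/eqP h1 /eqP h2]].
  by split; apply/eqP => h; [apply: h1|apply: h2]; rewrite h.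
by split=> -[].
Qed.

Lemma off_poles_none a : off_poles a None. Proof. by split. Qed.

Lemma moebius_neq0 a q : off_poles a q -> moebius a a^* q != 0.
Proof.
case: q => [z /off_poles_some[h1 h2]|_] /=; last exact: oner_neq0.
by rewrite mulf_neq0// ?invr_eq0 subr_eq0.
Qed.

Lemma holo_line_loop a k : holo_on (off_poles a) (line_loop a k).
Proof.
apply/holo_onP => p [p1 p2].
have d1 : derivable (fun z => moebius a a^* (chart p z) - 1) 0 1.
  exact: (@derB _ (fun z => moebius a a^* (chart p z)) (fun=> 1) 0 (@moebius_der a a^* p p1) (@der_cst _ 1 0)).
have d2 : derivable (fun z => moebius a^* a (chart p z) - 1) 0 1.
  exact: (@derB _ (fun z => moebius a^* a (chart p z)) (fun=> 1) 0 (@moebius_der a^* a p p2) (@der_cst _ 1 0)).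
have -> : (fun z => line_loop a k (chart p z)) = (fun z => 1%:M + (moebius a a^* (chart p z) - 1) *: (projl k)^T
    + (moebius a^* a (chart p z) - 1) *: projl k).
  by apply/funext => z; rewrite /line_loop /pmx -moebius_inv.
exact: (mderD (mderD (@mder_cst _ _ _ _ 0) (mderZ d1 (@mder_cst _ _ _ _ 0))) (mderZ d2 (@mder_cst _ _ _ _ 0))).
Qed.

Lemma holo_pair_loop a l k : holo_on (off_poles a) (pair_loop a l k).
Proof. exact: holo_onM (@holo_line_loop a l) (@holo_line_loop a k). Qed.

Lemma autO_pair_loop a l k q : adm l k -> off_poles a q -> autO (pair_loop a l k q).
Proof. by move=> lk Uq; exact: (adm_autO lk (moebius_neq0 Uq)). Qed.

Definition trL g : CP1 R -> M7 := fun q => (g q)^T.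

Lemma holo_trL U g : holo_on U g -> holo_on U (trL g).
Proof. by move=> /holo_onP gU; apply/holo_onP => p Up; exact: (mder_tr (gU p Up)). Qed.

Lemma invL_pair_loop a l k q : adm l k -> off_poles a q -> invL (pair_loop a l k) q = trL (pair_loop a l k) q.
Proof. by move=> lk Uq; apply: invmx_orth; have [] := autO_pair_loop lk Uq. Qed.

Lemma pair_loop_none a l k : pair_loop a l k None = 1%:M.
Proof. exact: (etrans (congr2 (fun A B => A *m B) (pmx1 l) (pmx1 k)) (mul1mx _)). Qed.

End Loops.

(** * Membership of the loops in the rational group *)

Lemma sub_neq (V : zmodType) (x y : V) : x - y != 0 -> x != y.
Proof. by rewrite subr_eq0. Qed.

Lemma scale_mid (K : comNzRingType) n (c : K) (A B D : 'M[K]_n) :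
  A *m (c *: B) *m D = c *: (A *m B *m D).
Proof. by rewrite -scalemxAr -scalemxAl. Qed.

Section Pole0.
Variable K : numClosedFieldType.
Implicit Types (a z : K) (l k : 'cV[K]_7).

Lemma pole_clear a z l k : dotC l (cj k) = 0 -> z - a^* != 0 -> z - a != 0 ->
  (z - a^*) *: pair_poly ((z - a) / (z - a^*)) l k =
  (z - a) *: (pmx ((z - a^*) / (z - a)) l *m pmx ((z - a^*) / (z - a)) k).
Proof.
move=> lk z1 z2.
have t0 : (z - a) / (z - a^*) != 0 by rewrite mulf_neq0 ?invr_eq0.
by rewrite (pair_polyE lk t0) scalerA mulrC divfK// invf_div.
Qed.

Lemma pole_residue_neq0 a l k : a^* != a -> adm l k ->
  (a - a^*) *: pair_poly ((a - a) / (a - a^*)) l k <> 0.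
Proof.
move=> ca lk; rewrite subrr mul0r => /eqP.
by rewrite scaler_eq0 subr_eq0 eq_sym (negPf ca) /= (negPf (pair_poly0_neq0 lk)).
Qed.
End Pole0.

Section Main.
Context {R : realType}.
Local Notation C := (Cplx R).
Local Notation M7 := 'M[Cplx R]_7.
Local Notation cmx := (map_mx (fun z : C => z^*)).
Implicit Types (z w a b : C) (p q : CP1 R) (U V W : set (CP1 R)) (g e h : CP1 R -> M7) (G : set M7).
Implicit Types (l k : 'cV[C]_7).

Lemma G2M (A B : M7) : G2 A -> G2 B -> G2 (A *m B).
Proof. by move=> /G2P AA /G2P BB; apply/G2P; exact: (autO_mul AA BB). Qed.

Lemma G2_conj (A : M7) : G2 A -> G2 (cmx A).
Proof. by move=> /G2P AA; apply/G2P; exact: (autO_conj AA). Qed.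

Lemma setT_M (A B : M7) : [set: M7] A -> [set: M7] B -> [set: M7] (A *m B).
Proof. by []. Qed.

Section Pole.
Variables (a : C) (l k : 'cV[C]_7).
Hypotheses (ca : a^* != a) (lk : adm l k).
Let tau z : C := (z - a) / (z - a^*).
Let F z : M7 := (z - a^*) *: pair_poly (tau z) l k.

(** The value at the pole of the extension is a nonzero multiple of the residue
    of the admissible pair. *)
Lemma pair_loop_pole : exists2 e,
  extends_at setT (fun q => local_coord (pt a) q *: pair_loop a l k q) (pt a) e & e (pt a) <> 0.
Proof.
have Fn : \forall z \near a, mder F z /\ [set: M7] (F z).
  have : \forall z \near a, z != a^* by apply: near_neq; rewrite eq_sym.
  apply: filterS => z zc; split=> //.
  have cd b : derivable (fun x : C => x - b) z 1.
    exact: (@derB _ (fun x => x) (fun=> b) z (@der_id _ z) (@der_cst _ b z)).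
  have td : derivable tau z 1.
    by apply: (@der_quo _ (fun x => x - a^*) (fun x => x - a) z (cd _) (cd _)); rewrite subr_eq0.
  exact: (mderZ (cd a^*) (@mder_pair_poly _ tau l k z td)).
exists (fun q => if q is Some z then F z else 0).
  apply: (@extends_at_some _ setT _ a F (off_poles a) (open_dense_off_poles a) Fn).
  apply: near_punctS (mob_near ca) => z [z1 z2] _.
  exact: (pole_clear (adm_perp lk) z1 z2).
exact: (pole_residue_neq0 ca lk).
Qed.
End Pole.

(** The pole at conj a is the pole of the loop of the conjugate pair. *)
Lemma pair_loop_pole_conj a l k : a^* != a -> adm l k -> exists2 e,
  extends_at setT (fun q => local_coord (pt a^*) q *: pair_loop a l k q) (pt a^*) e & e (pt a^*) <> 0.
Proof.
move=> ca lk; rewrite -pair_loop_cj; apply: pair_loop_pole; last exact: adm_conj.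
by rewrite conjCK eq_sym.
Qed.

Lemma pair_loop_ext a l k p : adm l k -> off_poles a p -> extends_at G2 (pair_loop a l k) p (pair_loop a l k).
Proof.
move=> lk; apply: holo_extends; [exact: open_dense_off_poles|exact: holo_pair_loop|] => q Uq.
by apply/G2P; exact: autO_pair_loop.
Qed.

Lemma tr_pair_loop_ext a l k p : adm l k -> off_poles a p -> extends_at G2 (trL (pair_loop a l k)) p (trL (pair_loop a l k)).
Proof.
move=> lk; apply: holo_extends; [exact: open_dense_off_poles|apply: holo_trL; exact: holo_pair_loop|] => q Uq.
by apply/G2P; apply: (autO_tr (autO_pair_loop lk Uq)).
Qed.

Lemma off_poles_cases a p : [\/ p = pt a, p = pt a^* | off_poles a p].
Proof.
have [->|pa] := pselect (p = pt a); first by constructor 1.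
have [->|pc] := pselect (p = pt a^*); first by constructor 2.
by constructor 3.
Qed.

Lemma Lminus_pair_loop a l k : a^* != a -> adm l k -> Lminus (pair_loop a l k).
Proof.
move=> ca lk; split; last exact: real_loop_pair_loop.
- have [Uo Ud] := open_dense_off_poles a; exists (off_poles a); split=> //; first exact: holo_pair_loop.
  by move=> q Uq; apply/G2P; exact: autO_pair_loop.
- move=> p; case: (off_poles_cases a p) => [->|->|Up].
  + by exists 1%N; have [e ee _] := pair_loop_pole ca lk; exists e.
  + by exists 1%N; have [e ee _] := pair_loop_pole_conj ca lk; exists e.
  + exists 0%N; exists (pair_loop a l k).
    apply: (extends_at_congr (open_dense_off_poles a) _ (extends_at_sub _ (pair_loop_ext lk Up))) => // q _.
    by rewrite expr0 scale1r.
- have ee := pair_loop_ext lk (off_poles_none a); split; first by exists (pair_loop a l k).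
  by rewrite (loop_valueE ee) pair_loop_none.
Qed.

Section Dress.
Variables (a : C) (l k : 'cV[C]_7) (h e : CP1 R -> M7).
Hypotheses (ca : a^* != a) (lk : adm l k) (he : extends_at G2 h (pt a) e).

Let e1 z := e (Some z).
Let k' := (e1 a)^T *m k.
Let pKh := mulL (mulL (line_loop a k) h) (invL (line_loop a k')).

Lemma extension_near : \forall z \near a, mder e1 z /\ autO (e1 z).
Proof. by have [H _] := extends_at_someP he; apply: filterS H => z [ez /G2P]. Qed.

(** The local extension of the first dressing, viewed on the sphere; its
    existence makes the value at alpha meaningful. *)
Lemma single_dressing : exists S : C -> M7,
  [/\ extends_at SO7 pKh (pt a) (fun q => if q is Some z then S z else 0), SO_near a S &
   near_punct a (fun z => S z = pmx (mob a z) k *m e1 z *m pmx (mob a z)^-1 k')].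
Proof.
have [ln kn _ _ _] := lk.
have [S SSO SE] := dressing_local ca kn (SO_near_e extension_near); exists S; split=> //.
have [_ [V Vod VE]] := extends_at_someP he.
have [e1d [e1o _]] := nbhs_singleton extension_near.
have k'n : null k' := orth_null e1o kn.
have Sn : \forall z \near a, mder S z /\ SO7 (S z).
  by apply: filterS SSO => z [? ? ?]; split.
apply: (@extends_at_some _ SO7 pKh a S V Vod Sn).
have := near_punctI (near_punctI SE (near_punct_near VE)) (mob_near ca).
apply: near_punctS => z [[Sz Vz] [z1 z2]] /Vz ez; rewrite Sz /e1 ez.
have t0 : mob a z != 0 by rewrite mulf_neq0 ?invr_eq0.
have iE : invmx (pmx (mob a z) k') = pmx (mob a z)^-1 k'.
  exact: (etrans (invmx_orth (pmx_orth k'n t0)) (pmx_tr _ _)).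
exact: (congr1 (fun A => pmx (mob a z) k *m h (Some z) *m A) (esym iE)).
Qed.

(** The dressing near the pole, in the language of loops: S is the value at the
    pole of the first dressing. *)
Lemma pair_dressing (S : M7) : S = loop_value SO7 pKh (pt a) ->
  let l' := S^T *m l in
  S^T *m S = 1%:M /\ adm l' k' /\ holo_at G2 (mulL (mulL (pair_loop a l k) h) (invL (pair_loop a l' k'))) (pt a).
Proof.
have [S1 [SE SSO SP]] := single_dressing.
rewrite (loop_valueE SE) => -> l'; split; first by have [] := nbhs_singleton SSO.
have [l'k' [ht htn htE]] := pair_dressing_local ca lk extension_near SSO SP.
split=> //; exists (fun q => if q is Some z then ht z else 0).
have [_ [V Vod VE]] := extends_at_someP he.
have htn' : \forall z \near a, mder ht z /\ G2 (ht z).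
  by apply: filterS htn => z [hz /G2P].
apply: (@extends_at_some _ G2 _ a ht V Vod htn').
have := near_punctI (near_punctI htE (near_punct_near VE)) (mob_near ca).
apply: near_punctS => z [[hz Vz] [z1 z2]] /Vz ez; rewrite hz /e1 ez.
have Uz : off_poles a (Some z) := proj2 (off_poles_some a z) (conj (sub_neq z2) (sub_neq z1)).
exact: (congr1 (fun A => pair_loop a l k (Some z) *m h (Some z) *m A) (esym (invL_pair_loop l'k' Uz))).
Qed.

End Dress.

(** Away from the two poles every factor of the dressed loop is holomorphic or
    has the pole order of h; at the poles it is holomorphic, by hypothesis at
    alpha and then by reality at conj alpha. *)
Lemma Lminus_dressed a l k l' k' h : a^* != a -> adm l k -> adm l' k' -> Lminus h ->
  let g := mulL (mulL (pair_loop a l k) h) (invL (pair_loop a l' k')) in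
  holo_at G2 g (pt a) -> [/\ Lminus g, holo_at G2 g (pt a) & holo_at G2 g (pt a^*)].
Proof.
move=> ca lk lk' [hl hm [hN hN1] hr] g ga.
pose g1 := mulL (mulL (pair_loop a l k) h) (trL (pair_loop a l' k')).
have gg1 q : off_poles a q -> g1 q = g q.
  by move=> Uq; rewrite /g1 /g /mulL (invL_pair_loop lk' Uq).
have gr : real_loop g.
  apply: (@real_loopM _ (mulL (pair_loop a l k) h)).
    exact: real_loopM (real_loop_pair_loop a l k) hr.
  exists setT; split; [exact: openT| |].
    by move=> U Une _; rewrite setIT.
  move=> q _; exact: (etrans (map_invmx (@Num.conj C) _) (congr1 invmx (pair_loop_real a l' k' q))).
split=> //; last first.
  have [e ge] := ga; exists (fun q => cmx (e (conjP q))).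
  exact: (@extends_at_conj _ G2 g (pt a) e G2_conj gr ge).
split=> //.
- have [Uo Ud] := open_dense_off_poles a.
  have Pl l1 k1 : adm l1 k1 -> is_loop G2 (pair_loop a l1 k1).
    by move=> lk1; exists (off_poles a); split=> //; [exact: holo_pair_loop|move=> q Uq; apply/G2P; exact: autO_pair_loop].
  apply: (is_loop_congr (open_dense_off_poles a) gg1); apply: (is_loopM G2M).
    exact: (is_loopM G2M (Pl _ _ lk) hl).
  exists (off_poles a); split=> //; first by apply: holo_trL; exact: holo_pair_loop.
  by move=> q Uq; apply/G2P; exact: (autO_tr (autO_pair_loop lk' Uq)).
- have m0 p : holo_at G2 g p -> exists n, holo_at setT (fun q => local_coord p q ^+ n *: g q) p.
    move=> [e ge]; exists 0%N, e; apply: (extends_at_congr (open_dense_off_poles a) _ (extends_at_sub _ ge)) => // q _.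
    by rewrite expr0 scale1r.
  move=> p; case: (off_poles_cases a p) => [->|->|Up]; [exact: m0|apply: m0|].
    by have [e ge] := ga; exists (fun q => cmx (e (conjP q)));
      exact: (@extends_at_conj _ G2 g (pt a) e G2_conj gr ge).
  have [n [e he]] := hm p; exists n; exists (mulL (mulL (pair_loop a l k) e) (trL (pair_loop a l' k'))).
  have PE : extends_at setT (pair_loop a l k) p (pair_loop a l k) := @extends_at_sub _ _ setT _ _ _ (fun _ _ => I) (pair_loop_ext lk Up).
  have TE : extends_at setT (trL (pair_loop a l' k')) p (trL (pair_loop a l' k')) := @extends_at_sub _ _ setT _ _ _ (fun _ _ => I) (tr_pair_loop_ext lk' Up).
  apply: (extends_at_congr (open_dense_off_poles a) _ (extends_atM setT_M (extends_atM setT_M PE he) TE)) => q Uq.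
  by rewrite -gg1//; exact: scale_mid.
- have [e he eN] := holo_at_value hN.
  have gE : extends_at G2 g None (mulL (mulL (pair_loop a l k) e) (trL (pair_loop a l' k'))).
    apply: (extends_at_congr (open_dense_off_poles a) gg1).
    exact: (extends_atM G2M (extends_atM G2M (pair_loop_ext lk (off_poles_none a)) he) (tr_pair_loop_ext lk' (off_poles_none a))).
  split; first by eexists; exact: gE.
  rewrite (loop_valueE gE) /mulL /trL eN hN1 !pair_loop_none.
  by rewrite trmx1 !mulmx1.
Qed.

End Main.

(** * The proposition *)

Theorem proposition6p10 (R : realType) (alpha : Cplx R)
    (L K : {vspace 'cV[Cplx R]_7}) (h : CP1 R -> 'M[Cplx R]_7) :
  alpha \isn't Num.real ->
  admissible L K ->
  Lminus h ->
  holo_at G2 h (pt alpha) ->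
  let K' := mximage (invmx (loop_value G2 h (pt alpha))) K in
  let pKh := mulL (mulL (loop_line alpha K) h) (invL (loop_line alpha K')) in
  let L' := mximage (invmx (loop_value SO7 pKh (pt alpha))) L in
  let pLKh := mulL (mulL (loop_pair alpha L K) h) (invL (loop_pair alpha L' K')) in
  [/\ admissible L' K',
      [/\ Lminus (loop_pair alpha L' K'),
          simple_pole (loop_pair alpha L' K') (pt alpha)
        & simple_pole (loop_pair alpha L' K') (pt alpha^*)]
    & [/\ Lminus pLKh,
          holo_at G2 pLKh (pt alpha)
        & holo_at G2 pLKh (pt alpha^*)]].
Proof.
rewrite CrealE => ca LK hL ha; have [Ll Kl _ _] := LK.
have [[l LE ln] [k KE kn]] := (line_gen Ll, line_gen Kl).
have lk : adm l k by apply/(admissibleP ln kn); rewrite -LE -KE.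
have [e he eH] := holo_at_value ha.
have [_ [HH _]] := nbhs_singleton (extension_near he).
pose k' := (e (pt alpha))^T *m k; have k'n : null k' := orth_null HH kn.
have [SS [l'k' ga]] := pair_dressing ca lk he erefl.
move: SS l'k' ga; set S := loop_value SO7 _ _ => SS; set l' := S^T *m l => l'k' ga.
have [l'n _ _ _ _] := l'k'.
move=> K' pKh L' pLKh.
have K'E : K' = <[k']>%VS by rewrite /K' -eH (invmx_orth HH) KE mximage_line.
have pKhE : pKh = mulL (mulL (line_loop alpha k) h) (invL (line_loop alpha k')).
  by rewrite /pKh K'E KE (loop_lineE alpha kn) (loop_lineE alpha k'n).
have L'E : L' = <[l']>%VS by rewrite /L' pKhE (invmx_orth SS) LE mximage_line.
have pE : loop_pair alpha L' K' = pair_loop alpha l' k' by rewrite L'E K'E loop_pairE.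
have pLKhE : pLKh = mulL (mulL (pair_loop alpha l k) h) (invL (pair_loop alpha l' k')).
  by rewrite /pLKh pE LE KE (loop_pairE alpha ln kn).
rewrite pLKhE pE L'E K'E; split; first exact: (proj2 (admissibleP l'n k'n) l'k').
  split; first exact: (Lminus_pair_loop ca l'k').
    have [e1 he1 n1] := pair_loop_pole ca l'k'; exact: (ex_intro _ e1 (conj he1 n1)).
  have [e1 he1 n1] := pair_loop_pole_conj ca l'k'; exact: (ex_intro _ e1 (conj he1 n1)).
exact: (Lminus_dressed ca lk l'k' hL ga).
Qed.
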